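(* For all $\zeta,\delta\in(0,1)$ and integer $d\ge 2$ there is $C_0$ such that for all $C\ge C_0$ the following holds. For every $n$, let $T$ be a tree on $n$ vertices with maximum degree at most $d$ containing at least $\zeta n$ leaves, let $G_0$ be a graph on vertex set $[n]$ with minimum degree at least $\delta n$, and suppose $G\sim G_0\cup\mathbf{G}(n,C/n)$ is uniformly edge-coloured in $[n-1]$. Then, with probability tending to $1$ as $n\to\infty$, $G$ contains a rainbow copy of $T$.
   Context: $\mathbf{G}(n,p)$ is the binomial random graph on $[n]$ with edge probability $p$; $G_0\cup\mathbf{G}(n,p)$ has as edge set the union of both edge sets. Uniformly edge-coloured in $\mathcal{C}$: each edge independently gets a uniformly random colour from $\mathcal{C}$. Rainbow: all edges have distinct colours. *)

(* Defs.v *)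
From HB Require Import structures.
From mathcomp Require Import all_boot all_order all_algebra.

Set Implicit Arguments.
Unset Strict Implicit.
Unset Printing Implicit Defensive.

Import Order.TTheory GRing.Theory Num.Theory.

Definition pairs (V : finType) : {set {set V}} := [set e : {set V} | #|e| == 2].

Record sgraph (V : finType) := SGraph {
  edges : {set {set V}};
  edges_pairs : edges \subset pairs V
}.

HB.instance Definition _ (V : finType) := [isSub for @edges V].
HB.instance Definition _ (V : finType) := [Finite of sgraph V by <:].

Notation edge_of G := {e | e \in edges G}.

Lemma union_pairs (V : finType) (G H : sgraph V) :
  edges G :|: edges H \subset pairs V.
Proof. by rewrite subUset !edges_pairs. Qed.

Definition gunion (V : finType) (G H : sgraph V) : sgraph V :=
  SGraph (union_pairs G H).

Definition adj (V : finType) (G : sgraph V) : rel V :=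
  fun x y => [set x; y] \in edges G.

Definition deg (V : finType) (G : sgraph V) (v : V) : nat := #|[set w | adj G v w]|.

Definition leaves (V : finType) (G : sgraph V) : {set V} := [set v | deg G v == 1].

Definition gconnected (V : finType) (G : sgraph V) : Prop :=
  0 < #|V| /\ forall x y : V, connect (adj G) x y.

(* Since [adj] is symmetric, an edge traversed back and forth is a [ucycle] of
   length 2; the cycles of a simple graph are those of length at least 3. *)
Definition gacyclic (V : finType) (G : sgraph V) : Prop :=
  forall s : seq V, ucycle (adj G) s -> size s < 3.

Definition is_tree (V : finType) (G : sgraph V) : Prop :=
  gconnected G /\ gacyclic G.

Definition copy_edges (V W : finType) (T : sgraph V) (f : V -> W) : {set {set W}} :=
  [set f @: e | e : {set V} in edges T].

Definition rainbow (W K : finType) (G : sgraph W) (c : {ffun edge_of G -> K})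
    (S : {set {set W}}) : bool :=
  [forall e1 : edge_of G, forall e2 : edge_of G,
    [&& val e1 \in S, val e2 \in S & c e1 == c e2] ==> (e1 == e2)].

Definition has_rainbow_copy (V W K : finType) (T : sgraph V) (G : sgraph W)
    (c : {ffun edge_of G -> K}) : bool :=
  [exists f : {ffun V -> W},
    [&& injectiveb f, copy_edges T f \subset edges G & rainbow c (copy_edges T f)]].

Section RandomColouredGraphs.
Local Open Scope ring_scope.
Variable R : realFieldType.

(* The mass of [H] under G(V, p): every pair is an edge independently with
   probability [p]. *)
Definition Gnp_mass (V : finType) (p : R) (H : sgraph V) : R :=
  \prod_(e in pairs V) (if e \in edges H then p else 1 - p).

(* The mass of [c] when every edge of [G] gets independently a uniform colour
   of [K]. *)
Definition colouring_mass (V K : finType) (G : sgraph V)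
    (c : {ffun edge_of G -> K}) : R :=
  \prod_(e : edge_of G) (#|K|%:R)^-1.

(* The colouring is drawn conditionally on the random graph, on the edges of
   the union only. *)
Definition perturbed_prob (V K : finType) (G0 : sgraph V) (p : R)
    (event : forall G : sgraph V, {ffun edge_of G -> K} -> bool) : R :=
  \sum_(H : sgraph V) Gnp_mass p H *
    \sum_(c : {ffun edge_of (gunion G0 H) -> K} | event _ c) colouring_mass c.

Lemma Gnp_mass_sum (V : finType) (p : R) : \sum_(H : sgraph V) Gnp_mass p H = 1.
Proof.
transitivity (\prod_(e : {set V})
    ((if e \in pairs V then p else 0) + (if e \in pairs V then 1 - p else 1))).
  rewrite bigA_distr (bigID (fun J : {set {set V}} => J \subset pairs V)) /=.
  rewrite [X in _ = _ + X]big1 ?addr0 => [|J /subsetPn[e eJ eV]]; last first.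
    by rewrite (bigD1 e) //= eJ (negPf eV) mul0r.
  rewrite (reindex_omap (@edges V) insub) => [|J sJ]; last by rewrite insubT.
  apply: eq_big => [H|H _]; first by rewrite edges_pairs valK eqxx.
  rewrite /Gnp_mass [LHS]big_mkcond; apply: eq_bigr => e _.
  case: ifPn => // eV; case: ifP => // eH.
  by rewrite (subsetP (edges_pairs H)) in eV.
by rewrite big1 // => e _; case: ifP => _; rewrite ?subrKC ?add0r.
Qed.

Lemma colouring_mass_sum (V K : finType) (G : sgraph V) : (0 < #|K|)%N ->
  \sum_(c : {ffun edge_of G -> K}) colouring_mass c = 1.
Proof.
move=> K0; rewrite /colouring_mass sumr_const card_ffun prodr_const.
by rewrite -[LHS]mulr_natl natrX -exprMn divff ?expr1n // pnatr_eq0 -lt0n.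
Qed.

Definition prob_rainbow_copy (V : finType) (n : nat) (T : sgraph V)
    (G0 : sgraph 'I_n) (p : R) : R :=
  @perturbed_prob _ 'I_n.-1 G0 p (fun G c => has_rainbow_copy T c).

End RandomColouredGraphs.

(* Main.v *)
Require Import Defs.
From HB Require Import structures.
From mathcomp Require Import all_boot all_order all_algebra.
From mathcomp Require Import ring lra zify.

Set Implicit Arguments.
Unset Strict Implicit.
Unset Printing Implicit Defensive.

Import Order.TTheory GRing.Theory Num.Theory.

(* The colouring of the perturbed graph is first replaced, one edge at a time,
   by a model in which every pair (edge, colour) is present independently, in
   three independent rounds (McDiarmid's coupling): given the other edges, the
   event only asks that the colour set of one edge meets a fixed set.

   Fix a lower-regular pair (A0, B0) of G0 and let P0 be a set of m parents of
   distinct leaves.  With the first round we embed the tree without these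
   leaves greedily.  Any linearly many vertices, vertices and colours span a
   coloured edge, so only few vertices ever get stuck, and those use G0-edges
   into a reserve, with reserved colours.  The missing leaves are matched the
   same way, stuck vertices being handled by a G0-edge and one exchange, until
   only equal-sized subsets of A0, B0 and of the colours are left.  The last
   two rounds contain a rainbow perfect matching there: a random sparse
   subgraph of the pair has a perfect matching, which yields a spread measure
   on rainbow perfect matchings; by the fragment argument of Park and Pham the
   second round misses only few edges of a typical one, and a second moment
   computation finds these in the third round. *)

(** * Spread hypergraphs and two rounds of exposure *)

(** The obstacle is exactness: a copy of [T] uses all n vertices and all n-1 colours, while G(n,C/n)
    alone leaves linearly many vertices isolated. So what is left at the end must be finished by
    edges of G0, and each of these carries a given colour with probability only about 1/n; the last
    two rounds rely on nothing else. A second moment over whole rainbow matchings is too weak: with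
    spread q = s^2 and p0 about 1/(3n), the variance bound is (1 + q/p0)^a - 1 with a linear in n,
    and s * n must grow for Hall's condition to survive sparsification. Replacing matchings by
    fragments replaces a by a much smaller t, and s = n^(1/8) / n then makes every error vanish. The
    constant C enters only through the coloured edges spanned by linear sets: there a union bound
    over 2^(3n) triples of sets has to be beaten. *)

Lemma ler_sum_subset (R : numDomainType) (J : finType) (P Q : pred J) (F : J -> R) :
  (forall j, Q j -> (0 <= F j)%R) -> (forall j, P j -> Q j) ->
  (\sum_(j | P j) F j <= \sum_(j | Q j) F j)%R.
Proof.
move=> F_ge0 PQ; rewrite [leRHS](bigID P) /= [X in (_ <= X + _)%R](eq_bigl P); last first.
  by move=> j; case: (boolP (P j)) => [/PQ ->|]; rewrite ?andbF.
by rewrite lerDl; apply: sumr_ge0 => j /andP[/F_ge0].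
Qed.

Lemma ler_sum_inj (R : numDomainType) (I J : finType) (P : pred I) (Q : pred J)
    (h : I -> J) (F : J -> R) :
  {in P &, injective h} -> (forall i, P i -> Q (h i)) -> (forall j, Q j -> (0 <= F j)%R) ->
  (\sum_(i | P i) F (h i) <= \sum_(j | Q j) F j)%R.
Proof.
move=> h_inj PQ F_ge0; rewrite -(big_imset F h_inj) /=.
by apply: ler_sum_subset => // j /imsetP[i Pi ->]; apply: PQ.
Qed.

Section Bernoulli.
Local Open Scope ring_scope.
Variables (R : realFieldType) (O : finType).
Implicit Types (p : O -> R) (S F T : {set O}).

Definition bern p S : R := \prod_x (if x \in S then p x else 1 - p x).

Lemma bern_ge0 p S : (forall x, 0 <= p x <= 1) -> 0 <= bern p S.
Proof.
move=> p01; apply: prodr_ge0 => x _; have /andP[? ?] := p01 x.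
by case: ifP => _ //; rewrite subr_ge0.
Qed.

Lemma bern_supset p F : \sum_(S : {set O} | F \subset S) bern p S = \prod_(x in F) p x.
Proof.
transitivity (\prod_x (p x + (if x \in F then 0 else 1 - p x))).
  rewrite bigA_distr [RHS](bigID (fun S : {set O} => F \subset S)) /= [X in _ = _ + X]big1.
    rewrite addr0; apply: eq_bigr => S FS; apply: eq_bigr => x _.
    by case: ifPn => // xS; case: ifP => // /(subsetP FS); rewrite (negPf xS).
  by move=> S /subsetPn[x xF xS]; rewrite (bigD1 x) //= (negPf xS) xF mul0r.
rewrite [RHS]big_mkcond; apply: eq_bigr => x _.
by case: ifP => _; rewrite ?addr0 // addrC subrK.
Qed.

Lemma bern_disjoint p F :
  \sum_(S : {set O} | [disjoint F & S]) bern p S = \prod_(x in F) (1 - p x).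
Proof.
transitivity (\prod_x ((if x \in F then 0 else p x) + (1 - p x))).
  rewrite bigA_distr [RHS](bigID (fun S : {set O} => [disjoint F & S])) /= [X in _ = _ + X]big1.
    rewrite addr0; apply: eq_bigr => S dFS; apply: eq_bigr => x _.
    by case: ifPn => // xS; case: ifP => // /(disjointFr dFS); rewrite xS.
  move=> S; rewrite -setI_eq0 => /set0Pn[x /setIP[xF xS]].
  by rewrite (bigD1 x) //= xS xF mul0r.
rewrite [RHS]big_mkcond; apply: eq_bigr => x _.
by case: ifP => _; rewrite ?add0r // subrKC.
Qed.

Lemma bern_sum p : \sum_S bern p S = 1.
Proof.
have := bern_supset p set0; rewrite big_set0 => <-.
by apply: eq_bigl => S; rewrite sub0set.
Qed.

Lemma sum_subset_expr (z : R) (H : {set O}) :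
  \sum_(T : {set O} | T \subset H) z ^+ #|T| = (1 + z) ^+ #|H|.
Proof.
transitivity (\prod_x ((if x \in H then z else 0) + 1)); last first.
  rewrite -prodr_const [RHS]big_mkcond; apply: eq_bigr => x _.
  by case: ifP => _; rewrite ?add0r // addrC.
rewrite bigA_distr [RHS](bigID (fun S : {set O} => S \subset H)) /= [X in _ = _ + X]big1.
  rewrite addr0; apply: eq_bigr => S SH; rewrite -prodr_const [LHS]big_mkcond.
  by apply: eq_bigr => x _; case: ifP => // /(subsetP SH) ->.
by move=> S /subsetPn[x xS xH]; rewrite (bigD1 x) //= xS (negPf xH) mul0r.
Qed.

End Bernoulli.

Section Spread.
Local Open Scope ring_scope.
Variables (R : realFieldType) (O I : finType).
Variables (p : O -> R) (p0 q : R) (good : pred I) (mu : I -> R).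
Hypothesis p01 : forall x, 0 <= p x <= 1.
Hypothesis p0_gt0 : 0 < p0.
Hypothesis q_ge0 : 0 <= q.
Hypothesis mu_ge0 : forall i, 0 <= mu i.

(** Chebyshev for [X], in which every index is weighted by the inverse probability of [T i], so that
    the mean is exactly M. A pair (i, j) contributes the inverse probability of the overlap, at most
    the sum of p0^-|S| over the subsets S of the overlap; for each S the spread condition then
    bounds the sum over j. *)
Lemma second_moment (J : pred I) (T : I -> {set O}) (t : nat) (M1 : R) :
    0 < M1 -> M1 <= \sum_(i | J i) mu i ->
    (forall i x, J i -> x \in T i -> p0 <= p x) ->
    (forall i, J i -> (#|T i| <= t)%N) ->
    (forall S : {set O}, \sum_(i | J i && (S \subset T i)) mu i <= q ^+ #|S|) ->
  1 - ((1 + q / p0) ^+ t - 1) / M1 ^+ 2 <=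
  \sum_(W : {set O} | [exists i, J i && (T i \subset W)]) bern p W.
Proof.
move=> M1_gt0 M1le pT Tt spread; set M := \sum_(i | J i) mu i in M1le.
pose pr (S : {set O}) := \prod_(x in S) p x.
pose X (W : {set O}) := \sum_(i | J i && (T i \subset W)) mu i / pr (T i).
have pr_gt0 i (S : {set O}) : J i -> S \subset T i -> 0 < pr S.
  move=> Ji ST; apply: prodr_gt0 => x xS.
  exact: lt_le_trans p0_gt0 (pT i x Ji (subsetP ST x xS)).
have EX : \sum_W bern p W * X W = M.
  transitivity (\sum_(i | J i) \sum_(W : {set O} | T i \subset W) bern p W * (mu i / pr (T i))).
    rewrite (eq_bigr (fun W : {set O} => \sum_(i | J i) if T i \subset W then
        bern p W * (mu i / pr (T i)) else 0)).
      by rewrite exchange_big; apply: eq_bigr => i Ji; rewrite -big_mkcond.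
    by move=> W _; rewrite mulr_sumr big_mkcondr.
  apply: eq_bigr => i Ji; rewrite -mulr_suml bern_supset -/(pr _).
  by rewrite mulrCA divff ?mulr1 // gt_eqF // (pr_gt0 i).
have M_gt0 : 0 < M by apply: lt_le_trans M1le.
have EX2 : \sum_W bern p W * X W ^+ 2 <= M ^+ 2 + ((1 + q / p0) ^+ t - 1).
  have -> : \sum_W bern p W * X W ^+ 2 =
      \sum_(i | J i) \sum_(j | J j) mu i * mu j / pr (T i :&: T j).
    transitivity (\sum_(i | J i) \sum_(j | J j) \sum_(W : {set O} | T i :|: T j \subset W)
         bern p W * ((mu i / pr (T i)) * (mu j / pr (T j)))).
      rewrite (eq_bigr (fun W : {set O} => \sum_(i | J i) \sum_(j | J j)
         if T i :|: T j \subset W then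
         bern p W * ((mu i / pr (T i)) * (mu j / pr (T j))) else 0)).
        rewrite exchange_big; apply: eq_bigr => i Ji; rewrite exchange_big.
        by apply: eq_bigr => j Jj; rewrite -big_mkcond.
      move=> W _; rewrite expr2 /X !mulr_suml mulr_sumr big_mkcondr.
      apply: eq_bigr => i Ji; case: ifP => Ti.
        rewrite !mulr_sumr big_mkcondr; apply: eq_bigr => j Jj.
        by rewrite subUset Ti.
      by rewrite big1 // => j _; rewrite subUset Ti.
    apply: eq_bigr => i Ji; apply: eq_bigr => j Jj; rewrite -mulr_suml bern_supset -/(pr _).
    have pi := pr_gt0 i (T i) Ji (subxx _); have pj := pr_gt0 j (T j) Jj (subxx _).
    have pij := pr_gt0 i (T i :&: T j) Ji (subsetIl _ _).
    have pU : pr (T i :|: T j) * pr (T i :&: T j) = pr (T i) * pr (T j).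
      rewrite /pr ![\prod_(x in _) _]big_mkcond -!big_split; apply: eq_bigr => x _ /=.
      by rewrite !inE; case: (_ \in _); case: (_ \in _); rewrite ?mulr1 ?mul1r.
    have pU0 : pr (T i :|: T j) = pr (T i) * pr (T j) / pr (T i :&: T j).
      by rewrite -pU mulfK // gt_eqF.
    by rewrite pU0; field; rewrite !gt_eqF.
  have le1 : \sum_(i | J i) \sum_(j | J j) mu i * mu j / pr (T i :&: T j) <=
      \sum_(i | J i) \sum_(S : {set O} | S \subset T i)
         mu i * ((p0^-1) ^+ #|S| * \sum_(j | J j && (S \subset T j)) mu j).
    apply: ler_sum => i Ji.
    have -> : \sum_(S : {set O} | S \subset T i)
         mu i * ((p0^-1) ^+ #|S| * \sum_(j | J j && (S \subset T j)) mu j) =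
       \sum_(j | J j) mu i * mu j * \sum_(S : {set O} | S \subset T i :&: T j) p0^-1 ^+ #|S|.
      rewrite (eq_bigr (fun S : {set O} => \sum_(j | J j)
          if S \subset T j then mu i * mu j * p0^-1 ^+ #|S| else 0)).
        rewrite exchange_big; apply: eq_bigr => j Jj.
        rewrite -big_mkcondr mulr_sumr; apply: eq_bigl => S; by rewrite subsetI.
      move=> S _; rewrite !mulr_sumr big_mkcondr; apply: eq_bigr => j Jj.
      by case: ifP => _ //; ring.
    apply: ler_sum => j Jj; rewrite sum_subset_expr ler_wpM2l ?mulr_ge0 ?mu_ge0 //.
    have pij := pr_gt0 i (T i :&: T j) Ji (subsetIl _ _).
    rewrite invf_ple ?posrE ?exprn_gt0 ?addr_gt0 ?invr_gt0 //.
    rewrite -exprVn -prodr_const; apply: ler_prod => x /setIP[xi xj].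
    rewrite invr_ge0 addr_ge0 ?invr_ge0 ?(ltW p0_gt0) //=.
    apply: le_trans (pT i x Ji xi); rewrite invf_ple ?posrE ?addr_gt0 ?invr_gt0 //.
    by rewrite lerDr.
  apply: le_trans le1 _.
  have le2 i : J i -> \sum_(S : {set O} | S \subset T i)
         mu i * ((p0^-1) ^+ #|S| * \sum_(j | J j && (S \subset T j)) mu j) <=
      mu i * (M + ((1 + q / p0) ^+ t - 1)).
    move=> Ji; rewrite -mulr_sumr ler_wpM2l ?mu_ge0 //.
    rewrite (bigD1 set0) ?sub0set //= cards0 expr0 mul1r lerD //.
      by rewrite le_eqVlt; apply/orP; left; apply/eqP; apply: eq_bigl => j; rewrite sub0set andbT.
    have lt_t : (1 + q / p0) ^+ #|T i| <= (1 + q / p0) ^+ t.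
      by rewrite ler_weXn2l ?Tt // lerDl divr_ge0 // ltW.
    rewrite lerBrDr; apply: le_trans lt_t.
    rewrite -sum_subset_expr [leRHS](bigD1 set0) ?sub0set //= cards0 expr0 [leRHS]addrC lerD2r.
    apply: ler_sum => S _; rewrite [leRHS]exprMn [leRHS]mulrC ler_wpM2l ?exprn_ge0 ?invr_ge0 ?(ltW p0_gt0) //.
  apply: (le_trans (ler_sum _ le2)); rewrite -mulr_suml -/M mulrDr expr2 lerD2l.
  (* The spread condition at the empty set bounds the whole mass by 1, which turns M * (M + D) into
     M^2 + D. *)
  have Mle1 : M <= 1.
    have := spread set0; rewrite cards0 expr0; apply: le_trans.
    by rewrite le_eqVlt; apply/orP; left; apply/eqP; apply: eq_bigl => j; rewrite sub0set andbT.
  by rewrite ler_piMl // subr_ge0 exprn_ege1 // lerDl divr_ge0 // (ltW p0_gt0).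
set D := (1 + q / p0) ^+ t - 1.
have D_ge0 : 0 <= D by rewrite subr_ge0 exprn_ege1 // lerDl divr_ge0 // ltW.
set E := fun W : {set O} => [exists i, J i && (T i \subset W)].
have := bern_sum p; rewrite (bigID E) /= => sum1.
have Pbad : (\sum_(W : {set O} | ~~ E W) bern p W) * M ^+ 2 <= D.
  have var : \sum_W bern p W * (X W - M) ^+ 2 <= D.
    have -> : \sum_W bern p W * (X W - M) ^+ 2 =
       \sum_W bern p W * X W ^+ 2 - M ^+ 2.
      rewrite (eq_bigr (fun W => bern p W * X W ^+ 2 - (bern p W * X W) * (2 * M) +
          bern p W * M ^+ 2)); last by move=> W _; ring.
      rewrite big_split sumrB /= -!mulr_suml EX bern_sum; ring.
    by rewrite lerBlDl; exact: EX2.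
  apply: le_trans var; rewrite mulr_suml [leRHS](bigID E) /=.
  rewrite ler_wpDl //; first by apply: sumr_ge0 => W _; rewrite mulr_ge0 ?sqr_ge0 ?bern_ge0.
  apply: ler_sum => W nE; rewrite ler_wpM2l ?bern_ge0 //.
  suff -> : X W = 0 by rewrite sub0r sqrrN.
  rewrite /X big_pred0 // => i; apply: contraNF nE => JT; by apply/existsP; exists i.
rewrite lerBlDr -sum1 lerD2l.
apply: (@le_trans _ _ (D / M ^+ 2)); first by rewrite ler_pdivlMr ?exprn_gt0.
by rewrite ler_wpM2l // lef_pV2 ?posrE ?exprn_gt0 // lerXn2r // nnegrE ltW.
Qed.

Variable H : I -> {set O}.
Hypothesis pH : forall i x, good i -> x \in H i -> p0 <= p x.
Hypothesis spreadH :
  forall S : {set O}, \sum_(i | good i && (S \subset H i)) mu i <= q ^+ #|S|.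

(** The minimum fragment of Park and Pham: any good j serves as well as i, so i is traded for the
    one that leaves the least to find in the next round. *)
Definition frag_rep (W : {set O}) (i : I) : I :=
  [arg min_(j < i | good j && (H j \subset W :|: H i)) #|H j :\: W|]%N.

Definition frag (W : {set O}) (i : I) : {set O} := H (frag_rep W i) :\: W.

Lemma frag_repP (W : {set O}) i : good i ->
  [/\ good (frag_rep W i), H (frag_rep W i) \subset W :|: H i &
    forall j, good j -> H j \subset W :|: H i -> (#|frag W i| <= #|H j :\: W|)%N].
Proof.
move=> gi; rewrite /frag /frag_rep; case: arg_minnP; first by rewrite gi subsetUr.
by move=> j /andP[gj Hj] jmin; split => // k gk Hk; apply: jmin; rewrite gk.
Qed.

Lemma frag_subset (W : {set O}) i : good i -> frag W i \subset H i.
Proof.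
by case/(@frag_repP W) => _ sub _; rewrite /frag subDset.
Qed.

Lemma frag_disjoint (W : {set O}) i : [disjoint W & frag W i].
Proof. by rewrite disjoint_sym /frag disjoints_subset subsetDr. Qed.

(** The choice depends on the union Z alone. Once Z is known, the fragment is a subset of a known
    set of the hypergraph, which keeps the count in [frag_gf] small. *)
Definition frag_hull (Z : {set O}) : option I := [pick j | good j && (H j \subset Z)].

(* Any edge of the hypergraph inside W :|: frag W i leaves a fragment contained
   in frag W i, hence equal to it by minimality. *)
Lemma frag_hullP (W : {set O}) i : good i ->
  exists2 j, frag_hull (W :|: frag W i) = Some j & frag W i \subset H j.
Proof.
move=> gi; have [gr sr rmin] := frag_repP W gi; rewrite /frag_hull.
case: pickP => [j /andP[gj sj]|/(_ (frag_rep W i))]; last first.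
  by rewrite gr /= /frag -subDset subxx.
exists j => //.
have sF : H j :\: W \subset frag W i by rewrite subDset.
have sj' : H j \subset W :|: H i.
  by apply: subset_trans sj _; rewrite setUS // frag_subset.
have /eqP <- : H j :\: W == frag W i by rewrite eqEcard sF rmin.
exact: subsetDl.
Qed.

(** For each element of T the factor 1 - p x is at most 1, hence at most p x / p0: adding T is a
    change of measure that costs p0^-1 per element. *)
Lemma bern_setD (Z T : {set O}) : T \subset Z -> (forall x, x \in T -> p0 <= p x) ->
  bern p (Z :\: T) <= bern p Z * p0^-1 ^+ #|T|.
Proof.
move=> TZ pT; rewrite -prodr_const [X in _ * X]big_mkcond -big_split /=.
apply: ler_prod => x _; have /andP[p0x px1] := p01 x.
have ge0 : 0 <= (if x \in Z :\: T then p x else 1 - p x).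
  by case: ifP => _ //; rewrite subr_ge0.
rewrite ge0 /= inE; case: (boolP (x \in T)) => xT /=; last by rewrite mulr1.
rewrite (subsetP TZ) // ler_pdivlMr //.
by have := pT x xT; nra.
Qed.

(** Encode (W, i) by the fragment T and Z = W :|: T. Passing to Z costs p0^-|T|, [frag_hull Z]
    leaves only the subsets T of one known set, and the indices i with T inside H i have mass at
    most q^|T|. The sum over T is a binomial expansion. *)
Lemma frag_gf (y : R) (m : nat) : 0 <= y -> (forall i, good i -> (#|H i| <= m)%N) ->
  \sum_W bern p W * (\sum_(i | good i) mu i * y ^+ #|frag W i|) <=
  (1 + y * (q / p0)) ^+ m.
Proof.
move=> y_ge0 Hm.
have step i : good i -> \sum_W bern p W * (mu i * y ^+ #|frag W i|) <=
    \sum_(T : {set O} | T \subset H i) \sum_(Z : {set O} | if frag_hull Z is Some j then T \subset H j else false)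
       bern p Z * (mu i * (y / p0) ^+ #|T|).
  move=> gi; rewrite (partition_big (fun W => frag W i) (fun T => T \subset H i)) /=; last first.
    by move=> W _; apply: frag_subset.
  apply: ler_sum => T TH.
  apply: (@le_trans _ _ (\sum_(W | frag W i == T) bern p (W :|: T) * (mu i * (y / p0) ^+ #|T|))).
    apply: ler_sum => W /eqP fW; rewrite fW exprMn.
    have dWT : [disjoint W & T] by rewrite -fW frag_disjoint.
    have eW : W = (W :|: T) :\: T.
      by rewrite setDUl setDv setU0; apply/esym/setDidPl.
    have pT x : x \in T -> p0 <= p x by move=> /(subsetP TH); apply: pH.
    rewrite {1}eW; apply: (le_trans (ler_wpM2r _ (bern_setD (subsetUr W T) pT))).
      by rewrite mulr_ge0 ?exprn_ge0 ?mu_ge0.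
    by rewrite le_eqVlt; apply/orP; left; apply/eqP; ring.
  (* With T fixed, W is recovered from W :|: T because a fragment is disjoint from W. *)
  apply: (@ler_sum_inj _ _ _ (fun W => frag W i == T) _ (fun W => W :|: T)
      (fun Z => bern p Z * (mu i * (y / p0) ^+ #|T|))).
  - move=> W W' /eqP fW /eqP fW' eWW.
    have dW : [disjoint W & T] by rewrite -fW frag_disjoint.
    have dW' : [disjoint W' & T] by rewrite -fW' frag_disjoint.
    have: (W :|: T) :\: T = (W' :|: T) :\: T by rewrite eWW.
    by rewrite !setDUl setDv !setU0 !(setDidPl _).
  - by move=> W /eqP fW; have [j] := frag_hullP W gi; rewrite fW => ->.
  - move=> Z _; rewrite mulr_ge0 ?bern_ge0 // mulr_ge0 ?mu_ge0 // exprn_ge0 //.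
    by rewrite divr_ge0 // ltW.
rewrite (eq_bigr (fun W => \sum_(i | good i) bern p W * (mu i * y ^+ #|frag W i|))); last first.
  by move=> W _; rewrite mulr_sumr.
rewrite exchange_big; apply: (le_trans (ler_sum _ step)).
have -> : \sum_(i | good i) \sum_(T : {set O} | T \subset H i)
     \sum_(Z : {set O} | if frag_hull Z is Some j then T \subset H j else false)
       bern p Z * (mu i * (y / p0) ^+ #|T|) =
   \sum_Z bern p Z * \sum_(T : {set O} | if frag_hull Z is Some j then T \subset H j else false)
       ((y / p0) ^+ #|T| * \sum_(i | good i && (T \subset H i)) mu i).
  transitivity (\sum_(Z : {set O}) \sum_(T : {set O}) \sum_(i | good i)
     if (T \subset H i) && (if frag_hull Z is Some j then T \subset H j else false)
     then bern p Z * (mu i * (y / p0) ^+ #|T|) else 0).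
    rewrite [RHS]exchange_big [RHS](eq_bigr (fun T : {set O} => \sum_(i | good i)
      \sum_(Z : {set O}) if (T \subset H i) && (if frag_hull Z is Some j then T \subset H j else false)
     then bern p Z * (mu i * (y / p0) ^+ #|T|) else 0)); last first.
      by move=> T _; rewrite exchange_big.
    rewrite [RHS]exchange_big; apply: eq_bigr => i gi; rewrite [LHS]big_mkcond.
    apply: eq_bigr => T _; case: ifP => TH /=; last by rewrite big1.
    by rewrite big_mkcond.
  apply: eq_bigr => Z _; rewrite mulr_sumr [RHS]big_mkcond; apply: eq_bigr => T _.
  case: ifP => hZ; last by rewrite big1 // => i _; rewrite andbF.
  rewrite !mulr_sumr [RHS]big_mkcondr; apply: eq_bigr => i _; rewrite andbT.
  by case: ifP => // _; ring.
apply: (@le_trans _ _ (\sum_Z bern p Z * (1 + y * (q / p0)) ^+ m)); last first.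
  by rewrite -mulr_suml bern_sum mul1r.
have c_ge0 : 0 <= y * (q / p0) by rewrite mulr_ge0 // divr_ge0 // ltW.
apply: ler_sum => Z _; rewrite ler_wpM2l ?bern_ge0 //.
rewrite /frag_hull; case: pickP => [j /andP[gj _]|_]; last first.
  by rewrite big_pred0 // exprn_ge0 // addr_ge0.
apply: (@le_trans _ _ ((1 + y * (q / p0)) ^+ #|H j|)); last first.
  by rewrite ler_weXn2l ?Hm // lerDl.
rewrite -sum_subset_expr; apply: ler_sum => T _.
have -> : (y * (q / p0)) ^+ #|T| = (y / p0) ^+ #|T| * q ^+ #|T|.
  by rewrite -exprMn; congr (_ ^+ _); ring.
by rewrite ler_wpM2l ?exprn_ge0 ?divr_ge0 // ltW.
Qed.

(** Markov's inequality for the generating function treats W1: if the indices with fragments of size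
    at most t have mass below M0, the others have mass at least M0, the total being at least 2 * M0,
    and each is weighted by at least y^t. For all other W1 the second moment, applied to the
    fragments, finds one of them in W2. *)
Lemma spread_two_rounds (y M0 : R) (m t : nat) : 1 <= y -> 0 < M0 ->
    2 * M0 <= \sum_(i | good i) mu i -> (forall i, good i -> (#|H i| <= m)%N) ->
  1 - (1 + y * (q / p0)) ^+ m / (y ^+ t * M0) - ((1 + q / p0) ^+ t - 1) / M0 ^+ 2 <=
  \sum_W1 bern p W1 * (\sum_(W2 : {set O} |
     [exists i, good i && (H i \subset W1 :|: W2)]) bern p W2).
Proof.
move=> y1 M0_gt0 M0le Hm.
have y_gt0 : 0 < y by apply: lt_le_trans y1.
pose sm W1 i := good i && (#|frag W1 i| <= t)%N.
pose G (W1 : {set O}) := M0 <= \sum_(i | sm W1 i) mu i.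
have PG : 1 - (1 + y * (q / p0)) ^+ m / (y ^+ t * M0) <= \sum_(W1 | G W1) bern p W1.
  rewrite lerBlDr -[leLHS](bern_sum p) [leLHS](bigID G) /= lerD2l.
  rewrite ler_pdivlMr ?mulr_gt0 ?exprn_gt0 //.
  apply: le_trans (frag_gf (ltW y_gt0) Hm).
  rewrite [leRHS](bigID G) /= ler_wpDl //.
    apply: sumr_ge0 => W _; rewrite mulr_ge0 ?bern_ge0 //; apply: sumr_ge0 => i _.
    by rewrite mulr_ge0 ?mu_ge0 // exprn_ge0 // ltW.
  rewrite mulr_suml; apply: ler_sum => W; rewrite -ltNge => nG.
  rewrite ler_wpM2l ?bern_ge0 // mulrC.
  apply: (@le_trans _ _ (\sum_(i | good i && ~~ (#|frag W i| <= t)%N) mu i * y ^+ t)).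
    rewrite -mulr_suml ler_wpM2r ?exprn_ge0 ?(ltW y_gt0) //.
    have := M0le; rewrite (bigID (fun i => (#|frag W i| <= t)%N)) /= => M0le'.
    by move: nG M0le'; rewrite /sm; lra.
  rewrite [leRHS](bigID (fun i => (#|frag W i| <= t)%N)) /= ler_wpDl //.
    apply: sumr_ge0 => i _; by rewrite mulr_ge0 ?mu_ge0 // exprn_ge0 // ltW.
  apply: ler_sum => i /andP[_]; rewrite -ltnNge => tf.
  by rewrite ler_wpM2l ?mu_ge0 // ler_weXn2l // ltnW.
set D := ((1 + q / p0) ^+ t - 1) / M0 ^+ 2.
have D_ge0 : 0 <= D.
  rewrite divr_ge0 ?exprn_ge0 ?(ltW M0_gt0) // subr_ge0 exprn_ege1 //.
  by rewrite lerDl divr_ge0 // ltW.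
have inner W1 : G W1 -> 1 - D <= \sum_(W2 : {set O} |
     [exists i, good i && (H i \subset W1 :|: W2)]) bern p W2.
  move=> GW; apply: (@le_trans _ _ (\sum_(W2 : {set O} |
     [exists i, sm W1 i && (frag W1 i \subset W2)]) bern p W2)).
    apply: second_moment => //.
    - move=> i x /andP[gi _] xf; apply: (pH gi); exact: (subsetP (frag_subset W1 gi)).
    - by move=> i /andP[].
    move=> S; apply: le_trans (spreadH S); apply: ler_sum_subset => [i _|i]; first exact: mu_ge0.
    by move=> /andP[/andP[gi _] Sf]; rewrite gi (subset_trans Sf) // frag_subset.
  apply: ler_sum_subset => [W _|W /existsP[i /andP[/andP[gi _] sf]]]; first exact: bern_ge0.
  have [gr sr _] := frag_repP W1 gi.
  by apply/existsP; exists (frag_rep W1 i); rewrite gr /= -subDset.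
apply: (@le_trans _ _ (\sum_(W1 | G W1) bern p W1 * (1 - D))).
  rewrite -mulr_suml.
  have sle1 : \sum_(W1 | G W1) bern p W1 <= 1.
    by rewrite -(bern_sum p); apply: ler_sum_subset => // W _; apply: bern_ge0.
  by move: PG sle1; set s := \sum_(W1 | G W1) _; set B := _ / (_ * M0); nra.
apply: (@le_trans _ _ (\sum_(W1 | G W1) bern p W1 * (\sum_(W2 : {set O} |
     [exists i, good i && (H i \subset W1 :|: W2)]) bern p W2))).
  by apply: ler_sum => W GW; rewrite ler_wpM2l ?bern_ge0 // inner.
apply: ler_sum_subset => // W _; rewrite mulr_ge0 ?bern_ge0 //.
by apply: sumr_ge0 => W2 _; apply: bern_ge0.
Qed.

End Spread.

(** * Comparison with independent edge-colour pairs *)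

Section Hybrid.
Local Open Scope ring_scope.
Variable R : realFieldType.

Definition prod_mass (E A : finType) (w : E -> A -> R) (s : {ffun E -> A}) : R :=
  \prod_e w e (s e).

Definition ffun_upd (E A : finType) (s : {ffun E -> A}) (e : E) (a : A) : {ffun E -> A} :=
  [ffun x => if x == e then a else s x].

Lemma prod_mass_upd (E A : finType) (w : E -> A -> R) (s : {ffun E -> A}) e a :
  prod_mass w s * w e a = prod_mass w (ffun_upd s e a) * w e (s e).
Proof.
rewrite /prod_mass (bigD1 e) //= [X in _ = X * _](bigD1 e) //= ffunE eqxx.
rewrite mulrAC [RHS]mulrAC [w e (s e) * _]mulrC; congr (_ * _).
by apply: eq_bigr => x xe; rewrite ffunE (negPf xe).
Qed.

Lemma prod_mass_ge0 (E A : finType) (w : E -> A -> R) s :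
  (forall e a, 0 <= w e a) -> 0 <= prod_mass w s.
Proof. by move=> w_ge0; apply: prodr_ge0. Qed.

Lemma prod_mass_sum (E A : finType) (w : E -> A -> R) :
  (forall e, \sum_a w e a = 1) -> \sum_s prod_mass w s = 1.
Proof.
by move=> w1; rewrite /prod_mass -bigA_distr_bigA big1.
Qed.

(** Exchanging the coordinate of s at e with a fresh sample is an involution that preserves the
    joint weight. *)
Lemma prod_mass_resample (E A : finType) (w : E -> A -> R) (e : E) (f : {ffun E -> A} -> R) :
  (\sum_a w e a = 1) ->
  \sum_s prod_mass w s * f s =
  \sum_s prod_mass w s * \sum_a w e a * f (ffun_upd s e a).
Proof.
move=> w1; pose h (x : {ffun E -> A} * A) := (ffun_upd x.1 e x.2, x.1 e).
have hK : involutive h.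
  move=> [s a]; rewrite /h /= ffunE eqxx; congr pair; apply/ffunP => x; rewrite !ffunE.
  by case: eqP => // ->.
transitivity (\sum_(x : {ffun E -> A} * A) prod_mass w x.1 * w e x.2 * f x.1).
  rewrite -(pair_bigA _ (fun s a => prod_mass w s * w e a * f s)) /=.
  by apply: eq_bigr => s _; rewrite -mulr_suml -mulr_sumr w1 mulr1.
rewrite (reindex_inj (inv_inj hK)) /=.
rewrite [RHS](eq_bigr (fun s => \sum_a prod_mass w s * w e a * f (ffun_upd s e a))); last first.
  by move=> s _; rewrite mulr_sumr; apply: eq_bigr => a _; rewrite mulrA.
rewrite [RHS](pair_bigA _ (fun s a => prod_mass w s * w e a * f (ffun_upd s e a))) /=.
by apply: eq_bigr => -[s a] _ /=; rewrite [in RHS]prod_mass_upd.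
Qed.

Variables (E K A B : finType) (wA : E -> A -> R) (wB : E -> B -> R).
Variables (hA : E -> A -> {set K}) (hB : E -> B -> {set K}).
Hypothesis wA_ge0 : forall e a, 0 <= wA e a.
Hypothesis wB_ge0 : forall e b, 0 <= wB e b.
Hypothesis wA1 : forall e, \sum_a wA e a = 1.
Hypothesis wB1 : forall e, \sum_b wB e b = 1.
Hypothesis dom : forall e (G : {set K}),
  \sum_(b | ~~ [disjoint hB e b & G]) wB e b <= \sum_(a | ~~ [disjoint hA e a & G]) wA e a.
Variable F : pred {set E * K}.
Hypothesis F_fun : forall (S : {set E * K}) e c c',
  F S -> (e, c) \in S -> (e, c') \in S -> c = c'.

Definition hits (v : E -> {set K}) : bool :=
  [exists S : {set E * K}, F S && [forall x in S, x.2 \in v x.1]].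

Lemma eq_hits v v' : v =1 v' -> hits v = hits v'.
Proof.
move=> vv; apply: eq_existsb => S; congr (_ && _); apply: eq_forallb => x.
by rewrite vv.
Qed.

(** [b] says whether a target avoiding e is already realised; [G] collects the colours c for which
    some target through (e, c) lacks nothing else. A target has at most one colour at e, so one
    colour of X in G completes it. *)
Lemma hits_upd (v : E -> {set K}) (e : E) : exists b (G : {set K}),
  forall X : {set K}, hits (fun x => if x == e then X else v x) = b || ~~ [disjoint X & G].
Proof.
pose ok (S : {set E * K}) := [forall x in S, (x.1 != e) ==> (x.2 \in v x.1)].
pose b0 := [exists S : {set E * K}, [&& F S, ok S & [forall x in S, x.1 != e]]].
pose G := [set c | [exists S : {set E * K}, [&& F S, ok S & (e, c) \in S]]].
exists b0, G => X; apply/idP/idP.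
  case/existsP => S /andP[FS /forall_inP Sv].
  have okS : ok S.
    apply/forall_inP => x xS; apply/implyP => xe; by have := Sv x xS; rewrite (negPf xe).
  case: (boolP [forall x in S, x.1 != e]) => [nS|]; first by rewrite /b0; apply/orP; left; apply/existsP; exists S; rewrite FS okS.
  rewrite negb_forall_in => /exists_inP[[e' c] eS] /= /negPn/eqP ee; subst e'.
  apply/orP; right; rewrite -setI_eq0; apply/set0Pn; exists c; rewrite inE.
  have := Sv _ eS; rewrite /= eqxx => -> /=; rewrite inE.
  by apply/existsP; exists S; rewrite FS okS.
case/orP => [/existsP[S /and3P[FS okS /forall_inP nS]]|].
  apply/existsP; exists S; rewrite FS; apply/forall_inP => x xS.
  by have := forall_inP okS _ xS; rewrite (nS x xS) (negPf (nS x xS)).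
rewrite -setI_eq0 => /set0Pn[c /setIP[cX]]; rewrite inE => /existsP[S /and3P[FS okS eS]].
apply/existsP; exists S; rewrite FS; apply/forall_inP => -[e' c'] xS /=.
case: eqP => [ee|/eqP ne]; first by subst e'; rewrite (F_fun FS xS eS).
by have := forall_inP okS _ xS; rewrite /= ne.
Qed.

(* Replacing the law of one edge at a time: given the other edges, the event
   only asks that the set at [e] meets some fixed set of colours. *)
Lemma hybrid_le :
  \sum_(t : {ffun E -> B} | hits (fun e => hB e (t e))) prod_mass wB t <=
  \sum_(s : {ffun E -> A} | hits (fun e => hA e (s e))) prod_mass wA s.
Proof.
pose mix (D : {set E}) (s : {ffun E -> A}) (t : {ffun E -> B}) e :=
  if e \in D then hA e (s e) else hB e (t e).
pose P (D : {set E}) := \sum_s prod_mass wA s * \sum_t prod_mass wB t * (hits (mix D s t))%:R.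
have P0 : P set0 = \sum_(t : {ffun E -> B} | hits (fun e => hB e (t e))) prod_mass wB t.
  rewrite /P [RHS]big_mkcond.
  transitivity (\sum_s prod_mass wA s * \sum_(t : {ffun E -> B}) if hits (fun e => hB e (t e)) then prod_mass wB t else 0).
    apply: eq_bigr => s _; congr (_ * _); apply: eq_bigr => t _.
    rewrite (@eq_hits _ (fun e => hB e (t e))); first by case: ifP => _; rewrite ?mulr1 ?mulr0.
    by move=> e; rewrite /mix inE.
  by rewrite -mulr_suml prod_mass_sum ?mul1r.
have PT : P setT = \sum_(s : {ffun E -> A} | hits (fun e => hA e (s e))) prod_mass wA s.
  rewrite /P [RHS]big_mkcond; apply: eq_bigr => s _.
  transitivity (prod_mass wA s * \sum_t prod_mass wB t * (hits (fun e => hA e (s e)))%:R).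
    congr (_ * _); apply: eq_bigr => t _; congr (_ * _%:R); congr nat_of_bool.
    by apply: eq_hits => e; rewrite /mix inE.
  by rewrite -mulr_suml prod_mass_sum ?mul1r //; case: ifP => _; rewrite ?mulr1 ?mulr0.
have step (D : {set E}) e : e \notin D -> P D <= P (e |: D).
  move=> eD.
  have -> : P D = \sum_s prod_mass wA s * \sum_t prod_mass wB t *
      \sum_b wB e b * (hits (mix D s (ffun_upd t e b)))%:R.
    apply: eq_bigr => s _; congr (_ * _).
    by rewrite (prod_mass_resample (fun t => (hits (mix D s t))%:R) (wB1 e)).
  have -> : P (e |: D) = \sum_s prod_mass wA s * \sum_t prod_mass wB t *
      \sum_a wA e a * (hits (mix (e |: D) (ffun_upd s e a) t))%:R.
    rewrite /P (prod_mass_resample (fun s => \sum_t prod_mass wB t * (hits (mix (e |: D) s t))%:R) (wA1 e)).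
    apply: eq_bigr => s _; congr (_ * _).
    rewrite (eq_bigr (fun a => \sum_t prod_mass wB t * (wA e a * (hits (mix (e |: D) (ffun_upd s e a) t))%:R))); last first.
      by move=> a _; rewrite mulr_sumr; apply: eq_bigr => t _; rewrite mulrCA.
    by rewrite exchange_big; apply: eq_bigr => t _; rewrite mulr_sumr.
  apply: ler_sum => s _; rewrite ler_wpM2l ?prod_mass_ge0 //.
  apply: ler_sum => t _; rewrite ler_wpM2l ?prod_mass_ge0 //.
  have [b0 [G hG]] := hits_upd (mix D s t) e.
  rewrite (eq_bigr (fun b => wB e b * (b0 || ~~ [disjoint hB e b & G])%:R)); last first.
    move=> b _; rewrite -hG; congr (_ * (nat_of_bool _)%:R); apply: eq_hits => x.
    by rewrite /mix ffunE; case: eqP => [->|] //; rewrite (negPf eD).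
  rewrite [leRHS](eq_bigr (fun a => wA e a * (b0 || ~~ [disjoint hA e a & G])%:R)); last first.
    move=> a _; rewrite -hG; congr (_ * (nat_of_bool _)%:R); apply: eq_hits => x.
    by rewrite /mix ffunE !inE; case: eqP => [->|].
  case: b0 {hG} => /=; first by rewrite -!mulr_suml wA1 wB1.
  have := dom e G; rewrite [leLHS]big_mkcond [leRHS]big_mkcond /=.
  rewrite [X in X <= _ -> _](eq_bigr (fun b => wB e b * (~~ [disjoint hB e b & G])%:R)); last first.
    by move=> b _; case: ifP => _; rewrite ?mulr1 ?mulr0.
  rewrite [X in _ <= X -> _](eq_bigr (fun a => wA e a * (~~ [disjoint hA e a & G])%:R)) //.
  by move=> b _; case: ifP => _; rewrite ?mulr1 ?mulr0.
rewrite -P0 -PT.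
have: forall k (D : {set E}), #|~: D| = k -> P D <= P setT.
  elim=> [|k IH] D; first by move=> /eqP; rewrite cards_eq0 => /eqP/(congr1 (@setC _)); rewrite setCK setC0 => ->.
  move=> Dk; have /card_gt0P[e] : (0 < #|~: D|)%N by rewrite Dk.
  rewrite inE => eD; apply: le_trans (step D e eD) (IH _ _).
  have -> : ~: (e |: D) = (~: D) :\ e by apply/setP => x; rewrite !inE negb_or.
  by have := cardsD1 e (~: D); rewrite Dk inE eD /= add1n => -[].
by apply.
Qed.

End Hybrid.

(** * Three global rounds as three independent colour sets per edge *)

Section ThreeRounds.
Local Open Scope ring_scope.
Variables (R : realFieldType) (E K : finType).

Definition slice (W : {set E * K}) (e : E) : {set K} := [set c | (e, c) \in W].

Definition unslice (v : E -> {set K}) : {set E * K} := [set x | x.2 \in v x.1].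

Lemma unsliceK v e : slice (unslice v) e = v e.
Proof. by apply/setP => c; rewrite !inE. Qed.

Lemma bern_slice (p : E -> R) (W : {set E * K}) :
  bern (fun x => p x.1) W = \prod_e bern (fun=> p e) (slice W e).
Proof.
rewrite /bern (pair_bigA _ (fun e c => if c \in slice W e then p e else 1 - p e)) /=.
by apply: eq_bigr => -[e c] _ /=; rewrite inE.
Qed.

Lemma bernoulli_ineq (x : R) m : 0 <= x <= 1 -> 1 - x *+ m <= (1 - x) ^+ m.
Proof.
move=> /andP[x0 x1]; elim: m => [|m IH]; first by rewrite mulr0n subr0 expr0.
rewrite exprS mulrS; apply: (le_trans _ (ler_wpM2l _ IH)); last by rewrite subr_ge0.
have : 0 <= x *+ m by rewrite mulrn_wge0.
by set y := x *+ m; nra.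
Qed.

Definition triple_mass (p : E -> R) (e : E) (x : {set K} * {set K} * {set K}) : R :=
  bern (fun=> p e) x.1.1 * bern (fun=> p e) x.1.2 * bern (fun=> p e) x.2.

Definition triple_hit (e : E) (x : {set K} * {set K} * {set K}) : {set K} :=
  x.1.1 :|: x.1.2 :|: x.2.

Lemma sum_triple (f g h : {set K} -> R) :
  \sum_(x : {set K} * {set K} * {set K}) f x.1.1 * g x.1.2 * h x.2 =
  (\sum_S f S) * (\sum_S g S) * (\sum_S h S).
Proof.
rewrite -(pair_bigA _ (fun x S => f x.1 * g x.2 * h S)) /=.
rewrite (eq_bigr (fun x : {set K} * {set K} => f x.1 * g x.2 * \sum_S h S)); last first.
  by move=> x _; rewrite mulr_sumr.
rewrite -mulr_suml; congr (_ * _); rewrite -(pair_bigA _ (fun x S => f x * g S)) /=.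
by rewrite mulr_suml; apply: eq_bigr => x _; rewrite mulr_sumr.
Qed.

Lemma triple_mass_sum p e : \sum_x triple_mass p e x = 1.
Proof. by rewrite sum_triple !bern_sum !mulr1. Qed.

Lemma triple_mass_disjoint (p : E -> R) e (G : {set K}) :
  \sum_(x | [disjoint triple_hit e x & G]) triple_mass p e x = (1 - p e) ^+ (3 * #|G|).
Proof.
pose f (S : {set K}) := if [disjoint S & G] then bern (fun=> p e) S else 0.
transitivity (\sum_(x : {set K} * {set K} * {set K}) f x.1.1 * f x.1.2 * f x.2).
  rewrite big_mkcond; apply: eq_bigr => -[[S0 S1] S2] _; rewrite /triple_hit /triple_mass /f /=.
  rewrite !disjoints_subset !subUset.
  by do 3!case: (_ \subset _); rewrite /= ?mul0r ?mulr0 ?mul0r.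
rewrite sum_triple /f -!big_mkcond.
have -> : \sum_(S : {set K} | [disjoint S & G]) bern (fun=> p e) S = (1 - p e) ^+ #|G|.
  by rewrite -prodr_const -bern_disjoint; apply: eq_bigl => S; exact: disjoint_sym.
by rewrite -!exprD; congr (_ ^+ _); lia.
Qed.

(** A transposition: a triple of colour sets for every edge is the same as a triple of sets of
    (edge, colour) pairs, and the product weights agree. *)
Lemma triple_rounds (p : E -> R) (ev : pred {set E * K}) :
  \sum_(t : {ffun E -> {set K} * {set K} * {set K}} |
     ev (unslice (fun e => triple_hit e (t e)))) prod_mass (triple_mass p) t =
  \sum_W0 bern (fun x => p x.1) W0 *
  \sum_W1 bern (fun x => p x.1) W1 *
  \sum_(W2 : {set E * K} | ev (W0 :|: W1 :|: W2)) bern (fun x => p x.1) W2.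
Proof.
pose h (w : {set E * K} * {set E * K} * {set E * K}) : {ffun E -> {set K} * {set K} * {set K}} :=
  [ffun e => (slice w.1.1 e, slice w.1.2 e, slice w.2 e)].
pose h' (t : {ffun E -> {set K} * {set K} * {set K}}) :=
  (unslice (fun e => (t e).1.1), unslice (fun e => (t e).1.2), unslice (fun e => (t e).2)).
have hK : cancel h h'.
  move=> [[W0 W1] W2]; congr (_, _, _); apply/setP => -[e c]; by rewrite !inE ffunE /= inE.
have h'K : cancel h' h.
  by move=> t; apply/ffunP => e; rewrite ffunE /= !unsliceK; case: (t e) => [[]].
rewrite (reindex h) /=; last by exists h' => x _; rewrite ?hK ?h'K.
rewrite (eq_bigr (fun W0 => \sum_W1 \sum_W2 if ev (W0 :|: W1 :|: W2) then
   bern (fun x => p x.1) W0 * bern (fun x => p x.1) W1 * bern (fun x => p x.1) W2 else 0)); last first.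
  move=> W0 _; rewrite mulr_sumr; apply: eq_bigr => W1 _; rewrite !mulr_sumr -big_mkcond /=.
  by apply: eq_bigr => W2 _; rewrite mulrA.
rewrite (pair_bigA _ (fun W0 W1 => \sum_W2 if ev (W0 :|: W1 :|: W2) then
   bern (fun x => p x.1) W0 * bern (fun x => p x.1) W1 * bern (fun x => p x.1) W2 else 0)).
rewrite (pair_bigA _ (fun w W2 => if ev (w.1 :|: w.2 :|: W2) then
   bern (fun x => p x.1) w.1 * bern (fun x => p x.1) w.2 * bern (fun x => p x.1) W2 else 0)) /=.
rewrite [LHS]big_mkcond; apply: eq_bigr => -[[W0 W1] W2] _ /=.
have -> : unslice (fun e => triple_hit e (h (W0, W1, W2) e)) = W0 :|: W1 :|: W2.
  by apply/setP => -[e c]; rewrite !inE ffunE /= !inE.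
case: ifP => // _; rewrite !bern_slice -!big_split /=; apply: eq_bigr => e _.
by rewrite ffunE.
Qed.

End ThreeRounds.

(** * The coloured perturbed graph as a product measure *)

Section RealModel.
Local Open Scope ring_scope.
Variables (R : realFieldType) (V X K : finType) (T : sgraph V) (G0 : sgraph X) (p : R).
Hypothesis K_gt0 : (0 < #|K|)%N.
Hypothesis p01 : 0 <= p <= 1.

Let k : R := #|K|%:R.
Let k_gt0 : 0 < k. Proof. by rewrite ltr0n. Qed.

Definition rainbow_copy_set (S : {set {set X} * K}) : bool :=
  [exists f : {ffun V -> X}, exists g : {ffun {set V} -> K},
    [&& injectiveb f, dinjectiveb g (mem (edges T)) &
      S == [set (f @: (e : {set V}), g e) | e in edges T]]].

Lemma rainbow_copy_set_fun (S : {set {set X} * K}) e c c' :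
  rainbow_copy_set S -> (e, c) \in S -> (e, c') \in S -> c = c'.
Proof.
case/existsP => f /existsP[g /and3P[/injectiveP f_inj _ /eqP ->]].
case/imsetP => e1 _ [-> ->] /imsetP[e2 _ [ee ->]].
by rewrite (imset_inj f_inj ee).
Qed.

(** Every subset of X is an index and absent edges are coloured too; this makes the coloured random
    graph one product measure. A set that is not a pair is present with probability 0. *)
Definition edge_mass (e : {set X}) (x : bool * K) : R :=
  (if e \in pairs X then (if x.1 then p else 1 - p) else (if x.1 then 0 else 1)) / k.

Definition edge_hit (e : {set X}) (x : bool * K) : {set K} :=
  if (e \in edges G0) || x.1 then [set x.2] else set0.

Lemma edge_mass_ge0 e x : 0 <= edge_mass e x.
Proof.
rewrite /edge_mass divr_ge0 ?(ltW k_gt0) //; have /andP[? ?] := p01.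
by case: ifP => _; case: x.1 => //; rewrite subr_ge0.
Qed.

Lemma sum_bool_const (u : bool -> R) (P : pred K) :
  \sum_(x : bool * K | P x.2) u x.1 / k = (u true + u false) * #|P|%:R / k.
Proof.
rewrite -(pair_big predT P (fun b c => u b / k)) /=.
rewrite big_bool /= !sumr_const -!(mulr_natr (_ / k)) -mulrDl -mulrDl.
by rewrite mulrAC.
Qed.

Lemma edge_mass_sum e : \sum_x edge_mass e x = 1.
Proof.
rewrite /edge_mass (sum_bool_const (fun b => if e \in pairs X then (if b then p else 1 - p) else (if b then 0 else 1)) predT).
rewrite -mulrA divff ?gt_eqF // mulr1.
by case: ifP => _; rewrite ?add0r // subrKC.
Qed.

Lemma edge_mass_hit e (G : {set K}) :
  \sum_(x | ~~ [disjoint edge_hit e x & G]) edge_mass e x =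
  (if e \in edges G0 then 1 else if e \in pairs X then p else 0) * #|G|%:R / k.
Proof.
rewrite /edge_mass /edge_hit; case: ifP => eG.
  rewrite (subsetP (edges_pairs G0)) //.
  rewrite (eq_bigl (fun x : bool * K => x.2 \in G)); last first.
    by move=> x; rewrite disjoints1 negbK.
  by rewrite (sum_bool_const (fun b => if b then p else 1 - p) (mem G)) subrKC.
rewrite (eq_bigl (fun x : bool * K => x.1 && (x.2 \in G))); last first.
  move=> [b c] /=; case: b; first by rewrite disjoints1 negbK.
  by rewrite disjoints_subset sub0set.
rewrite -(pair_big id (mem G) (fun b c => (if e \in pairs X then (if b then p else 1 - p) else (if b then 0 else 1)) / k)) /=.
by rewrite big_mkcond big_bool /= addr0 sumr_const -(mulr_natr (_ / k)) mulrAC.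
Qed.

(** The colours of the sets that are not edges sum out to 1, so colouring all sets and restricting
    gives the conditional colouring of the edges only. *)
Lemma colouring_extend (G : sgraph X) (ev : pred {ffun edge_of G -> K}) :
  \sum_(chi : {ffun {set X} -> K} | ev [ffun e => chi (val e)]) (\prod_(e : {set X}) k^-1) =
  \sum_(c : {ffun edge_of G -> K} | ev c) colouring_mass R c.
Proof.
rewrite (partition_big (fun chi : {ffun {set X} -> K} => [ffun e : edge_of G => chi (val e)]) ev) //=.
apply: eq_bigr => c evc.
pose Q (e : {set X}) : pred K := fun a => if insub e is Some e' then a == c e' else true.
transitivity (\sum_(chi in family Q) \prod_(e : {set X}) k^-1).
  apply: eq_bigl => chi; apply/andP/familyP => [[_ /eqP cE] e|fam].
    by rewrite /Q unfold_in; case: insubP => // u _ <-; rewrite -cE ffunE.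
  have -> : [ffun e : edge_of G => chi (val e)] = c; last by [].
  apply/ffunP => u; rewrite ffunE; have := fam (val u); rewrite /Q unfold_in valK.
  by move/eqP.
rewrite -(bigA_distr_big_dep _ (fun _ _ => k^-1)) /=.
rewrite (bigID (fun e => e \in edges G)) /= [X in _ * X]big1 ?mulr1; last first.
  move=> e eG; rewrite (eq_bigl predT); last by move=> a; rewrite /Q insubF //; apply/negbTE.
  by rewrite sumr_const -(mulr_natl k^-1) divff // gt_eqF.
rewrite /colouring_mass.
rewrite (eq_bigr (fun=> k^-1)); last first.
  move=> e eG; rewrite (eq_bigl (pred1 (c (Sub e eG)))) ?big_pred1_eq //.
  by move=> a; rewrite /Q insubT.
by rewrite !prodr_const card_sig.
Qed.

Lemma real_model_ge :
  \sum_(s : {ffun {set X} -> bool * K} | hits rainbow_copy_set (fun e => edge_hit e (s e)))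
     prod_mass edge_mass s <=
  perturbed_prob (K := K) G0 p (fun G c => has_rainbow_copy T c).
Proof.
pose h (w : {set {set X}} * {ffun {set X} -> K}) : {ffun {set X} -> bool * K} :=
  [ffun e => (e \in w.1, w.2 e)].
pose h' (s : {ffun {set X} -> bool * K}) : {set {set X}} * {ffun {set X} -> K} :=
  ([set e | (s e).1], [ffun e => (s e).2]).
have hK : cancel h h'.
  move=> [J chi]; congr pair; first by apply/setP => e; rewrite !inE ffunE.
  by apply/ffunP => e; rewrite !ffunE.
have h'K : cancel h' h.
  by move=> s; apply/ffunP => e; rewrite !ffunE /= inE; case: (s e).
rewrite (reindex h) /=; last by exists h' => x _; rewrite ?hK ?h'K.
pose hit (J : {set {set X}}) (chi : {ffun {set X} -> K}) := hits rainbow_copy_set (fun e => if (e \in edges G0) || (e \in J) then [set chi e] else set0).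
pose mJ (J : {set {set X}}) : R := \prod_(e : {set X}) (if e \in pairs X then (if e \in J then p else 1 - p) else (if e \in J then 0 else 1)).
have -> : \sum_(w | hits rainbow_copy_set (fun e => edge_hit e (h w e))) prod_mass edge_mass (h w) =
   \sum_(J : {set {set X}}) mJ J * \sum_(chi : {ffun {set X} -> K} | hit J chi) \prod_(e : {set X}) k^-1.
  rewrite (eq_bigr (fun J => \sum_(chi : {ffun {set X} -> K}) if hit J chi then mJ J * \prod_(e : {set X}) k^-1 else 0)); last first.
    by move=> J _; rewrite mulr_sumr -big_mkcond.
  rewrite (pair_bigA _ (fun J chi => if hit J chi then mJ J * \prod_(e : {set X}) k^-1 else 0)) /=.
  rewrite -big_mkcond; apply: eq_big => -[J chi].
    by apply: eq_hits => e; rewrite /edge_hit ffunE.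
  by move=> _; rewrite /prod_mass -big_split /=; apply: eq_bigr => e _; rewrite ffunE.
rewrite (bigID (fun J : {set {set X}} => J \subset pairs X)) /= [X in _ + X <= _]big1 ?addr0; last first.
  move=> J /subsetPn[e eJ eV]; rewrite /mJ (bigD1 e) //= eJ (negPf eV).
  by rewrite !mul0r.
rewrite (reindex_omap (@edges X) insub) => [|J sJ]; last by rewrite insubT.
rewrite /perturbed_prob (eq_bigl predT); last by move=> H; rewrite edges_pairs valK eqxx.
apply: ler_sum => H _.
have -> : mJ (edges H) = Gnp_mass p H.
  rewrite /mJ /Gnp_mass [RHS]big_mkcond; apply: eq_bigr => e _.
  by case: ifPn => // eV; case: ifP => // eH; rewrite (subsetP (edges_pairs H)) in eV.
have mass_ge0 : 0 <= Gnp_mass p H.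
  by apply: prodr_ge0 => e _; have /andP[? ?] := p01; case: ifP => _ //; rewrite subr_ge0.
rewrite ler_wpM2l // -colouring_extend.
apply: ler_sum_subset => [chi _|chi]; first by apply: prodr_ge0 => e _; rewrite invr_ge0 ltW.
case/existsP => S /andP[/existsP[f /existsP[g /and3P[f_inj /dinjectiveP g_inj /eqP ->]]] /forall_inP Sv].
have Sv' e : e \in edges T -> f @: e \in edges G0 :|: edges H /\ chi (f @: e) = g e.
  move=> eT; have := Sv _ (imset_f (fun e : {set V} => (f @: e, g e)) eT).
  by rewrite /= inE; case: ifP => _; rewrite !inE // => /eqP ->.
apply/existsP; exists f; rewrite f_inj /=; apply/andP; split.
  by apply/subsetP => _ /imsetP[e eT ->]; have [] := Sv' e eT.
apply/forallP => e1; apply/forallP => e2; apply/implyP => /and3P[/imsetP[d1 d1T E1] /imsetP[d2 d2T E2]].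
rewrite !ffunE E1 E2 (Sv' _ d1T).2 (Sv' _ d2T).2 => /eqP /(g_inj _ _ d1T d2T) d12.
by apply/eqP/val_inj; rewrite /= E1 E2 d12.
Qed.

(* A third of the probability that [e] is present with a given colour. *)
Definition round_prob (e : {set X}) : R :=
  (if e \in edges G0 then 1 else if e \in pairs X then p else 0) / (3 * k).

Lemma round_prob01 e : 0 <= round_prob e <= 1.
Proof.
have k1 : 1 <= k by rewrite ler1n.
have /andP[? ?] := p01.
rewrite divr_ge0 ?mulr_ge0 ?(ltW k_gt0) //=; last by case: ifP => // _; case: ifP.
rewrite ler_pdivrMr ?mulr_gt0 //; by case: ifP => _; last case: ifP => _; lra.
Qed.

(** An instance of [hybrid_le]. If an edge is present with probability P, it meets a set of g
    colours with probability P g / k in the true model and 1 - (1 - P / (3k))^(3g) in the three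
    rounds; Bernoulli's inequality compares the two. *)
Lemma perturbed_three_rounds :
  \sum_W0 bern (fun x => round_prob x.1) W0 *
  \sum_W1 bern (fun x => round_prob x.1) W1 *
  \sum_(W2 : {set {set X} * K} |
     [exists S : {set {set X} * K}, rainbow_copy_set S && (S \subset W0 :|: W1 :|: W2)])
     bern (fun x => round_prob x.1) W2 <=
  perturbed_prob (K := K) G0 p (fun G c => has_rainbow_copy T c).
Proof.
apply: le_trans real_model_ge.
rewrite -(triple_rounds round_prob (fun W => [exists S : {set {set X} * K}, rainbow_copy_set S && (S \subset W)])).
rewrite (eq_bigl (fun t : {ffun {set X} -> {set K} * {set K} * {set K}} =>
   hits rainbow_copy_set (fun e => triple_hit e (t e)))); last first.
  move=> t; apply: eq_existsb => S; congr (_ && _); apply/subsetP/forall_inP => sub x xS.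
    by have := sub x xS; rewrite inE.
  by rewrite inE sub.
apply: hybrid_le.
- by move=> e a; apply: edge_mass_ge0.
- by move=> e x; rewrite /triple_mass !mulr_ge0 ?bern_ge0 // => _; apply: round_prob01.
- exact: edge_mass_sum.
- exact: triple_mass_sum.
- move=> e G; rewrite edge_mass_hit.
  have := triple_mass_sum K round_prob e.
  rewrite (bigID (fun x => [disjoint triple_hit e x & G])) /= triple_mass_disjoint => tot.
  have := bernoulli_ineq (3 * #|G|) (round_prob01 e).
  have -> : round_prob e *+ (3 * #|G|) = (if e \in edges G0 then 1 else if e \in pairs X then p else 0) * #|G|%:R / k.
    rewrite -(mulr_natr (round_prob e)) natrM /round_prob; move: (if _ then _ else _) => u.
    have k0 : k != 0 by rewrite gt_eqF.
    by move: (#|G|%:R : R) => g; field; exact: k0.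
  set u := (X in _ - X <= _); set P := (X in _ <= X -> _) => bi; set S := (X in X <= _).
  have tot1 : P + S = 1 by exact: tot.
  suff : S <= u by [].
  by move: tot1 bi; clearbody S P u; lra.
- exact: rainbow_copy_set_fun.
Qed.

End RealModel.

(** * Perfect matchings in random subgraphs *)

Section Hall.
Variables (X Y : finType) (r : X -> Y -> bool) (y0 : Y).

Definition nbhd (B : {set Y}) (S : {set X}) : {set Y} := [set y in B | [exists x in S, r x y]].

Lemma nbhdU B S S' : nbhd B (S :|: S') = nbhd B S :|: nbhd B S'.
Proof.
apply/setP => y; rewrite !inE -andb_orr; congr (_ && _).
apply/existsP/orP => [[x /andP[/setUP[xS|xS'] rxy]]|[/exists_inP[x xS rxy]|/exists_inP[x xS rxy]]].
- by left; apply/exists_inP; exists x.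
- by right; apply/exists_inP; exists x.
- by exists x; rewrite inE xS.
- by exists x; rewrite inE xS orbT.
Qed.

(** Induction on the size of A. If a nonempty proper subset is tight, it and its complement are
    matched separately, into its neighbourhood and outside of it. Otherwise every such subset has a
    neighbour to spare, so any edge may be put into the matching and removed. *)
Lemma Hall_marriage (A : {set X}) (B : {set Y}) :
  (forall S : {set X}, S \subset A -> #|S| <= #|nbhd B S|) ->
  exists f : X -> Y, {in A &, injective f} /\ (forall x, x \in A -> f x \in B /\ r x (f x)).
Proof.
move: {2}#|A|.+1 (ltnSn #|A|) => k; elim: k A B => // k IH A B; rewrite ltnS => Ak hall.
have [->|/set0Pn[x xA]] := eqVneq A set0.
  by exists (fun=> y0); split=> [x|x]; rewrite inE.
have [/existsP[S0 /and3P[S0A S0n /eqP S0e]]|] := boolP [exists S : {set X},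
   [&& S \proper A, S != set0 & #|nbhd B S| == #|S|]].
  have S0A' := proper_sub S0A.
  have [|f1 [f1i f1r]] := IH S0 (nbhd B S0) (leq_trans (proper_card S0A) Ak).
    move=> S SS0; apply: leq_trans (hall S (subset_trans SS0 S0A')) _.
    apply/subset_leq_card/subsetP => y; rewrite !inE => /andP[yB /exists_inP[z zS rzy]].
    by rewrite yB /=; apply/andP; split; apply/exists_inP; exists z => //; apply: (subsetP SS0).
  have A0lt : #|A :\: S0| < k.
    apply: leq_trans Ak; rewrite cardsD (setIidPr S0A').
    by move: S0n (subset_leq_card S0A'); rewrite -card_gt0; lia.
  have [|f2 [f2i f2r]] := IH (A :\: S0) (B :\: nbhd B S0) A0lt.
    move=> S SA.
    have dS : [disjoint S & S0].
      by apply: (disjointWl SA); rewrite disjoints_subset subsetDr.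
    have : #|S :|: S0| <= #|nbhd B (S :|: S0)|.
      by apply: hall; rewrite subUset S0A' (subset_trans SA) ?subsetDl.
    rewrite nbhdU cardsU (eqP (etrans (setI_eq0 _ _) dS)) cards0 subn0.
    have -> : nbhd (B :\: nbhd B S0) S = nbhd B S :\: nbhd B S0.
      by apply/setP => y; rewrite !inE; case: (y \in B); case: [exists _ in S, _]; rewrite /= ?andbT ?andbF.
    rewrite cardsU cardsD S0e; have := subset_leq_card (subsetIl (nbhd B S) (nbhd B S0)).
    by have := subset_leq_card (subsetIr (nbhd B S) (nbhd B S0)); rewrite S0e; lia.
  have f2' z : z \in A -> (z \in S0) = false -> f2 z \in B :\: nbhd B S0 /\ r z (f2 z).
    by move=> zA zS; apply: f2r; rewrite inE zS.
  exists (fun z => if z \in S0 then f1 z else f2 z); split.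
    move=> z w zA wA; case: ifP => zS; case: ifP => wS; first exact: f1i.
    - by move=> e; have [] := f2' w wA wS; rewrite -e inE (f1r z zS).1.
    - by move=> e; have [] := f2' z zA zS; rewrite e inE (f1r w wS).1.
    - by apply: f2i; rewrite inE ?zS ?wS.
  move=> z zA; case: ifP => zS; last by have [/setDP[]] := f2' z zA zS.
  by have [] := f1r z zS; rewrite inE => /andP[].
rewrite negb_exists => /forallP tight.
have /card_gt0P[y] : 0 < #|nbhd B [set x]|.
  by apply: leq_trans (hall _ _); rewrite ?cards1 ?sub1set.
rewrite inE => /andP[yB /exists_inP[z]]; rewrite inE => /eqP -> rxy.
have Axlt : #|A :\ x| < k by apply: leq_trans Ak; rewrite [X in _ <= X](cardsD1 x) xA.
have [|f [fi fr]] := IH (A :\ x) (B :\ y) Axlt.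
  move=> S SA; have [->|Sn] := eqVneq S set0; first by rewrite cards0.
  have SA' : S \proper A.
    apply: (sub_proper_trans SA); apply: properD1 xA.
  have := tight S; rewrite SA' Sn /= => ne.
  have le := hall S (proper_sub SA').
  have -> : nbhd (B :\ y) S = nbhd B S :\ y.
    by apply/setP => w; rewrite !inE andbA.
  by move: ne le; rewrite [#|nbhd B S|](cardsD1 y); case: (y \in _) => /=; lia.
exists (fun z => if z == x then y else f z); split.
  move=> z1 w zA wA; case: eqP => [->|/eqP zx]; case: eqP => [->|/eqP wx] //.
  - by move=> e; have := fr w; rewrite !inE wx wA -e eqxx => -[].
  - by move=> e; have := fr z1; rewrite !inE zx zA e eqxx => -[].
  - by apply: fi; rewrite !inE ?zx ?wx.
move=> w wA; case: eqP => [->|/eqP wx] //.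
by have := fr w; rewrite !inE wx wA => -[] // /andP[].
Qed.

End Hall.

Lemma exists_subset_card (T : finType) (A : {set T}) k : k <= #|A| ->
  exists2 B : {set T}, B \subset A & #|B| = k.
Proof.
move=> kA; have : 0 < #|[set B : {set T} | B \subset A & #|B| == k]|.
  by rewrite cards_draws bin_gt0.
by case/card_gt0P => B; rewrite inE => /andP[? /eqP]; exists B.
Qed.

Lemma bin_le_expn n k : 'C(n, k) <= n ^ k.
Proof.
elim: n k => [|n IH] [|k] //; rewrite binS.
have le : n ^ k <= n.+1 ^ k by case: k => // k; rewrite leq_exp2r.
apply: leq_trans (leq_add (IH _) (IH _)) _.
by rewrite !expnS -mulSnr; apply: leq_mul.
Qed.

Section RandomMatching.
Variables (X Y : finType) (Gam : X -> Y -> bool) (A : {set X}) (B : {set Y}) (y0 : Y).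
Variables (a c : nat).
Hypotheses (cardA : #|A| = a) (cardB : #|B| = a).

Definition bip_edges (S : {set X}) (T : {set Y}) : {set X * Y} :=
  [set z | [&& z.1 \in S, z.2 \in T & Gam z.1 z.2]].

Definition is_pm (G : {set X * Y}) (h : {ffun X -> Y}) : bool :=
  dinjectiveb h (mem A) && [forall x in A, [&& h x \in B, Gam x (h x) & (x, h x) \in G]].

Definition has_pm (G : {set X * Y}) : bool := [exists h, is_pm G h].

(** A set S violating Hall's condition has at least a + 1 - |S| non-neighbours in B. Keeping exactly
    that many limits the number of witnesses in the union bound of [pm_prob]. *)
Lemma no_pm_witness (G : {set X * Y}) : ~~ has_pm G ->
  exists (S : {set X}) (T : {set Y}), [/\ S \subset A, T \subset B, #|S| + #|T| = a.+1 & [disjoint bip_edges S T & G]].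
Proof.
move=> nopm.
have [/existsP[S /andP[SA]]|] := boolP [exists S : {set X},
    (S \subset A) && (#|nbhd (fun x y => Gam x y && ((x, y) \in G)) B S| < #|S|)].
  set N := nbhd _ B S => NS.
  have NB : N \subset B by apply/subsetP => y; rewrite inE => /andP[].
  have Sa := subset_leq_card SA; rewrite cardA in Sa.
  have [|T TB Ta] := @exists_subset_card _ (B :\: N) (a.+1 - #|S|).
    by rewrite cardsD (setIidPr NB) cardB; lia.
  exists S, T; split => //.
  - exact: subset_trans TB (subsetDl _ _).
  - by rewrite Ta; lia.
  rewrite -setI_eq0; apply/eqP/setP => -[x y]; rewrite !inE /=.
  apply/negbTE/negP => /andP[/and3P[xS yT xy] xyG].
  have /setDP[yB /negP] := subsetP TB y yT; apply; rewrite inE yB /=.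
  by apply/exists_inP; exists x; rewrite ?xy.
rewrite negb_exists => /forallP hall.
have [|f [fi fr]] := @Hall_marriage _ _ (fun x y => Gam x y && ((x, y) \in G)) y0 A B.
  by move=> S SA; have := hall S; rewrite SA /= -leqNgt.
case/negP: nopm; apply/existsP; exists (finfun f); apply/andP; split.
  by apply/dinjectiveP => x x' xA x'A; rewrite !ffunE; apply: fi.
by apply/forall_inP => x xA; rewrite ffunE; have [-> /andP[-> ->]] := fr x xA.
Qed.

Hypothesis SR : forall (S : {set X}) (T : {set Y}), S \subset A -> T \subset B -> a < #|S| + #|T| ->
  c * minn #|S| #|T| <= #|bip_edges S T|.

Local Open Scope ring_scope.

(** Union bound over the witnesses. With z = (1-s)^c, a witness occurs with probability at most
    z^min(|S|,|T|) <= z^|S| + z^|T|. A given S has C(a, |S|-1) <= a^|S| partners T, and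
    symmetrically, so each of the two sums is at most (1 + a z)^a - 1; the factor 4 makes their
    total at most 1/2. *)
Lemma pm_prob (R : realFieldType) (s : R) : 0 <= s <= 1 ->
  4 * ((1 + a%:R * (1 - s) ^+ c) ^+ a - 1) <= 1 ->
  2^-1 <= \sum_(G : {set X * Y} | has_pm G) bern (fun=> s) G.
Proof.
move=> /andP[s0 s1] small.
have b_ge0 (G : {set X * Y}) : 0 <= bern (fun=> s) G by apply: bern_ge0 => _; rewrite s0.
have zs : 0 <= 1 - s <= 1 by lra.
set z := (1 - s) ^+ c in small.
have z0 : 0 <= z by rewrite exprn_ge0 //; lra.
pose Q (w : {set X} * {set Y}) := [&& w.1 \subset A, w.2 \subset B & #|w.1| + #|w.2| == a.+1]%N.
have bad : \sum_(G : {set X * Y} | ~~ has_pm G) bern (fun=> s) G <=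
    \sum_(w | Q w) (1 - s) ^+ #|bip_edges w.1 w.2|.
  apply: (@le_trans _ _ (\sum_(G : {set X * Y}) \sum_(w | Q w && [disjoint bip_edges w.1 w.2 & G]) bern (fun=> s) G)).
    rewrite big_mkcond; apply: ler_sum => G _; case: ifPn => [/no_pm_witness[S [T [SA TB ST dis]]]|_].
      rewrite (bigD1 (S, T)) /=; last by rewrite /Q /= SA TB ST eqxx.
      by rewrite lerDl; apply: sumr_ge0.
    exact: sumr_ge0.
  rewrite (exchange_big_dep Q) /=; last by move=> G w _ /andP[].
  apply: ler_sum => w Qw; rewrite -prodr_const -bern_disjoint.
  by apply: ler_sum_subset => // G; rewrite Qw.
have key (Z Z' : finType) (D : {set Z}) (D' : {set Z'}) : #|D| = a -> #|D'| = a ->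
   \sum_(w : {set Z} * {set Z'} | [&& w.1 \subset D, w.2 \subset D' & #|w.1| + #|w.2| == a.+1]%N) z ^+ #|w.1|
    <= (1 + a%:R * z) ^+ a - 1.
  move=> Da D'a.
  rewrite -(pair_big_dep (fun S : {set Z} => S \subset D) (fun (S : {set Z}) (T : {set Z'}) => (T \subset D') && (#|S| + #|T| == a.+1)%N)
     (fun (S : {set Z}) (T : {set Z'}) => z ^+ #|S|)) /=.
  rewrite -[in leRHS]Da -sum_subset_expr (bigD1 set0) ?sub0set //= [in leRHS](bigD1 set0) ?sub0set //=.
  rewrite cards0 expr0 big1 ?add0r; last first.
    move=> T /andP[TD]; rewrite add0n => /eqP Ta; have := subset_leq_card TD; rewrite Ta D'a; lia.
  rewrite [X in _ <= X]addrAC subrr add0r; apply: ler_sum => S /andP[SD Sn].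
  have Sa := subset_leq_card SD; rewrite Da in Sa.
  have S0 : (0 < #|S|)%N by rewrite card_gt0.
  rewrite sumr_const -(mulr_natl (z ^+ _)) exprMn ler_wpM2r ?(exprn_ge0 _ z0) // -natrX ler_nat Da.
  have -> : #|(fun T : {set Z'} => (T \subset D') && (#|S| + #|T| == a.+1)%N)| = 'C(a, #|S|.-1).
    have -> : 'C(a, #|S|.-1) = 'C(a, a.+1 - #|S|).
      by rewrite -[RHS]bin_sub; [congr ('C(a, _)); lia | lia].
    rewrite -D'a -cards_draws cardsE; apply: eq_card => T; rewrite !unfold_in /= D'a.
    by congr (_ && _); apply/eqP/eqP; lia.
  apply: leq_trans (bin_le_expn _ _) _; apply: leq_pexp2l; last exact: leq_pred.
  by apply: leq_trans Sa.
have bad2 : \sum_(w | Q w) (1 - s) ^+ #|bip_edges w.1 w.2| <=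
    \sum_(w | Q w) z ^+ #|w.1| + \sum_(w | Q w) z ^+ #|w.2|.
  rewrite -big_split /=; apply: ler_sum => w /and3P[SA TB /eqP ST].
  apply: (@le_trans _ _ (z ^+ minn #|w.1| #|w.2|)).
    by rewrite -exprM ler_wiXn2l ?SR //; lra || rewrite ?ST.
  by rewrite /minn; case: ifP => _; rewrite ?lerDl ?lerDr (exprn_ge0 _ z0).
have := key _ _ A B cardA cardB; rewrite -/Q => k1.
have k2 : \sum_(w | Q w) z ^+ #|w.2| <= (1 + a%:R * z) ^+ a - 1.
  apply: le_trans (key _ _ B A cardB cardA).
  apply: (@ler_sum_inj _ _ _ Q _ (fun w => (w.2, w.1)) (fun w : {set Y} * {set X} => z ^+ #|w.1|)).
  - by move=> [u v] [u' v'] _ _ [-> ->].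
  - by move=> [u v] /and3P[? ? ?]; apply/and3P; split => //=; rewrite addnC.
  - by move=> w _; rewrite (exprn_ge0 _ z0).
have := bern_sum (fun _ : X * Y => s); rewrite (bigID has_pm) /= => tot.
by move: (le_trans bad bad2) k1 k2 tot small; rewrite -/Q; lra.
Qed.

End RandomMatching.

Lemma set2_disjoint_inj (X : finType) (A B : {set X}) x x' z z' : [disjoint A & B] ->
  x \in A -> x' \in A -> z \in B -> z' \in B -> [set x; z] = [set x'; z'] -> x = x' /\ z = z'.
Proof.
move=> disAB xA x'A zB z'B e.
have ne u : u \in A -> u \in B -> False by move=> /(disjointFr disAB) ->.
have /set2P[xx|xz] : x \in [set x'; z'] by rewrite -e set21.
  have /set2P[zx|//] : z \in [set x'; z'] by rewrite -e set22.
  by rewrite zx in zB; case: (ne x').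
by rewrite xz in xA; case: (ne z').
Qed.

(** * Rainbow perfect matchings from two rounds *)

Section RainbowMatching.
Local Open Scope ring_scope.
Variables (R : realFieldType) (X K : finType) (Gam : X -> X -> bool).
Variables (A B : {set X}) (C : {set K}) (a c : nat) (x0 : X) (k0 : K).
Hypotheses (cardA : #|A| = a) (cardB : #|B| = a) (cardC : #|C| = a).
Hypothesis disAB : [disjoint A & B].
Hypothesis SR : forall (S T : {set X}), S \subset A -> T \subset B -> (a < #|S| + #|T|)%N ->
  (c * minn #|S| #|T| <= #|bip_edges Gam S T|)%N.
Hypothesis c_le : (2 * c <= a.+1)%N.

Definition rainbow_pm (Z : {set {set X} * K}) : bool :=
  [exists h : {ffun X -> X}, exists g : {ffun X -> K},
    [&& dinjectiveb h (mem A), dinjectiveb g (mem A) &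
      [forall x in A, [&& h x \in B, g x \in C & ([set x; h x], g x) \in Z]]]].

Let h1 (G : {set X * X}) : {ffun X -> X} := odflt [ffun=> x0] [pick h | is_pm Gam A B G h].
Let h2 (G : {set X * K}) : {ffun X -> K} :=
  odflt [ffun=> k0] [pick h | is_pm (fun _ _ => true) A C G h].

Let h1P G : has_pm Gam A B G -> is_pm Gam A B G (h1 G).
Proof. by case/existsP => h hG; rewrite /h1; case: pickP => [//|/(_ h)]; rewrite hG. Qed.

Let h2P G : has_pm (fun _ _ => true) A C G -> is_pm (fun _ _ => true) A C G (h2 G).
Proof. by case/existsP => h hG; rewrite /h2; case: pickP => [//|/(_ h)]; rewrite hG. Qed.

(** The hypergraph is indexed by pairs of random bipartite graphs of density s, one between A and B
    and one between A and C; a pair yields the rainbow matching read off from one fixed perfect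
    matching of each graph. As these matchings lie inside the graphs, prescribing k triples
    prescribes k edges in both, which gives the spread s^2 without any knowledge of the law of the
    matchings. *)
Lemma rainbow_pm_rounds (p : {set X} * K -> R) (p0 s y : R) (t : nat) :
    (forall x, 0 <= p x <= 1) -> 0 < p0 -> 0 <= s <= 1 -> 1 <= y ->
    (forall x z k, x \in A -> z \in B -> Gam x z -> k \in C -> p0 <= p ([set x; z], k)) ->
    4 * ((1 + a%:R * (1 - s) ^+ c) ^+ a - 1) <= 1 ->
  1 - (1 + y * (s ^+ 2 / p0)) ^+ a / (y ^+ t * 8^-1) -
      ((1 + s ^+ 2 / p0) ^+ t - 1) / 8^-1 ^+ 2 <=
  \sum_W1 bern p W1 *
     (\sum_(W2 : {set {set X} * K} | rainbow_pm (W1 :|: W2)) bern p W2).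
Proof.
move=> p01 p0_gt0 s01 y1 pAB small.
pose good (i : {set X * X} * {set X * K}) :=
  has_pm Gam A B i.1 && has_pm (fun _ _ => true) A C i.2.
pose mu (i : {set X * X} * {set X * K}) : R := bern (fun=> s) i.1 * bern (fun=> s) i.2.
pose H (i : {set X * X} * {set X * K}) : {set {set X} * K} :=
  [set ([set x; h1 i.1 x], h2 i.2 x) | x in A].
have s_ge0 : 0 <= s by case/andP: s01.
have b_ge0 (O : finType) (G : {set O}) : 0 <= bern (fun=> s) G by apply: bern_ge0.
have mu_ge0 i : 0 <= mu i by rewrite mulr_ge0.
have goodP i x : good i -> x \in A -> [/\ h1 i.1 x \in B, Gam x (h1 i.1 x),
    (x, h1 i.1 x) \in i.1, h2 i.2 x \in C & (x, h2 i.2 x) \in i.2].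
  move=> /andP[/h1P/andP[_ /forall_inP H1] /h2P/andP[_ /forall_inP H2]] xA.
  by have /and3P[] := H1 x xA; have /and3P[] := H2 x xA.
have pH i x : good i -> x \in H i -> p0 <= p x.
  move=> gi /imsetP[z zA ->]; have [? ? _ ? _] := goodP i z gi zA; exact: pAB.
have spread (S : {set {set X} * K}) : \sum_(i | good i && (S \subset H i)) mu i <= (s ^+ 2) ^+ #|S|.
  case: (boolP [exists i, good i && (S \subset H i)]) => [/existsP[i0 /andP[g0 S0]]|]; last first.
    rewrite negb_exists => /forallP none; rewrite big_pred0 ?exprn_ge0 ?sqr_ge0 // => i.
    exact/negbTE/none.
  pose AS := [set x in A | ([set x; h1 i0.1 x], h2 i0.2 x) \in S].
  have cAS : (#|S| <= #|AS|)%N.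
    have -> : S = [set ([set x; h1 i0.1 x], h2 i0.2 x) | x in AS].
      apply/setP => z; apply/idP/imsetP => [zS|[x]]; last by rewrite inE => /andP[_ xS ->].
      by have /imsetP[x xA zE] := subsetP S0 z zS; exists x; rewrite // inE xA -zE.
    exact: leq_imset_card.
  pose F1 := [set (x, h1 i0.1 x) | x in AS]; pose F2 := [set (x, h2 i0.2 x) | x in AS].
  have c1 : #|F1| = #|AS| by apply: card_imset => x x' [].
  have c2 : #|F2| = #|AS| by apply: card_imset => x x' [].
  apply: (@le_trans _ _ (\sum_(i : {set X * X} * {set X * K} | (F1 \subset i.1) && (F2 \subset i.2)) mu i)).
    apply: ler_sum_subset => // i /andP[gi Si].
    have H0 x : x \in AS -> (x, h1 i0.1 x) \in i.1 /\ (x, h2 i0.2 x) \in i.2.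
      rewrite inE => /andP[xA /(subsetP Si)/imsetP[x' x'A [e1 e2]]].
      have [B0 _ _ _ _] := goodP i0 x g0 xA; have [Bi _ G1 _ G2] := goodP i x' gi x'A.
      by have [ex eh] := set2_disjoint_inj disAB xA x'A B0 Bi e1; rewrite eh e2 ex.
    by apply/andP; split; apply/subsetP => _ /imsetP[x xAS ->]; have [] := H0 x xAS.
  rewrite -(pair_big (fun G1 : {set X * X} => F1 \subset G1) (fun G2 : {set X * K} => F2 \subset G2)
     (fun G1 G2 => bern (fun=> s) G1 * bern (fun=> s) G2)) /=.
  rewrite (eq_bigr (fun G1 => bern (fun=> s) G1 * s ^+ #|AS|)); last first.
    by move=> G1 _; rewrite -mulr_sumr bern_supset prodr_const c2.
  rewrite -mulr_suml bern_supset prodr_const c1 -expr2 exprAC.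
  by apply: ler_wiXn2l cAS; rewrite ?sqr_ge0 // expr_le1 //; case/andP: s01.
(* Each graph has a perfect matching with probability at least 1/2, so the mass is at least 1/4;
   hence M0 = 1/8. *)
have mass : 2 * 8^-1 <= \sum_(i | good i) mu i.
  rewrite -(pair_big (fun G1 => has_pm Gam A B G1) (fun G2 => has_pm (fun _ _ => true) A C G2)
     (fun G1 G2 => bern (fun=> s) G1 * bern (fun=> s) G2)) /=.
  rewrite (eq_bigr (fun G1 => bern (fun=> s) G1 * \sum_(G2 : {set X * K} | has_pm (fun _ _ => true) A C G2) bern (fun=> s) G2)); last first.
    by move=> G1 _; rewrite mulr_sumr.
  rewrite -mulr_suml.
  have m1 := pm_prob x0 cardA cardB SR s01 small.
  (* In the complete pair the larger of S and T has at least (a+1)/2 elements, hence at least c by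
     [c_le]. *)
  have SR2 (S : {set X}) (T : {set K}) : S \subset A -> T \subset C -> (a < #|S| + #|T|)%N ->
      (c * minn #|S| #|T| <= #|bip_edges (fun _ _ => true) S T|)%N.
    move=> SA TC ST.
    have -> : bip_edges (fun _ _ => true) S T = setX S T.
      by apply/setP => z; rewrite !inE andbT.
    rewrite cardsX; case: (leqP #|S| #|T|) => le.
      by rewrite [X in (_ <= X)%N]mulnC leq_mul //; lia.
    by rewrite leq_mul //; lia.
  have m2 := pm_prob k0 cardA cardC SR2 s01 small.
  by move: m1 m2; move: (\sum_(_ | _) _) (\sum_(_ | _) _) => u v; nra.
have Hm i : good i -> (#|H i| <= a)%N by move=> _; rewrite -cardA; apply: leq_imset_card.
have M0 : 0 < 8^-1 :> R by rewrite invr_gt0.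
have := spread_two_rounds p01 p0_gt0 (sqr_ge0 s) mu_ge0 pH spread t y1 M0 mass Hm.
move/le_trans; apply; apply: ler_sum => W1 _; rewrite ler_wpM2l ?bern_ge0 //.
apply: ler_sum_subset => [W2 _|W2 /existsP[i /andP[gi Hi]]]; first exact: bern_ge0.
have /andP[/h1P/andP[inj1 _] /h2P/andP[inj2 _]] := gi.
apply/existsP; exists (h1 i.1); apply/existsP; exists (h2 i.2); rewrite inj1 inj2 /=.
apply/forall_inP => x xA; have [-> _ _ -> _] := goodP i x gi xA; rewrite /=.
by apply: (subsetP Hi); apply/imsetP; exists x.
Qed.

End RainbowMatching.

(** * Lower-regular pairs *)

Section BipartiteCount.
Variables (X Y : finType) (Gam : X -> Y -> bool).
Implicit Types (S : {set X}) (T : {set Y}).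

Lemma card_bip_edges S T :
  #|bip_edges Gam S T| = \sum_(x in S) #|[set y in T | Gam x y]|.
Proof.
rewrite (eq_bigr (fun x => \sum_(y | (y \in T) && Gam x y) 1)); last first.
  by move=> x _; rewrite -sum1_card; apply: eq_bigl => y; rewrite inE.
rewrite (pair_big_dep (mem S) (fun x y => (y \in T) && Gam x y) (fun _ _ => 1)) /= sum1_card.
by apply: eq_card => z; rewrite inE unfold_in.
Qed.

Lemma bip_edges_splitl S S' T : S' \subset S ->
  #|bip_edges Gam S T| = #|bip_edges Gam S' T| + #|bip_edges Gam (S :\: S') T|.
Proof. by move=> SS; rewrite !card_bip_edges (big_setID S') /= (setIidPr SS). Qed.

Lemma bip_edges_le S T : #|bip_edges Gam S T| <= #|S| * #|T|.
Proof.
rewrite -cardsX; apply/subset_leq_card/subsetP => z.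
by rewrite !inE => /and3P[-> ->].
Qed.

Lemma bip_edges_ge S T k : (forall x, x \in S -> k <= #|[set y in T | Gam x y]|) ->
  k * #|S| <= #|bip_edges Gam S T|.
Proof.
by move=> deg; rewrite card_bip_edges mulnC -sum_nat_const; apply: leq_sum.
Qed.

(** Deleting a vertex of minimum degree from S never lowers the density; this is repeated until k
    vertices are left. *)
Lemma bip_edges_avg S T k : k <= #|S| -> exists2 S' : {set X}, S' \subset S &
  #|S'| = k /\ k * #|bip_edges Gam S T| <= #|S| * #|bip_edges Gam S' T|.
Proof.
move: {2}#|S|.+1 (ltnSn #|S|) => m; elim: m S => // m IH S; rewrite ltnS => Sm kS.
have [<-|kn] := eqVneq #|S| k; first by exists S.
have /card_gt0P[x0 x0S] : 0 < #|S| by apply: leq_trans (_ : k.+1 <= _); lia.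
pose dg x := #|[set y in T | Gam x y]|.
case: (arg_minnP dg x0S) => x xS xmin; rewrite -/(x \in S) in xS.
have Sx : #|S| = #|S :\ x|.+1 by rewrite (cardsD1 x S) xS.
have [||S' S'S [S'k S'e]] := IH (S :\ x); [by rewrite -Sx | by lia|].
exists S'; first exact: subset_trans S'S (subsetDl _ _).
split=> //.
have eS : #|bip_edges Gam S T| = dg x + #|bip_edges Gam (S :\ x) T|.
  by rewrite (@bip_edges_splitl S [set x]) ?sub1set // card_bip_edges big_set1.
have min_le : dg x * #|S :\ x| <= #|bip_edges Gam (S :\ x) T|.
  by apply: bip_edges_ge => z /setD1P[_ zS]; apply: xmin.
have [S0|Spos] := posnP #|S :\ x|.
  by have -> : k = 0 by lia.
rewrite -(leq_pmul2l Spos) Sx eS; move: min_le S'e.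
set d := dg x; set e1 := #|bip_edges Gam (S :\ x) T|; set e2 := #|bip_edges Gam S' T|.
set q := #|S :\ x| => h1 h2.
have h3 : q.+1 * (k * e1) <= q.+1 * (q * e2) by rewrite leq_mul2l h2 orbT.
have h4 : k * (d * q) <= k * e1 by rewrite leq_mul2l h1 orbT.
by nia.
Qed.

End BipartiteCount.

Lemma bip_edges_swap (X Y : finType) (Gam : X -> Y -> bool) (S : {set X}) (T : {set Y}) :
  #|bip_edges Gam S T| = #|bip_edges (fun y x => Gam x y) T S|.
Proof.
have inj : injective (fun z : X * Y => (z.2, z.1)) by move=> [x y] [x' y'] [-> ->].
rewrite -(card_imset _ inj); apply: eq_card => -[y x]; rewrite !inE /=.
apply/imsetP/and3P => [[[x' y']]|[yT xS xy]]; first by rewrite inE => /and3P[? ? ?] [-> ->].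
by exists (x, y); rewrite // inE /= xS yT xy.
Qed.

Lemma bip_edges_splitr (X Y : finType) (Gam : X -> Y -> bool) (S : {set X}) (T T' : {set Y}) :
  T' \subset T ->
  #|bip_edges Gam S T| = #|bip_edges Gam S T'| + #|bip_edges Gam S (T :\: T')|.
Proof. by move=> TT; rewrite !(bip_edges_swap Gam) (bip_edges_splitl _ _ TT). Qed.

Section RegularPair.
Local Open Scope ring_scope.
Variables (R : archiRealFieldType) (X : finType) (Gam : X -> X -> bool).
Hypothesis Gam_sym : forall x y, Gam x y = Gam y x.

Let e (S T : {set X}) : R := #|bip_edges Gam S T|%:R.
Let sz (S : {set X}) : R := #|S|%:R.

Implicit Types S T : {set X}.

Let e_sym S T : e S T = e T S.
Proof.
rewrite /e bip_edges_swap; congr (_%:R); apply: eq_card => z; rewrite !inE.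
by rewrite Gam_sym.
Qed.

Let e_ge0 S T : 0 <= e S T. Proof. exact: ler0n. Qed.

Let e_splitl S (S' : {set X}) T : S' \subset S -> e S T = e S' T + e (S :\: S') T.
Proof. by move=> SS; rewrite /e (bip_edges_splitl _ _ SS) natrD. Qed.

Let e_splitr S T (T' : {set X}) : T' \subset T -> e S T = e S T' + e S (T :\: T').
Proof. by move=> TT; rewrite /e (bip_edges_splitr _ _ TT) natrD. Qed.

Let e_le S T : e S T <= sz S * sz T.
Proof. by rewrite -natrM ler_nat bip_edges_le. Qed.

Let sz_split S (S' : {set X}) : S' \subset S -> sz S = sz S' + sz (S :\: S').
Proof. by move=> SS; rewrite /sz -natrD cardsD (setIidPr SS) subnKC // subset_leq_card. Qed.

Let sz_le S (S' : {set X}) : S' \subset S -> sz S' <= sz S.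
Proof. by move=> SS; rewrite ler_nat subset_leq_card. Qed.

Let e_avg (S T : {set X}) : exists S' T' : {set X}, [/\ S' \subset S, T' \subset T,
  #|S'| = minn #|S| #|T|, #|T'| = minn #|S| #|T| &
  e S T * (minn #|S| #|T|)%:R ^+ 2 <= e S' T' * (sz S * sz T)].
Proof.
have one (U W : {set X}) : (#|U| <= #|W|)%N -> exists2 W' : {set X}, W' \subset W &
    #|W'| = #|U| /\ e W U * #|U|%:R ^+ 2 <= e W' U * (sz U * sz W).
  move=> le; have [W' W'W [W'c avg]] := bip_edges_avg Gam U le.
  exists W' => //; split=> //; move: avg; rewrite -(ler_nat R) !natrM -/(e _ _) -/(e _ _) -/(sz _) -/(sz _).
  by have := ler0n R #|U|; rewrite -/(sz U); nra.
case: (leqP #|S| #|T|) => [le|/ltnW le].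
  have [T' T'T [T'c avg]] := one S T le; exists S, T'; split=> //.
  by rewrite (e_sym S T) (e_sym S T').
have [S' S'S [S'c avg]] := one T S le; exists S', T; split=> //.
by rewrite (mulrC (sz S)).
Qed.

(* The pair maximises e(S, T)^(N+1) / |S|^(2N) among disjoint pairs of equal
   size: no part of it can be much denser, hence no part much sparser. *)
Lemma lower_regular (delta eps1 eta eps : R) (N : nat) (k0 : nat) (S00 T00 : {set X}) :
    0 < delta <= 1 -> 0 < eps1 -> 0 < eta -> 0 < eps ->
    1 <= (1 + eta) ^+ N.+1 * eps ^+ 2 -> eta + 2 * eps <= delta * eps1 ^+ 2 / 2 ->
    (0 < k0)%N -> [disjoint S00 & T00] -> #|S00| = k0 -> #|T00| = k0 ->
    delta * k0%:R ^+ 2 <= #|bip_edges Gam S00 T00|%:R ->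
  exists S0 T0 : {set X}, [/\ [disjoint S0 & T0], #|S0| = #|T0|, (#|S0| <= k0)%N,
    delta ^+ N.+1 * k0%:R <= #|S0|%:R &
    forall S T : {set X}, S \subset S0 -> T \subset T0 ->
      eps1 * #|S0|%:R <= #|S|%:R -> eps1 * #|S0|%:R <= #|T|%:R ->
      delta / 2 * (#|S|%:R * #|T|%:R) <= #|bip_edges Gam S T|%:R].
Proof.
move=> /andP[d_gt0 d_le1] eps1_gt0 eta_gt0 eps_gt0 big sm k0_gt0 dis0 S00k T00k dens.
pose P (w : {set X} * {set X}) :=
  [&& [disjoint w.1 & w.2], #|w.1| == #|w.2|, (#|w.1| <= k0)%N & (0 < #|w.1|)%N].
pose F (w : {set X} * {set X}) : R := e w.1 w.2 ^+ N.+1 / sz w.1 ^+ (2 * N).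
have P0 : P (S00, T00) by rewrite /P /= dis0 S00k T00k eqxx leqnn.
case: (arg_maxP F P0) => -[S0 T0] /and4P[/= dis /eqP eqc le_k0 S0pos] Fmax.
exists S0, T0.
have k0R : 0 < k0%:R :> R by rewrite ltr0n.
have s0_gt0 : 0 < sz S0 by rewrite ltr0n.
have szT : sz T0 = sz S0 by rewrite /sz eqc.
have [d dE] : exists d : R, d = e S0 T0 / sz S0 ^+ 2 by eexists.
have e0E : e S0 T0 = d * sz S0 ^+ 2 by rewrite dE divfK // gt_eqF // exprn_gt0.
have d_ge0 : 0 <= d by rewrite dE divr_ge0 // exprn_ge0 // ltW.
have d_lt1 : d <= 1.
  by rewrite dE ler_pdivrMr ?exprn_gt0 // mul1r expr2 -{2}szT; apply: e_le.
have pow (x s : R) : 0 < s -> (x * s ^+ 2) ^+ N.+1 / s ^+ (2 * N) = x ^+ N.+1 * s ^+ 2.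
  move=> s_gt0; rewrite exprMn -exprM mulnS exprD mulrA mulfK //.
  by rewrite gt_eqF // exprn_gt0.
have ME : F (S0, T0) = d ^+ N.+1 * sz S0 ^+ 2 by rewrite /F /= e0E pow.
(* Comparison with the starting pair: it yields delta <= d below and, as d <= 1, the lower bound on
   the size of S0. *)
have Mge : delta ^+ N.+1 * k0%:R ^+ 2 <= d ^+ N.+1 * sz S0 ^+ 2.
  rewrite -ME; apply: le_trans (Fmax _ P0); rewrite /F /= /sz S00k -(pow delta) //.
  rewrite ler_wpM2r ?invr_ge0 ?exprn_ge0 ?(ltW k0R) // lerXn2r ?nnegrE //.
  by rewrite mulr_ge0 ?exprn_ge0 ?(ltW k0R) // ltW.
have s0k : sz S0 <= k0%:R by rewrite ler_nat.
have dd : delta <= d.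
  rewrite -(@ler_pXn2r _ N.+1) ?nnegrE ?(ltW d_gt0) //.
  rewrite -(ler_pM2r (exprn_gt0 2 s0_gt0)); apply: le_trans Mge.
  by rewrite ler_wpM2l ?exprn_ge0 ?(ltW d_gt0) // lerXn2r ?nnegrE ?(ltW s0_gt0) ?(ltW k0R).
have dN1 : delta ^+ N.+1 <= 1 by rewrite exprn_ile1 // ltW.
have dN0 : 0 <= delta ^+ N.+1 by rewrite exprn_ge0 // ltW.
split=> //.
  rewrite -(@ler_pXn2r _ 2) ?nnegrE ?mulr_ge0 ?(ltW k0R) ?(ltW s0_gt0) // exprMn.
  apply: (@le_trans _ _ (delta ^+ N.+1 * k0%:R ^+ 2)).
    by rewrite ler_wpM2r ?exprn_ge0 ?(ltW k0R) // expr2 ler_piMl.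
  by apply: (le_trans Mge); rewrite ler_piMl ?exprn_ge0 ?(ltW s0_gt0) // exprn_ile1.
(* Averaging reduces to sides of equal size k. If k < eps |S0|, the trivial bound |S| |T| suffices.
   Otherwise maximality of [F] applies, where the ratio of the squared sizes is at most eps^-2 and
   is absorbed by (1 + eta)^(N+1). *)
have part (S T : {set X}) : S \subset S0 -> T \subset T0 ->
    e S T <= d * (1 + eta) * (sz S * sz T) + eps * sz S0 ^+ 2.
  move=> SS TT.
  have S_ge0 : 0 <= sz S by apply: ler0n.
  have T_ge0 : 0 <= sz T by apply: ler0n.
  have Sle := sz_le SS; have Tle := sz_le TT; rewrite szT in Tle.
  have [S' [T' [S'S T'T S'c T'c avg]]] := e_avg S T.
  set k := minn #|S| #|T| in S'c T'c avg.
  have c_ge0 : 0 <= d * (1 + eta) by rewrite mulr_ge0 // addr_ge0 // ltW.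
  have [small|large] := ltP k%:R (eps * sz S0).
    apply: (le_trans (e_le S T)); rewrite ler_wpDl ?(mulr_ge0 c_ge0) ?mulr_ge0 //.
    have [e1|e1] : k%:R = sz S \/ k%:R = sz T.
      by rewrite /k /minn; case: ifP => _; [left|right].
      by rewrite -e1 expr2 mulrA ler_pM // ltW.
    by rewrite -e1 mulrC expr2 mulrA ler_pM // ltW.
  have k_gt0 : 0 < k%:R :> R by apply: lt_le_trans large; rewrite mulr_gt0.
  have k2 : 0 < k%:R ^+ 2 :> R by rewrite exprn_gt0.
  have [d2 d2E] : exists d2 : R, d2 = e S' T' / k%:R ^+ 2 by eexists.
  have e2E : e S' T' = d2 * k%:R ^+ 2 by rewrite d2E divfK // gt_eqF.
  have d2_ge0 : 0 <= d2 by rewrite d2E divr_ge0 // ltW.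
  have P2 : P (S', T').
    rewrite /P /= S'c T'c eqxx /= -(ltr0n R) k_gt0 andbT.
    rewrite (disjointWl (subset_trans S'S SS)) ?(disjointWr (subset_trans T'T TT)) //=.
    by apply: leq_trans le_k0; rewrite -S'c subset_leq_card // (subset_trans S'S).
  have := Fmax _ P2; rewrite ME /F /= /sz S'c e2E pow // => F2.
  have d2le : d2 <= d * (1 + eta).
    rewrite -(@ler_pXn2r _ N.+1) ?nnegrE // exprMn.
    have kk : eps ^+ 2 * sz S0 ^+ 2 <= k%:R ^+ 2.
      by rewrite -exprMn lerXn2r ?nnegrE ?mulr_ge0 ?(ltW eps_gt0) ?(ltW s0_gt0) ?(ltW k_gt0).
    have s2 : 0 < sz S0 ^+ 2 by rewrite exprn_gt0.
    have h1 : d2 ^+ N.+1 * eps ^+ 2 <= d ^+ N.+1.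
      rewrite -(ler_pM2r s2) -mulrA; apply: le_trans F2.
      by rewrite ler_wpM2l ?exprn_ge0.
    have dN : 0 <= d ^+ N.+1 by rewrite exprn_ge0.
    have d2N : 0 <= d2 ^+ N.+1 by rewrite exprn_ge0.
    have eN : 0 <= (1 + eta) ^+ N.+1 by rewrite exprn_ge0 // addr_ge0 // ltW.
    apply: (@le_trans _ _ (d2 ^+ N.+1 * ((1 + eta) ^+ N.+1 * eps ^+ 2))).
      by rewrite ler_peMr.
    by rewrite mulrCA mulrC ler_wpM2r.
  have : e S T <= d2 * (sz S * sz T).
    by rewrite -(ler_pM2r k2) mulrAC -e2E.
  move/le_trans; apply; rewrite ler_wpDr ?mulr_ge0 ?exprn_ge0 ?(ltW eps_gt0) ?(ltW s0_gt0) //.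
  by rewrite ler_wpM2r // mulr_ge0.
move=> S T SS TT Sb Tb.
(* The edges between S and T are those between S0 and T0 without those between S0 :\: S and T0 and
   between S and T0 :\: T. Both removed parts are bounded by [part], so at most (d * eta + 2 * eps)
   |S0|^2 is lost. *)
have E1 := e_splitl T0 SS; have E2 := e_splitr S TT.
have p1 := part (S0 :\: S) T0 (subsetDl _ _) (subxx _).
have p2 := part S (T0 :\: T) SS (subsetDl _ _).
have z1 := sz_split SS; have z2 := sz_split TT; rewrite szT in p1 z2.
rewrite -/(e S T) -/(sz S) -/(sz T); rewrite -/(sz _) -/(sz _) in Sb; rewrite -/(sz _) -/(sz _) in Tb.
have ST : eps1 ^+ 2 * sz S0 ^+ 2 <= sz S * sz T.
  rewrite -exprMn expr2; apply: ler_pM => //; by rewrite mulr_ge0 // ltW.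
have eta_le : (eta + 2 * eps) * sz S0 ^+ 2 <= delta / 2 * (sz S * sz T).
  apply: (@le_trans _ _ (delta * eps1 ^+ 2 / 2 * sz S0 ^+ 2)); first by rewrite ler_wpM2r // exprn_ge0 // ltW.
  have -> : delta * eps1 ^+ 2 / 2 * sz S0 ^+ 2 = delta / 2 * (eps1 ^+ 2 * sz S0 ^+ 2) by field.
  by rewrite ler_wpM2l // divr_ge0 // ltW.
have S_ge0 : 0 <= sz S by apply: ler0n.
have T_ge0 : 0 <= sz T by apply: ler0n.
have dST : delta * (sz S * sz T) <= d * (1 + eta) * (sz S * sz T).
  rewrite ler_wpM2r ?mulr_ge0 //; apply: (le_trans dd); rewrite ler_peMr // lerDl ltW //.
have deta : d * eta * sz S0 ^+ 2 <= eta * sz S0 ^+ 2.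
  by rewrite ler_wpM2r ?exprn_ge0 ?(ltW s0_gt0) // ler_piMl // ltW.
move: E1; rewrite E2 e0E => E1.
have zz : sz S0 ^+ 2 = sz S * sz T + sz S * sz (T0 :\: T) + sz (S0 :\: S) * sz S0.
  by rewrite expr2 {1}z1 mulrDl {1}z2 mulrDr.
have key : d * (1 + eta) * sz S0 ^+ 2 = d * (1 + eta) * (sz S * sz T) +
   d * (1 + eta) * (sz S * sz (T0 :\: T)) + d * (1 + eta) * (sz (S0 :\: S) * sz S0).
  by rewrite zz !mulrDr.
have key2 : d * (1 + eta) * sz S0 ^+ 2 = d * sz S0 ^+ 2 + d * eta * sz S0 ^+ 2 by ring.
by lra.
Qed.
End RegularPair.

Section RegularPairExists.
Local Open Scope ring_scope.

(** A vertex of an arbitrary k0-set T has at least delta |X| - k0 >= delta |X| / 2 neighbours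
    outside T; averaging over the complement of T then gives S. *)
Lemma min_degree_pair (R : archiRealFieldType) (delta : R) (X : finType)
    (Gam : X -> X -> bool) (k0 : nat) :
    (forall x y, Gam x y = Gam y x) ->
    0 < delta <= 1 -> (0 < k0)%N -> 2 * k0%:R <= delta * #|X|%:R ->
    (forall x, delta * #|X|%:R <= #|[set y | Gam x y]|%:R) ->
  exists S T : {set X}, [/\ [disjoint S & T], #|S| = k0, #|T| = k0 &
    delta / 2 * k0%:R ^+ 2 <= #|bip_edges Gam S T|%:R]%R.
Proof.
move=> Gam_sym /andP[d0 d1] k0_gt0 k0le deg.
have X_ge0 : (0 <= #|X|%:R :> R)%R by apply: ler0n.
have k0X : (2 * k0 <= #|X|)%N.
  by rewrite -(ler_nat R) natrM; apply: le_trans k0le _; rewrite ler_piMl.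
have [T _ Tk] := @exists_subset_card _ [set: X] k0 ltac:(rewrite cardsT; lia).
have cT : #|~: T| = (#|X| - k0)%N by have := cardsC T; rewrite Tk; lia.
have [S ST [Sk avg]] := @bip_edges_avg _ _ Gam (~: T) T k0 ltac:(rewrite cT; lia).
exists S, T; split=> //; first by rewrite disjoints_subset.
have low : (k0%:R * (delta / 2 * #|X|%:R) <= #|bip_edges Gam (~: T) T|%:R :> R)%R.
  rewrite bip_edges_swap card_bip_edges natr_sum -Tk mulr_natl -sumr_const.
  apply: ler_sum => x xT.
  have : (#|[set y | Gam x y]| <= #|[set y in ~: T | Gam y x]| + #|T|)%N.
    have -> : #|[set y | Gam x y]| = (#|[set y | Gam x y] :\: T| + #|[set y | Gam x y] :&: T|)%N.
      by rewrite addnC cardsID.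
    apply: leq_add; last exact/subset_leq_card/subsetIr.
    by apply/subset_leq_card/subsetP => y; rewrite !inE Gam_sym.
  rewrite -(ler_nat R) natrD Tk => le.
  by have := deg x; move: le k0le => /=; lra.
have X_gt0 : (0 < #|X|%:R :> R)%R by rewrite ltr0n; lia.
rewrite -(ler_pM2r X_gt0).
have cT' : (#|~: T|%:R <= #|X|%:R :> R)%R by rewrite ler_nat cT leq_subr.
move: avg; rewrite -(ler_nat R) !natrM => avg.
apply: le_trans (_ : k0%:R * #|bip_edges Gam (~: T) T|%:R <= _)%R.
  have -> : (delta / 2 * k0%:R ^+ 2 * #|X|%:R = k0%:R * (k0%:R * (delta / 2 * #|X|%:R)))%R by ring.
  by rewrite ler_wpM2l.
by apply: (le_trans avg); rewrite mulrC ler_wpM2l.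
Qed.

(** Lower regularity says nothing about small S or T, so vertices of low degree are deleted first,
    the same number on either side. If |S| is small, T is almost a whole side and each vertex of S
    keeps many neighbours in T; likewise with S and T exchanged; if both are large, regularity
    applies. The bound is stated for all nearly full A1 and B1 because the embedding decides what
    remains of the pair. *)
Lemma regular_pair (R : archiRealFieldType) (delta : R) : (0 < delta <= 1)%R ->
  exists beta rho : R, [/\ 0 < beta, 0 < rho, rho <= 1 &
  forall (X : finType) (Gam : X -> X -> bool) (k0 : nat),
    (forall x y, Gam x y = Gam y x) -> (0 < k0)%N -> 2 * k0%:R <= delta * #|X|%:R ->
    (forall x, delta * #|X|%:R <= #|[set y | Gam x y]|%:R) ->
  exists A0 B0 : {set X}, [/\ [disjoint A0 & B0], #|A0| = #|B0|, (#|A0| <= k0)%N,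
    beta * k0%:R <= #|A0|%:R &
    forall A1 B1 S T : {set X}, A1 \subset A0 -> B1 \subset B0 -> #|A1| = #|B1| ->
      (#|A0| - #|A1|)%:R <= rho * #|A0|%:R -> S \subset A1 -> T \subset B1 ->
      (#|A1| < #|S| + #|T|)%N ->
      rho * #|A0|%:R * (minn #|S| #|T|)%:R <= #|bip_edges Gam S T|%:R]]%R.
Proof.
move=> d01; have /andP[d0 d1] := d01.
have [g gE] : exists g : R, g = delta / 4 by eexists.
have g0 : 0 < g by lra.
have g1 : g <= 1 / 4 by lra.
have [e1 e1E] : exists e1 : R, e1 = g / 16 by eexists.
have e1_0 : 0 < e1 by lra.
(* u plays both eta and eps in [lower_regular]: the requirement there becomes 3 * u <= 4 * u.
   Bernoulli's inequality then provides N. *)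
have [u uE] : exists u : R, u = delta / 2 * e1 ^+ 2 / 8 by eexists.
have u0 : 0 < u by rewrite uE divr_gt0 // mulr_gt0 ?exprn_gt0 //; lra.
have [N big] : exists N, 1 <= (1 + u) ^+ N.+1 * u ^+ 2.
  exists (Num.bound (u ^- 3)).
  have lt := archi_boundP (ltW (_ : 0 < u ^- 3)); rewrite invr_gt0 exprn_gt0 // in lt.
  have {}lt := lt isT; set N := Num.bound _ in lt *.
  have bern1 : 1 + u * N.+1%:R <= (1 + u) ^+ N.+1.
    elim: N.+1 => [|m IH]; first by rewrite mulr0 addr0 expr0.
    rewrite exprS -natr1; apply: le_trans (ler_wpM2l _ IH); last by lra.
    by have := ler0n R m; set mm := m%:R; nra.
  have N1 : u ^- 3 <= N.+1%:R by apply/ltW/(lt_le_trans lt); rewrite ler_nat.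
  have le : 1 <= u * N.+1%:R * u ^+ 2.
    have -> : u * N.+1%:R * u ^+ 2 = N.+1%:R * u ^+ 3 by ring.
    by rewrite -ler_pdivrMr ?exprn_gt0 // mul1r.
  apply: (le_trans le); rewrite ler_wpM2r ?exprn_ge0 ?(ltW u0) //.
  by apply: le_trans bern1; rewrite lerDr.
have sm : u + 2 * u <= delta / 2 * e1 ^+ 2 / 2.
  have -> : delta / 2 * e1 ^+ 2 / 2 = 4 * u by rewrite uE; field.
  by lra.
have dh : 0 < delta / 2 <= 1 by lra.
exists ((delta / 2) ^+ N.+1 / 2), (g ^+ 2 / 16); split.
- by rewrite divr_gt0 // exprn_gt0 //; lra.
- by rewrite divr_gt0 // exprn_gt0.
- by nra.
move=> X Gam k0 Gam_sym k0_gt0 k0le deg.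
have [S00 [T00 [dis00 S00k T00k dens]]] := min_degree_pair Gam_sym d01 k0_gt0 k0le deg.
have [S0 [T0 [dis eqc le_k0 S0big reg]]] :=
  lower_regular Gam_sym dh e1_0 u0 u0 big sm k0_gt0 dis00 S00k T00k dens.
have k0R : 0 < k0%:R :> R by rewrite ltr0n.
set s := #|S0|%:R : R.
have s0 : 0 < s by apply: lt_le_trans S0big; rewrite mulr_gt0 // exprn_gt0; lra.
(* The starting pair has density delta / 2, and [lower_regular] halves it once more. *)
have gE2 : delta / 2 / 2 = g by rewrite gE; field.
rewrite gE2 in reg.
have degE (Z W : {set X}) x : #|[set y in W | Gam x y]|%:R <= #|[set y in Z | Gam x y]|%:R + #|W :\: Z|%:R :> R.
  rewrite -natrD ler_nat.
  have -> : #|[set y in W | Gam x y]| = (#|[set y in W | Gam x y] :&: Z| + #|[set y in W | Gam x y] :\: Z|)%N by rewrite cardsID.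
  apply: leq_add; apply/subset_leq_card/subsetP => y; rewrite !inE.
    by case/andP => /andP[_ ->] ->.
  by case/and3P => -> ->.
have badle (U W : {set X}) : (forall S T : {set X}, S \subset U -> T \subset W -> e1 * s <= #|S|%:R -> e1 * s <= #|T|%:R ->
      g * (#|S|%:R * #|T|%:R) <= #|bip_edges Gam S T|%:R) -> #|W|%:R = s ->
    #|[set x in U | #|[set y in W | Gam x y]|%:R <= g / 2 * s]|%:R < e1 * s.
  move=> regUW Ws; rewrite ltNge; apply/negP => big2.
  set Bd := [set x in U | _] in big2.
  have BU : Bd \subset U by apply/subsetP => x; rewrite inE => /andP[].
  have := regUW Bd W BU (subxx _) big2; rewrite Ws.
  have -> : e1 * s <= s by rewrite ler_piMl ?(ltW s0) //; lra.
  move=> /(_ isT); rewrite card_bip_edges natr_sum => h.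
  have : \sum_(x in Bd) #|[set y in W | Gam x y]|%:R <= \sum_(x in Bd) g / 2 * s.
    by apply: ler_sum => x; rewrite inE => /andP[].
  rewrite sumr_const -(mulr_natl (g / 2 * s)) => h2.
  have B0 : 0 < #|Bd|%:R :> R by apply: lt_le_trans big2; rewrite mulr_gt0.
  have := le_trans h h2; rewrite leNgt => /negP; apply.
  have -> : g * (#|Bd|%:R * s) = #|Bd|%:R * (g / 2 * s) + #|Bd|%:R * (g / 2 * s) by field.
  by rewrite ltrDl !mulr_gt0 ?invr_gt0.
have bA := badle S0 T0 reg _; rewrite -eqc in bA; have {}bA := bA (erefl _).
have bB : #|[set x in T0 | #|[set y in S0 | Gam x y]|%:R <= g / 2 * s]|%:R < e1 * s.
  apply: badle => // S T ST TS Sb Tb; rewrite mulrC (mulrC #|S|%:R) mulrC.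
  rewrite bip_edges_swap; have := reg T S TS ST Tb Sb.
  by congr (_ <= _%:R); apply: eq_card => z; rewrite !inE Gam_sym.
set BA := [set x in S0 | _] in bA; set BB := [set x in T0 | _] in bB.
pose b := maxn #|BA| #|BB|.
have bs : b%:R < e1 * s by rewrite /b /maxn; case: ifP.
have e1s : e1 * s <= s / 16 by rewrite mulrC ler_wpM2l ?(ltW s0) //; lra.
have extend (U Bd : {set X}) : Bd \subset U -> (#|Bd| <= b)%N -> (b <= #|U|)%N ->
    exists D : {set X}, [/\ Bd \subset D, D \subset U & #|D| = b].
  move=> BU Bb bU; have [|E EU Ec] := @exists_subset_card _ (U :\: Bd) (b - #|Bd|).
    by rewrite cardsD (setIidPr BU) leq_sub2r.
  exists (Bd :|: E); split; [exact: subsetUl| |].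
    by rewrite subUset BU (subset_trans EU) ?subsetDl.
  rewrite cardsU Ec (_ : Bd :&: E = set0) ?cards0 ?subn0 ?subnKC //.
  by apply/eqP; rewrite setI_eq0 disjoint_sym (disjointWl EU) // disjoints_subset subsetDr.
have bS0 : (b <= #|S0|)%N by rewrite -(ler_nat R) -/s; lra.
have subBA : BA \subset S0 by apply/subsetP => x; rewrite inE => /andP[].
have subBB : BB \subset T0 by apply/subsetP => x; rewrite inE => /andP[].
have [DA [BADA DAS DAc]] := extend S0 BA subBA (leq_maxl _ _) bS0.
have [DB [BBDB DBT DBc]] := extend T0 BB subBB (leq_maxr _ _) ltac:(by rewrite -eqc).
have cA : #|S0 :\: DA| = (#|S0| - b)%N by rewrite cardsD (setIidPr DAS) DAc.
have cB : #|T0 :\: DB| = (#|S0| - b)%N by rewrite cardsD (setIidPr DBT) DBc eqc.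
exists (S0 :\: DA), (T0 :\: DB).
set a := #|S0 :\: DA|%:R : R.
have aE : a = s - b%:R by rewrite /a cA natrB.
have b0 : 0 <= b%:R :> R by apply: ler0n.
have a_lo : s * (15 / 16) <= a by rewrite aE; lra.
have a_hi : a <= s by rewrite aE; lra.
have a0 : 0 < a by lra.
split.
- by apply: disjointWl (subsetDl _ _) (disjointWr (subsetDl _ _) dis).
- by rewrite cA cB.
- by rewrite cA (leq_trans (leq_subr _ _)).
- by move: S0big a_lo; rewrite -/s; set w := (_ ^+ _); lra.
move=> A1 B1 S T A1A B1B A1B1c A1big SA TB ST.
have [r rE] : exists r : R, r = #|A1|%:R by eexists.
have rA : a - r <= g ^+ 2 / 16 * a.
  by move: A1big; rewrite natrB ?subset_leq_card // -/a rE.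
have g2 : g ^+ 2 <= g / 4 by rewrite expr2 (_ : g / 4 = g * (1 / 4)) ?ler_wpM2l //; [lra|field].
have rA' : a - r <= g / 64 * a.
  by apply: (le_trans rA); rewrite ler_wpM2r ?(ltW a0) //; lra.
have mindeg (U W D W1 : {set X}) (Q Q' : {set X}) :
   #|W|%:R = s -> #|D| = b -> D \subset W -> #|W1| = #|A1| -> W1 \subset W :\: D -> Q' \subset W1 ->
   (forall x, x \in Q -> g / 2 * s < #|[set y in W | Gam x y]|%:R) ->
   (#|A1| < #|Q| + #|Q'|)%N -> #|Q|%:R <= g / 8 * a ->
   g ^+ 2 / 16 * a * #|Q|%:R <= #|bip_edges Gam Q Q'|%:R.
  move=> Ws Db DW W1c W1W Q'W hdeg QQ Qle.
  rewrite card_bip_edges natr_sum.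
  have -> : g ^+ 2 / 16 * a * #|Q|%:R = \sum_(x in Q) g ^+ 2 / 16 * a.
    by rewrite sumr_const -[RHS]mulr_natr.
  apply: ler_sum => x xQ; have := hdeg x xQ; have := degE Q' W x.
  have Q'W' : Q' \subset W by apply: subset_trans Q'W (subset_trans W1W (subsetDl _ _)).
  have -> : #|W :\: Q'|%:R = s - #|Q'|%:R :> R by rewrite cardsD (setIidPr Q'W') natrB ?subset_leq_card // Ws.
  have QQ' : r <= #|Q|%:R + #|Q'|%:R by rewrite rE -natrD ler_nat ltnW.
  have ga : g ^+ 2 / 16 * a <= g / 64 * a by rewrite ler_wpM2r ?(ltW a0) //; lra.
  have gs : g / 64 * a <= g / 64 * s by rewrite ler_wpM2l //; lra.
  have gs2 : g / 8 * a <= g / 8 * s by rewrite ler_wpM2l //; lra.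
  have e1s' : e1 * s = g * s / 16 by rewrite e1E; field.
  have gsE : g / 64 * s = g * s / 64 by field.
  have gsE2 : g / 8 * s = g * s / 8 by field.
  have gsE3 : g / 2 * s = g * s / 2 by field.
  have gs0 : 0 < g * s by rewrite mulr_gt0.
  by move: aE bs; lra.
have degA x : x \in S -> g / 2 * s < #|[set y in T0 | Gam x y]|%:R.
  move=> /(subsetP SA)/(subsetP A1A)/setDP[xS xD]; rewrite ltNge; apply: contra xD => le.
  by apply: (subsetP BADA); rewrite inE xS.
have degB x : x \in T -> g / 2 * s < #|[set y in S0 | Gam x y]|%:R.
  move=> /(subsetP TB)/(subsetP B1B)/setDP[xS xD]; rewrite ltNge; apply: contra xD => le.
  by apply: (subsetP BBDB); rewrite inE xS.
have rho_ge0 : 0 <= g ^+ 2 / 16 * a by rewrite mulr_ge0 ?(ltW a0) // divr_ge0 // exprn_ge0 // ltW.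
have [Ssm|Slarge] := leP #|S|%:R (g / 8 * a).
  apply: (@le_trans _ _ (g ^+ 2 / 16 * a * #|S|%:R)).
    by rewrite ler_wpM2l // ler_nat geq_minl.
  apply: (mindeg S0 T0 DB B1) => //; by rewrite ?eqc // /s eqc.
have [Tsm|Tlarge] := leP #|T|%:R (g / 8 * a).
  apply: (@le_trans _ _ (g ^+ 2 / 16 * a * #|T|%:R)).
    by rewrite ler_wpM2l // ler_nat geq_minr.
  have -> : #|bip_edges Gam S T| = #|bip_edges Gam T S|.
    by rewrite bip_edges_swap; apply: eq_card => z; rewrite !inE Gam_sym.
  by apply: (mindeg T0 S0 DA A1) => //; rewrite addnC.
have e1a : e1 * s <= g / 8 * a.
  have : g / 8 * (s * (15 / 16)) <= g / 8 * a by rewrite ler_wpM2l //; lra.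
  have -> : g / 8 * (s * (15 / 16)) = g * s * (15 / 128) by field.
  have -> : e1 * s = g * s / 16 by rewrite e1E; field.
  have : 0 < g * s by rewrite mulr_gt0.
  by lra.
have sub1 : S \subset S0 by apply: subset_trans SA (subset_trans A1A (subsetDl _ _)).
have sub2 : T \subset T0 by apply: subset_trans TB (subset_trans B1B (subsetDl _ _)).
have := reg S T sub1 sub2 (le_trans e1a (ltW Slarge)) (le_trans e1a (ltW Tlarge)).
apply: le_trans.
have c1 : 0 <= #|S|%:R :> R by apply: ler0n.
have c2 : 0 <= #|T|%:R :> R by apply: ler0n.
apply: (@le_trans _ _ (g * (g / 8 * a) * (minn #|S| #|T|)%:R)).
  rewrite ler_wpM2r ?ler0n // mulrA ler_wpM2r ?(ltW a0) //.
  by have := exprn_ge0 2 (ltW g0); rewrite (_ : g * (g / 8) = g ^+ 2 / 8); [lra | field].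
rewrite -mulrA ler_wpM2l ?(ltW g0) //.
have ga0 : 0 <= g / 8 * a by rewrite mulr_ge0 ?(ltW a0) // divr_ge0 // ltW.
by rewrite /minn; case: ifP => _; [rewrite mulrC ler_wpM2l | rewrite ler_wpM2r] => //; rewrite ltW.
Qed.

End RegularPairExists.

(** * Greedy embedding of a tree *)

Lemma connect_closed (V : finType) (r : rel V) (C : {set V}) (x y : V) :
  (forall a b, r a b -> a \in C -> b \in C) -> connect r x y -> x \in C -> y \in C.
Proof.
move=> step /connectP[p pp ->]; elim: p x pp => //= b p IH x /andP[xb pp] xC.
exact: IH pp (step _ _ xb xC).
Qed.

Section TreeOrder.
Variables (V : finType) (T : sgraph V).

Lemma adj_sym x y : adj T x y = adj T y x.
Proof. by rewrite /adj setUC. Qed.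

Lemma adj_irrefl x : adj T x x = false.
Proof.
apply/negP => /(subsetP (edges_pairs T)); rewrite inE setUid cards1.
by [].
Qed.

Definition restr_adj (S : {set V}) : rel V := [rel x y | [&& x \in S, y \in S & adj T x y]].

Lemma restr_path (S : {set V}) x p : path (restr_adj S) x p -> x \in S ->
  all (mem S) p /\ path (adj T) x p.
Proof.
elim: p x => [|y p IH] x //= /andP[/and3P[xS yS xy] pp] _.
by have [-> ->] := IH y pp yS; rewrite xy yS.
Qed.

(** Otherwise a path from x to y inside S, closed up through v, would be a cycle of length at least
    3. *)
Lemma acyclic_unique_nbr (S : {set V}) v x y : gacyclic T ->
  connect (restr_adj S) x y -> x \in S -> v \notin S -> adj T x v -> adj T y v -> x = y.
Proof.
move=> acyc /connectP[p0 pp0 ->] xS vS xv yv; case/shortenP: pp0 yv => p pp up _ yv.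
case: (eqVneq x (last x p)) => // ne; have [allS padj] := restr_path pp xS.
have := acyc (v :: x :: p); rewrite /ucycle /= rcons_path adj_sym xv padj yv /=.
rewrite inE negb_or /=; have -> : (v == x) = false by apply: contraNF vS => /eqP ->.
have -> /= : v \notin p by apply: contra vS => /(allP allS).
move: up; rewrite cons_uniq => /andP[up1 up2]; rewrite up1 up2 => /(_ isT).
by case: (p) ne => //=; rewrite eqxx.
Qed.

(** If every edge leaving S led into L, then S with the leaves hanging on it would be closed under
    adjacency, a leaf having no second neighbour, and connectedness would make it everything. *)
Lemma connected_next (L S : {set V}) (rt : V) : gconnected T ->
    (forall l, l \in L -> deg T l = 1) -> rt \in S -> S \subset ~: L -> S != ~: L ->
  exists v x, [/\ v \notin L, v \notin S, x \in S & adj T x v].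
Proof.
move=> [_ conn] leaf rtS SL SnL.
have [/existsP[v /existsP[x /and4P[]]]|none] := boolP [exists v, exists x,
    [&& v \notin L, v \notin S, x \in S & adj T x v]]; first by exists v, x.
case/negP: SnL; rewrite eqEsubset SL; apply/subsetP => w; rewrite inE => wL.
pose C := S :|: [set l in L | [exists x in S, adj T x l]].
have step a b : adj T a b -> a \in C -> b \in C.
  move=> ab /setUP[aS|].
    rewrite inE; have [//|bS] := boolP (b \in S); rewrite inE /=; apply/andP; split.
      apply: contraNT none => bL; apply/existsP; exists b; apply/existsP; exists a.
      by rewrite bL bS aS.
    by apply/exists_inP; exists a.
  rewrite inE => /andP[aL /exists_inP[x xS xa]].
  have /eqP/cards1P[z zE] := leaf a aL.
  have : b \in [set w0 | adj T a w0] by rewrite inE.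
  have : x \in [set w0 | adj T a w0] by rewrite inE adj_sym.
  by rewrite zE => /set1P <- /set1P ->; rewrite inE xS.
have := connect_closed step (conn rt w); rewrite inE rtS => /(_ isT) /setUP[] //.
by rewrite inE (negPf wL).
Qed.

End TreeOrder.

Lemma card_fiber_le (A B : finType) (D : {set A}) (E : {set B}) (h : A -> B) (k : nat) :
  (forall x, x \in D -> h x \in E) ->
  (forall y, y \in E -> #|[set x in D | h x == y]| <= k) -> #|D| <= k * #|E|.
Proof.
move=> hE fib; rewrite -sum1_card (partition_big h (mem E)) //= mulnC -sum_nat_const.
apply: leq_sum => y yE; rewrite sum1_card; apply: leq_trans (fib y yE).
by apply/subset_leq_card/subsetP => x; rewrite inE.
Qed.

(** Here e will be a small fraction of n; random edges of large constant average degree already have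
    this property. *)
Definition spans_triples (X K : finType) (tau : X -> X -> K -> bool) (e : nat) : Prop :=
  forall (A B : {set X}) (J : {set K}), [disjoint A & B] ->
  e <= #|A| -> e <= #|B| -> e <= #|J| ->
  exists x y c, [/\ x \in A, y \in B, c \in J & tau x y c].

(** [N v] will be the neighbourhood of v in G0. Allowing any r elements to be missing makes the
    reserve usable whatever part of it an adaptive procedure has consumed. *)
Definition reserve_spans (X K : finType) (tau : X -> X -> K -> bool) (N : X -> {set X})
    (r : nat) (Rs : {set X}) (Kf : {set K}) : Prop :=
  forall (v : X) (Y : {set X}) (J : {set K}),
  #|(N v :&: Rs) :\: Y| <= r -> #|Kf :\: J| <= r ->
  exists y c, [/\ y \in Y, c \in J & tau v y c].

Section Embedding.
Variables (V X K : finType) (T : sgraph V) (d e r : nat) (L : {set V}) (rt : V).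
Variables (tau : X -> X -> K -> bool) (N : X -> {set X}).
Variables (Z : bool -> {set X}) (ty : V -> bool) (Wr : {set X}) (Kf : {set K}).
Hypotheses (T_tree : is_tree T) (degT : forall v, deg T v <= d).
Hypotheses (L_leaf : forall l, l \in L -> deg T l = 1) (rtL : rt \notin L).
Hypothesis dense : spans_triples tau e.
Hypothesis reserve : reserve_spans tau N r Wr Kf.
Hypothesis disZ : [disjoint Z true & Z false].
Hypothesis disZW : forall b, [disjoint Z b & Wr].
Hypothesis cardZ : forall b, #|[set v in ~: L | ty v == b]| + e <= #|Z b|.
Hypothesis cardK : #|~: L| + e <= #|~: Kf|.+1.
Hypotheses (e_gt0 : 0 < e) (der : 2 * (d * e) <= r).

Implicit Types (S : {set V}) (f : V -> X) (g : V -> K) (par : V -> V).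

(* This set only grows along the embedding, so its final size bounds the number
   of times the reserve is used. *)
Definition stuck S f g b : {set X} := [set x in f @: S |
  ~~ [exists y in Z b :\: f @: S, exists c in ~: Kf :\: g @: (S :\ rt), tau x y c]].

(** [g v] is the colour of the edge from v to its parent, so it is meaningless at the root, which
    [emb_col] leaves out. By [emb_ty] and [emb_res], a vertex leaves its pool or uses a reserved
    colour only as the child of a stuck vertex. *)
Record embeds S f g par : Prop := Embeds {
  emb_rt : rt \in S;
  emb_sub : S \subset ~: L;
  emb_conn : forall x, x \in S -> connect (restr_adj T S) rt x;
  emb_inj : {in S &, injective f};
  emb_col : {in S :\ rt &, injective g};
  emb_par : forall v, v \in S -> v != rt ->
    [/\ par v \in S, adj T (par v) v & tau (f (par v)) (f v) (g v)];
  emb_adj : forall x y, x \in S -> y \in S -> adj T x y ->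
    (x != rt /\ par x = y) \/ (y != rt /\ par y = x);
  emb_ty : forall v, v \in S -> f v \in Z (ty v) \/
    [/\ v != rt, f v \in Wr & f (par v) \in stuck S f g (ty v)];
  emb_res : forall v, v \in S -> v != rt -> g v \in Kf -> f v \notin Z (ty v) }.

Definition fallback S f : {set V} := [set v in S | f v \notin Z (ty v)].

Lemma disZb b b' x : x \in Z b -> x \in Z b' -> b = b'.
Proof.
case: b b' => [] [] //; first by move/(disjointFr disZ) => ->.
by move/(disjointFl disZ) => ->.
Qed.

(** Otherwise the stuck vertices, the free part of the pool and the free colours would be three sets
    of size at least e that span no coloured edge. *)
Lemma card_stuck S f g par b : embeds S f g par -> #|stuck S f g b| < e.
Proof.
move=> E; rewrite ltnNge; apply/negP => big.
have SL := subset_leq_card (emb_sub E).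
have [||| x [y [c [xs yZ cK xyc]]]] := @dense (stuck S f g b) (Z b :\: f @: S) (~: Kf :\: g @: (S :\ rt)) _ big.
- rewrite disjoint_sym disjoints_subset; apply/subsetP => y /setDP[_ yf]; rewrite inE.
  by apply: contra yf; rewrite inE => /andP[].
- have : #|Z b :&: f @: S| <= #|[set v in ~: L | ty v == b]|.
    apply: leq_trans (leq_imset_card f _); apply/subset_leq_card/subsetP => y.
    case/setIP => yZ /imsetP[v vS yE]; apply/imsetP; exists v => //.
    rewrite inE (subsetP (emb_sub E)) //=; apply/eqP; rewrite yE in yZ.
    have [vZ|[_ vW _]] := emb_ty E vS; first exact: disZb yZ.
    by rewrite (disjointFr (disZW b) yZ) in vW.
  by have := cardZ b; rewrite -[#|Z b|](cardsID (f @: S)); lia.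
(* The root carries no colour, so only |S| - 1 colours are in use; this accounts for the successor
   in [cardK]. *)
- have : #|~: Kf :&: g @: (S :\ rt)| <= #|S :\ rt|.
    by apply: leq_trans (leq_imset_card g _); apply/subset_leq_card/subsetIr.
  have := cardsD1 rt S; rewrite (emb_rt E).
  by have := cardK; rewrite -[#|~: Kf|](cardsID (g @: (S :\ rt))); lia.
by move: xs; rewrite inE => /andP[_ /negP]; apply; apply/exists_inP; exists y => //; apply/exists_inP; exists c.
Qed.

(** A fallback vertex is a child of a stuck vertex; for each of the two types there are fewer than e
    stuck vertices, with at most d children each. *)
Lemma card_fallback S f g par : embeds S f g par -> #|fallback S f| <= 2 * (d * e).
Proof.
move=> E.
pose D b := [set v in S :\ rt | f (par v) \in stuck S f g b].
have sub : fallback S f \subset D true :|: D false.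
  apply/subsetP => v; rewrite inE => /andP[vS vZ].
  have [vZ'|[vrt _ vst]] := emb_ty E vS; first by rewrite vZ' in vZ.
  by apply/setUP; case: (ty v) vst => vst; [left|right]; rewrite inE vst andbT !inE vrt vS.
have cD b : #|D b| <= d * e.
  pose PB := [set x in S | f x \in stuck S f g b].
  apply: (@leq_trans (d * #|PB|)).
    apply: (@card_fiber_le _ _ _ _ par) => [v|x _].
      by move=> /setIdP[/setD1P[vrt vS] st]; have [pS _ _] := emb_par E vS vrt; rewrite inE pS st.
    apply: leq_trans (degT x); apply/subset_leq_card/subsetP => v.
    move=> /setIdP[/setIdP[/setD1P[vrt vS] _] /eqP <-].
    by have [_ pa _] := emb_par E vS vrt; rewrite inE pa.
  rewrite leq_mul2l; apply/orP; right; apply: ltnW; apply: leq_trans (card_stuck b E); rewrite ltnS.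
  have PBS : PB \subset S by apply/subsetP => x; rewrite inE => /andP[].
  have <- : #|f @: PB| = #|PB|.
    by apply: card_in_imset => x y /(subsetP PBS) xS /(subsetP PBS) yS; apply: (emb_inj E).
  by apply/subset_leq_card/subsetP => _ /imsetP[x /setIdP[_ st] ->].
apply: leq_trans (subset_leq_card sub) _; apply: leq_trans (leq_card_setU _ _) _.
by have := cD true; have := cD false; lia.
Qed.

Lemma embeds_step S f g par : embeds S f g par -> S != ~: L ->
  exists v f' g' par', [/\ v \notin S, v \notin L & embeds (v |: S) f' g' par'].
Proof.
move=> E SnL; have [T_conn T_acyc] := T_tree.
have [v [x [vL vS xS xv]]] := connected_next T_conn L_leaf (emb_rt E) (emb_sub E) SnL.
have [y [c [yc ynew cnew xyc vty]]] : exists y c, [/\ True, y \notin f @: S,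
    c \notin g @: (S :\ rt), tau (f x) y c &
    (y \in Z (ty v) /\ c \notin Kf) \/ (y \in Wr /\ f x \in stuck S f g (ty v))].
  have [st|nst] := boolP (f x \in stuck S f g (ty v)).
    have cF := leq_trans (card_fallback E) der.
    have [||y [c [/setDP[yW yf] /setDP[cK cg] xyc]]] := @reserve (f x) (Wr :\: f @: S) (Kf :\: g @: (S :\ rt)).
    - apply: leq_trans cF; apply: leq_trans (leq_imset_card f _).
      apply/subset_leq_card/subsetP => y /setDP[/setIP[_ yW]]; rewrite !inE yW andbT negbK.
      case/imsetP => w wS yE; apply/imsetP; exists w => //; rewrite inE wS -yE.
      by rewrite (disjointFl (disZW _) yW).
    - apply: leq_trans cF; apply: leq_trans (leq_imset_card g _).
      apply/subset_leq_card/subsetP => k /setDP[kK]; rewrite !inE kK andbT negbK.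
      case/imsetP => w /setD1P[wrt wS] kE; apply/imsetP; exists w => //; rewrite inE wS.
      by apply: emb_res E _ wS wrt _; rewrite -kE.
    by exists y, c; split=> //; right.
  move: nst; rewrite inE (imset_f f xS) /= negbK => /exists_inP[y /setDP[yZ yf] /exists_inP[c /setDP[cK cg] xyc]].
  by exists y, c; split=> //; left; split=> //; rewrite inE in cK.
pose f' z := if z == v then y else f z.
pose g' z := if z == v then c else g z.
pose par' z := if z == v then x else par z.
exists v, f', g', par'; split=> //.
have neS z : z \in S -> (z == v) = false by move=> zS; apply: contraNF vS => /eqP <-.
have vrt : v != rt by apply: contraNneq vS => ->; apply: emb_rt E.
have fS : f @: S \subset f' @: (v |: S).
  by apply/subsetP => _ /imsetP[z zS ->]; apply/imsetP; exists z; rewrite ?inE ?zS ?orbT // /f' neS.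
have gS : g @: (S :\ rt) \subset g' @: ((v |: S) :\ rt).
  apply/subsetP => _ /imsetP[z /setD1P[zrt zS] ->]; apply/imsetP; exists z.
    by rewrite !inE zrt zS orbT.
  by rewrite /g' neS.
have st_mono b : stuck S f g b \subset stuck (v |: S) f' g' b.
  apply/subsetP => z; rewrite !inE => /andP[zf /negP nex]; rewrite (subsetP fS) //=.
  apply/negP => /exists_inP[y' /setDP[yZ' yf'] /exists_inP[c' /setDP[cK' cg'] ztau]]; apply: nex.
  apply/exists_inP; exists y'; first by rewrite inE yZ' andbT; apply: contra yf' => /(subsetP fS).
  by apply/exists_inP; exists c' => //; rewrite inE cK' andbT; apply: contra cg' => /(subsetP gS).
have sub_conn a b : connect (restr_adj T S) a b -> connect (restr_adj T (v |: S)) a b.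
  apply: connect_sub => a' b' /and3P[a'S b'S ab]; apply: connect1.
  by rewrite /restr_adj /= !inE a'S b'S ab !orbT.
have conn2 a b : a \in S -> b \in S -> connect (restr_adj T S) a b.
  move=> aS bS; apply: connect_trans (emb_conn E bS); rewrite (@sym_connect_sym _ (restr_adj T S)).
    exact: emb_conn E _ aS.
  by move=> a' b'; rewrite /restr_adj /= adj_sym andbCA.
split.
- by rewrite inE (emb_rt E) orbT.
- by rewrite subUset sub1set inE vL (emb_sub E).
- move=> z /setU1P[->|zS]; last exact: sub_conn (emb_conn E zS).
  apply: connect_trans (sub_conn _ _ (emb_conn E xS)) (connect1 _).
  by rewrite /restr_adj /= !inE xS eqxx xv orbT.
- move=> z w /setU1P[->|zS] /setU1P[->|wS]; rewrite /f' ?eqxx ?neS //.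
  + by move=> yE; case/negP: ynew; rewrite yE imset_f.
  + by move=> yE; case/negP: ynew; rewrite -yE imset_f.
  + exact: emb_inj E _ _ zS wS.
- move=> z w /setD1P[zrt /setU1P[zE|zS]] /setD1P[wrt /setU1P[wE|wS]]; rewrite /g' ?zE ?wE ?eqxx ?neS //.
  + by move=> yE; case/negP: cnew; rewrite yE imset_f // !inE wrt.
  + by move=> yE; case/negP: cnew; rewrite -yE imset_f // !inE zrt.
  + by apply: (emb_col E); rewrite !inE ?zrt ?wrt.
- move=> z /setU1P[->|zS] zrt; first by rewrite /par' /f' /g' eqxx (neS x) // inE xS orbT.
  have [pS pa pt] := emb_par E zS zrt.
  by rewrite /par' /f' /g' (neS z) // (neS (par z)) // inE pS orbT.
- move=> a b /setU1P[->|aS] /setU1P[->|bS] ab; rewrite /par' ?eqxx ?neS //.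
  + by rewrite adj_irrefl in ab.
  + left; split=> //; rewrite adj_sym in ab.
    exact: acyclic_unique_nbr T_acyc (conn2 _ _ xS bS) xS vS xv ab.
  + right; split=> //.
    exact: acyclic_unique_nbr T_acyc (conn2 _ _ xS aS) xS vS xv ab.
  + exact: emb_adj E _ _ aS bS ab.
- move=> z /setU1P[->|zS].
    rewrite {1 2}/f' /par' eqxx; case: vty => [[yZ _]|[yW st]]; [by left | right; split=> //].
    by rewrite {1}/f' neS // (subsetP (st_mono _)).
  rewrite {1 2}/f' /par' neS //.
  have [zZ|[zrt zW zst]] := emb_ty E zS; [by left|right; split=> //].
  have [pS _ _] := emb_par E zS zrt.
  by rewrite {1}/f' neS // (subsetP (st_mono _)).
- move=> z /setU1P[->|zS] zrt; rewrite /g' /f' ?eqxx ?neS //; last exact: (emb_res E zS zrt).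
  case: vty => [[_ /negPf ->]//|[yW _] _].
  by rewrite (disjointFl (disZW _) yW).
Qed.

Lemma embeds_exists : exists f g par, embeds (~: L) f g par.
Proof.
have [x0 x0Z] : exists x0, x0 \in Z (ty rt).
  by apply/card_gt0P; apply: leq_trans (cardZ _); lia.
have [k0 _] : exists k0, k0 \in ~: Kf.
  apply/card_gt0P; have : 0 < #|~: L| by apply/card_gt0P; exists rt; rewrite inE.
  by have := cardK; lia.
have base : embeds [set rt] (fun=> x0) (fun=> k0) (fun=> rt).
  split; rewrite ?inE ?eqxx //.
  - by rewrite sub1set inE.
  - by move=> x; rewrite inE => /eqP ->; apply: connect0.
  - by move=> x y; rewrite !inE => /eqP -> /eqP ->.
  - by move=> x y; rewrite setDv inE.
  - by move=> v; rewrite inE => /eqP ->; rewrite eqxx.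
  - by move=> x y; rewrite !inE => /eqP -> /eqP ->; rewrite adj_irrefl.
  - by move=> v; rewrite inE => /eqP ->; left.
  - by move=> v; rewrite inE => /eqP ->; rewrite eqxx.
suff loop k S f g par : embeds S f g par -> #|~: L :\: S| <= k -> exists f g par, embeds (~: L) f g par.
  exact: loop base (leqnn _).
elim: k S f g par => [|k IH] S f g par E; have [<-|SnL] := eqVneq S (~: L); try by exists f, g, par.
  rewrite leqn0 cards_eq0 setD_eq0 => sub; case/negP: SnL.
  by rewrite eqEsubset (emb_sub E) sub.
move=> cS; have [v [f' [g' [par' [vS vL E']]]]] := embeds_step E SnL.
apply: (IH _ _ _ _ E'); rewrite -ltnS; apply: leq_trans cS.
have -> : ~: L :\: (v |: S) = (~: L :\: S) :\ v by apply/setP => z; rewrite !inE negb_or -andbA.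
by rewrite [X in _ < X](cardsD1 v) !inE vL vS.
Qed.

End Embedding.

(** * Matching the remaining leaves *)

Section LeafMatching.
Variables (X K : finType) (e r r1 m : nat).
Variables (tau : X -> X -> K -> bool) (N : X -> {set X}).
Variables (Q U A0 B0 Wr D0 : {set X}) (C Kf : {set K}).
Hypothesis tau_sym : forall x y c, tau x y c = tau y x c.
Hypothesis dense : spans_triples tau e.
Hypothesis reserveW : reserve_spans tau N r Wr Kf.
Hypothesis reserveD : reserve_spans tau N r D0 Kf.
Hypotheses (disQU : [disjoint Q & U]) (cardQ : #|Q| = m) (cardU : #|U| = m) (cardC : #|C| = m).
Hypotheses (B0U : B0 \subset U) (disDA : [disjoint D0 & A0]) (disWB : [disjoint Wr & B0]).
Hypotheses (cD : #|D0 :\: Q| <= r1) (cW : #|Wr :\: U| <= r1) (cKf : #|Kf :\: C| <= r1).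
Hypotheses (cA0 : #|A0 :\: Q| <= r1) (cAB : #|A0| = #|B0|).
Hypotheses (rle : 2 * r1 + 2 * e <= r) (A0big : #|Kf| + 2 * r1 + 3 * e <= #|A0|).

Implicit Types (S : {set X}) (u : X -> X) (c : X -> K).

Record matches j S u c : Prop := Matches {
  mat_sub : S \subset Q;
  mat_inj : {in S &, injective u};
  mat_col : {in S &, injective c};
  mat_edge : forall q, q \in S -> [/\ u q \in U, c q \in C & tau q (u q) (c q)];
  mat_A0 : #|S :&: A0| <= j;
  mat_B0 : #|u @: S :&: B0| <= j;
  mat_Kf : #|c @: S :&: Kf| <= j }.

Definition freeQ S : {set X} := (Q :\: A0) :\: S.
Definition freeU S u : {set X} := (U :\: B0) :\: u @: S.

Lemma card_setU1I (Y : finType) (x : Y) (A B : {set Y}) j :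
  #|A :&: B| <= j -> #|(x |: A) :&: B| <= j.+1.
Proof.
move=> le; rewrite setIUl; apply: leq_trans (leq_card_setU _ _) _.
by rewrite -[j.+1]add1n leq_add // (leq_trans (subset_leq_card (subsetIl _ _))) // cards1.
Qed.

(* The exchange: [x] takes over the partner of [q], and [q] moves on to [y]. *)
Lemma matches_swap j S u c x q y cx cq : matches j S u c ->
    x \in Q :\: S -> q \in S -> y \in U :\: u @: S -> cx != cq ->
    cx \in C :\: c @: S -> cq \in C :\: c @: S -> ~~ ((cx \in Kf) && (cq \in Kf)) ->
    tau x (u q) cx -> tau q y cq ->
  exists u' c', matches j.+1 (x |: S) u' c' /\ u' @: (x |: S) = y |: u @: S.
Proof.
move=> M /setDP[xQ xS] qS /setDP[yU yS] cxq /setDP[cxC cxS] /setDP[cqC cqS] notboth t1 t2.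
pose u' z := if z == x then u q else if z == q then y else u z.
pose c' z := if z == x then cx else if z == q then cq else c z.
have xq : x == q = false by apply: contraNF xS => /eqP ->.
have neS z : z \in S -> (z == x) = false by move=> zS; apply: contraNF xS => /eqP <-.
have u'E : u' @: (x |: S) = y |: u @: S.
  apply/setP => z; apply/imsetP/idP.
    move=> [w /setU1P[->|wS] ->]; apply/setU1P; rewrite /u'.
      by rewrite eqxx; right; apply: imset_f.
    by rewrite neS //; case: ifP => _; [left | right; apply: imset_f].
  case/setU1P => [->|/imsetP[w wS ->]].
    by exists q; rewrite ?inE ?qS ?orbT // /u' eq_sym xq eqxx.
  have [->|wq] := eqVneq w q; first by exists x; rewrite ?inE ?eqxx // /u' eqxx.
  by exists w; rewrite ?inE ?wS ?orbT // /u' neS // (negPf wq).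
have c'sub z : z \in c' @: (x |: S) -> [|| z == cx, z == cq | z \in c @: S].
  move=> /imsetP[w /setU1P[->|wS] ->]; rewrite /c' ?eqxx // neS //.
  by case: ifP => _; rewrite ?eqxx ?orbT // imset_f // !orbT.
exists u', c'; split=> //; split.
- by rewrite subUset sub1set xQ (mat_sub M).
- have qu w : w \in S -> u w = y -> False by move=> wS uy; case/negP: yS; rewrite -uy imset_f.
  move=> z w /setU1P[->|zS] /setU1P[->|wS]; rewrite /u' ?eqxx ?neS //=.
  + case: ifP => wq; first by move=> /(qu _ qS).
    by move=> /(mat_inj M qS wS) qw; rewrite qw eqxx in wq.
  + case: ifP => zq; first by move=> /esym /(qu _ qS).
    by move=> /(mat_inj M zS qS) qw; rewrite qw eqxx in zq.
  + case: ifP => zq; case: ifP => wq; first by rewrite (eqP zq) (eqP wq).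
    * by move=> /esym /(qu _ wS).
    * by move=> /(qu _ zS).
    * exact: mat_inj M _ _ zS wS.
- have nc k w : k \notin c @: S -> w \in S -> c w = k -> False.
    by move=> kS wS cw; case/negP: kS; rewrite -cw imset_f.
  move=> z w /setU1P[->|zS] /setU1P[->|wS]; rewrite /c' ?eqxx ?neS //=.
  + case: ifP => wq; first by move=> /eqP; rewrite (negPf cxq).
    by move=> /esym /(nc _ _ cxS wS).
  + case: ifP => zq; first by move=> /esym /eqP; rewrite (negPf cxq).
    by move=> /(nc _ _ cxS zS).
  + case: ifP => zq; case: ifP => wq; first by rewrite (eqP zq) (eqP wq).
    * by move=> /esym /(nc _ _ cqS wS).
    * by move=> /(nc _ _ cqS zS).
    * exact: mat_col M _ _ zS wS.
- move=> z /setU1P[->|zS]; rewrite /u' /c' ?eqxx /=.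
    by have [uU _ _] := mat_edge M qS.
  rewrite neS //; have [->|_] := eqVneq z q; first by [].
  exact: mat_edge M _ zS.
- exact: card_setU1I (mat_A0 M).
- by rewrite u'E; apply: card_setU1I (mat_B0 M).
(* At most one of cx and cq is a reserved colour, so the used part of Kf gains at most the element
   k0. *)
have [k0 sub] : exists k0, c' @: (x |: S) :&: Kf \subset (k0 |: c @: S) :&: Kf.
  exists (if cx \in Kf then cx else cq); apply/subsetP => z /setIP[/c'sub zc zK].
  rewrite inE zK andbT inE; case/or3P: zc => [/eqP zE|/eqP zE|->]; last by rewrite orbT.
    by rewrite -zE zK inE eqxx.
  case: ifP notboth => cxK /=; first by rewrite -zE zK.
  by rewrite zE inE eqxx.
by apply: leq_trans (subset_leq_card sub) (card_setU1I _ (mat_Kf M)).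
Qed.

Lemma card_QA0 : #|A0| <= #|Q :&: A0| + r1.
Proof. by have := cardsID Q A0; rewrite setIC; lia. Qed.

Lemma matches_card j S u c : matches j S u c -> #|S| + #|A0| <= m + j + r1.
Proof.
move=> M; have := card_QA0; have := mat_A0 M; have := cardsID A0 S.
have : #|S :\: A0| <= #|Q :\: A0| by apply/subset_leq_card/setSD/(mat_sub M).
by have := cardsID A0 Q; rewrite cardQ; lia.
Qed.

Lemma free_colours j S u c : matches j S u c -> j <= r1 + 2 * e ->
  e <= #|(C :\: Kf) :\: c @: S|.
Proof.
move=> M jle; have := matches_card M; have := leq_imset_card c S.
have := cardsID Kf C; have := cardsID (c @: S) (C :\: Kf); rewrite cardC.
have : #|C :&: Kf| <= #|Kf| by apply/subset_leq_card/subsetIr.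
have : #|(C :\: Kf) :&: c @: S| <= #|c @: S| by apply/subset_leq_card/subsetIr.
have := A0big; lia.
Qed.

Lemma card_unusedKf j S u c : matches j S u c -> j <= r1 + 2 * e ->
  #|Kf :\: (Kf :&: C :\: c @: S)| <= r.
Proof.
move=> M jle; have -> : Kf :\: (Kf :&: C :\: c @: S) = (Kf :\: C) :|: (c @: S :&: Kf).
  by apply/setP => k; rewrite !inE; case: (k \in Kf); case: (k \in C); case: (k \in _ @: _).
apply: leq_trans (leq_card_setU _ _) _; have := mat_Kf M; have := cKf; have := rle; lia.
Qed.

(** The reserve links q0 to a vertex w of Wr by a colour of Kf. Excluded are the w outside U, the at
    most e unmatched ones and the partners of the fewer than e vertices of [Bd], in total at most r.
    Any other w is given up by its partner, which moves to a free vertex of B0 with a colour outside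
    Kf. *)
Lemma matches_coverQ j S u c : matches j S u c -> j < r1 + 2 * e -> #|freeU S u| <= e ->
  0 < #|freeQ S| ->
  exists S' u' c', [/\ matches j.+1 S' u' c', #|freeQ S'| < #|freeQ S| & #|freeU S' u'| <= #|freeU S u|].
Proof.
move=> M jlt fU /card_gt0P[q0 q0free]; have /setDP[/setDP[q0Q q0A] q0S] := q0free.
pose Bd := [set q in S | ~~ [exists b in B0 :\: u @: S, exists k in (C :\: Kf) :\: c @: S, tau q b k]].
have cBd : #|Bd| < e.
  rewrite ltnNge; apply/negP => big.
  have [|||q [b [k [qB bB kC qbk]]]] := @dense Bd (B0 :\: u @: S) ((C :\: Kf) :\: c @: S) _ big.
  - apply: (@disjointWl _ _ (mem Q)); last by apply: disjointWr disQU; apply: subset_trans (subsetDl _ _) B0U.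
    by apply/subsetP => q /setIdP[/(subsetP (mat_sub M))].
  - have := cardsID (u @: S) B0; rewrite setIC; have := mat_B0 M; have := cAB; have := A0big; lia.
  - exact: free_colours M (ltnW jlt).
  by move: qB => /setIdP[_ /negP]; apply; apply/exists_inP; exists b => //; apply/exists_inP; exists k.
have [||w [k1 [/setIdP[wW /exists_inP[q qS /andP[/eqP uq qB]]] kJ t1]]] := @reserveW q0
   [set w in Wr | [exists q in S, (u q == w) && (q \notin Bd)]] (Kf :&: C :\: c @: S).
- have sub : (N q0 :&: Wr) :\: [set w in Wr | [exists q in S, (u q == w) && (q \notin Bd)]] \subset
      (Wr :\: U) :|: (freeU S u :|: u @: Bd).
    apply/subsetP => w /setDP[/setIP[_ wW]]; rewrite inE wW /= => nex.
    rewrite inE in_setD wW andbT; have [wU|//] := boolP (w \in U); rewrite /= inE.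
    have [/imsetP[q qS wE]|nS] := boolP (w \in u @: S); last first.
      by rewrite !inE (negPf nS) wU (disjointFr disWB wW).
    apply/orP; right; rewrite wE imset_f //; apply: contraNT nex => qB.
    by apply/exists_inP; exists q; rewrite // wE eqxx.
  apply: leq_trans (subset_leq_card sub) _; apply: leq_trans (leq_card_setU _ _) _.
  have := leq_of_leqif (leq_card_setU (freeU S u) (u @: Bd)); have := leq_imset_card u Bd.
  have := cW; have := rle; lia.
- exact: card_unusedKf M (ltnW jlt).
move: qB; rewrite inE qS /= negbK => /exists_inP[b /setDP[bB bS] /exists_inP[k2 /setDP[/setDP[k2C k2K] k2S] t2]].
move: kJ => /setDP[/setIP[k1K k1C] k1S].
have [|||||||||u' [c' [M' u'E]]] := @matches_swap _ _ _ _ q0 q b k1 k2 M.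
- by rewrite inE q0S.
- exact: qS.
- by rewrite inE bS (subsetP B0U).
- by apply: contraNneq k2K => <-.
- by rewrite inE k1S.
- by rewrite inE k2S.
- by rewrite (negPf k2K) andbF.
- by rewrite uq.
- exact: t2.
exists (q0 |: S), u', c'; split=> //.
  have -> : freeQ (q0 |: S) = freeQ S :\ q0 by apply/setP => z; rewrite !inE negb_or -!andbA.
  by rewrite [X in _ < X](cardsD1 q0) q0free.
by rewrite /freeU u'E; apply/subset_leq_card/setDS/subsetUr.
Qed.

(** The mirror image: u0 takes a matched q of D0 with a reserved colour, and the former partner of q
    goes to a free vertex of A0. The exclusions are r1 vertices of D0 outside Q, r1 + e unmatched
    ones and e partners of [Bd], whence the hypothesis [rle]. *)
Lemma matches_coverU j S u c : matches j S u c -> j < r1 + 2 * e -> #|freeQ S| <= r1 + e ->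
  0 < #|freeU S u| ->
  exists S' u' c', [/\ matches j.+1 S' u' c', #|freeU S' u'| < #|freeU S u| & #|freeQ S'| <= #|freeQ S|].
Proof.
move=> M jlt fQ /card_gt0P[u0 u0free]; have /setDP[/setDP[u0U u0B] u0S] := u0free.
pose Bd := [set y in u @: S | ~~ [exists a in (Q :&: A0) :\: S, exists k in (C :\: Kf) :\: c @: S, tau a y k]].
have cBd : #|Bd| < e.
  rewrite ltnNge; apply/negP => big.
  have [||| a [y [k [aA yB kC ayk]]]] := @dense ((Q :&: A0) :\: S) Bd ((C :\: Kf) :\: c @: S) _ _ big.
  - apply: disjointWl (subset_trans (subsetDl _ _) (subsetIl _ _)) _; apply: disjointWr disQU.
    by apply/subsetP => y /setIdP[/imsetP[q qS ->] _]; have [] := mat_edge M qS.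
  - have := cardsID S (Q :&: A0); have := card_QA0; have := mat_A0 M.
    have : #|Q :&: A0 :&: S| <= #|S :&: A0|.
      by apply/subset_leq_card/subsetP => z; rewrite !inE => /andP[/andP[_ ->] ->].
    have := A0big; lia.
  - exact: free_colours M (ltnW jlt).
  by move: yB => /setIdP[_ /negP]; apply; apply/exists_inP; exists a => //; apply/exists_inP; exists k.
have [||q [k1 [/setIdP[/setIP[qD qS] qB] kJ t1]]] := @reserveD u0
   [set q in D0 :&: S | u q \notin Bd] (Kf :&: C :\: c @: S).
- have sub : (N u0 :&: D0) :\: [set q in D0 :&: S | u q \notin Bd] \subset
      (D0 :\: Q) :|: (freeQ S :|: [set q in S | u q \in Bd]).
    apply/subsetP => q /setDP[/setIP[_ qD] nex].
    rewrite in_setU in_setD qD andbT; have [qQ|//] := boolP (q \in Q); rewrite /= in_setU.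
    rewrite /freeQ in_setD in_setD qQ (disjointFr disDA qD) /= andbT.
    have [qS|//] := boolP (q \in S); apply: contraNT nex => qB; apply/setIdP; split.
      by rewrite inE qD.
    by apply: contra qB => qB; rewrite inE qS.
  apply: leq_trans (subset_leq_card sub) _; apply: leq_trans (leq_card_setU _ _) _.
  have := leq_of_leqif (leq_card_setU (freeQ S) [set q in S | u q \in Bd]).
  have : #|[set q in S | u q \in Bd]| <= #|Bd|.
    have SS : [set q in S | u q \in Bd] \subset S by apply/subsetP => q /setIdP[].
    have <- : #|u @: [set q in S | u q \in Bd]| = #|[set q in S | u q \in Bd]|.
      by apply: card_in_imset => q q' /(subsetP SS) qS /(subsetP SS) q'S; apply: (mat_inj M).
    by apply/subset_leq_card/subsetP => _ /imsetP[q /setIdP[_ qB] ->].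
  have := cD; have := rle; lia.
- exact: card_unusedKf M (ltnW jlt).
move: qB; rewrite inE imset_f //= negbK => /exists_inP[a /setDP[/setIP[aQ aA] aS] /exists_inP[k2 /setDP[/setDP[k2C k2K] k2S] t2]].
move: kJ => /setDP[/setIP[k1K k1C] k1S].
have [|||||||||u' [c' [M' u'E]]] := @matches_swap _ _ _ _ a q u0 k2 k1 M.
- by rewrite inE aS.
- exact: qS.
- by rewrite inE u0S.
- by apply: contraNneq k2K => ->.
- by rewrite inE k2S.
- by rewrite inE k1S.
- by rewrite (negPf k2K).
- exact: t2.
- by rewrite tau_sym.
exists (a |: S), u', c'; split=> //; last by apply/subset_leq_card/setDS/subsetUr.
rewrite /freeU u'E.
have -> : (U :\: B0) :\: (u0 |: u @: S) = freeU S u :\ u0 by apply/setP => z; rewrite !inE negb_or -!andbA.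
by rewrite [X in _ < X](cardsD1 u0) u0free.
Qed.

(** B0 lies in U, while A0 may miss Q in up to r1 vertices; hence U :\: B0 is the smaller side, by
    at most r1. The smaller side alone decides when density stops providing edges, and the other
    side then has at most r1 + e free vertices. *)
Lemma matches_greedy : 0 < e -> exists S u c, [/\ matches 0 S u c, #|freeU S u| <= e & #|freeQ S| <= r1 + e].
Proof.
move=> e_gt0.
have [x0 x0A] : exists x0, x0 \in A0 by apply/card_gt0P; have := A0big; lia.
have [k0 _] : exists k0, k0 \in C.
  apply/card_gt0P; rewrite cardC -cardQ; apply: leq_trans (subset_leq_card (subsetIl Q A0)).
  by have := card_QA0; have := A0big; lia.
have base : matches 0 set0 (fun=> x0) (fun=> k0).
  by split; rewrite ?sub0set ?imset0 ?set0I ?cards0 // => x; rewrite ?inE.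
suff loop k S u c : matches 0 S u c -> #|freeQ S| <= k ->
    exists S u c, [/\ matches 0 S u c, #|freeU S u| <= e & #|freeQ S| <= r1 + e].
  exact: loop base (leqnn _).
elim: k S u c => [|k IH] S u c M cS.
all: have SA : S \subset Q :\: A0.
1,3: by rewrite subsetD (mat_sub M) -setI_eq0 -cards_eq0 -leqn0 (mat_A0 M).
all: have uB : u @: S \subset U :\: B0.
1,3: by rewrite subsetD -[X in _ && X]setI_eq0 -[X in _ && X]cards_eq0 -[X in _ && X]leqn0 (mat_B0 M) andbT; apply/subsetP => _ /imsetP[q qS ->]; have [] := mat_edge M qS.
all: have dif : #|freeQ S| <= #|freeU S u| + r1 /\ #|freeU S u| <= #|freeQ S|.
1,3: have := cardsID S (Q :\: A0); have := cardsID (u @: S) (U :\: B0); rewrite (setIidPr SA) (setIidPr uB) (card_in_imset (mat_inj M)) -/(freeQ S) -/(freeU S u); have := cardsID A0 Q; have := cardsID B0 U; rewrite (setIidPr B0U) cardQ cardU; have := card_QA0; have : #|Q :&: A0| <= #|A0| by [apply/subset_leq_card/subsetIr]; lia.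
  by exists S, u, c; split=> //; lia.
have [small|big] := leqP #|freeU S u| e; first by exists S, u, c; split=> //; lia.
have [||||q [y [b [qf yf bC t]]]] := @dense (freeQ S) (freeU S u) ((C :\: Kf) :\: c @: S).
- apply: disjointWl (subset_trans (subsetDl _ _) (subsetDl _ _)) _.
  by apply: disjointWr (subset_trans (subsetDl _ _) (subsetDl _ _)) disQU.
- by lia.
- by lia.
- by apply: free_colours M _.
have /setDP[/setDP[qQ qA] qS] := qf; have /setDP[/setDP[yU yB] yS] := yf.
have /setDP[/setDP[bC' bK] bS] := bC.
have neS z : z \in S -> (z == q) = false by move=> zS; apply: contraNF qS => /eqP <-.
pose u' z := if z == q then y else u z; pose c' z := if z == q then b else c z.
have im (Y : finType) (h : X -> Y) v : (fun z => if z == q then v else h z) @: (q |: S) = v |: h @: S.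
  rewrite imsetU1 eqxx; congr (_ |: _); apply: eq_in_imset => z zS; by rewrite neS.
apply: (IH (q |: S) u' c').
  split.
  - by rewrite subUset sub1set qQ (mat_sub M).
  - move=> z w /setU1P[->|zS] /setU1P[->|wS]; rewrite /u' ?eqxx ?neS //=.
    + by move=> yE; case/negP: yS; rewrite yE imset_f.
    + by move=> yE; case/negP: yS; rewrite -yE imset_f.
    + exact: mat_inj M _ _ zS wS.
  - move=> z w /setU1P[->|zS] /setU1P[->|wS]; rewrite /c' ?eqxx ?neS //=.
    + by move=> yE; case/negP: bS; rewrite yE imset_f.
    + by move=> yE; case/negP: bS; rewrite -yE imset_f.
    + exact: mat_col M _ _ zS wS.
  - move=> z /setU1P[->|zS]; rewrite /u' /c' ?eqxx ?neS //=; exact: (mat_edge M zS).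
  - rewrite setIUl (_ : [set q] :&: A0 = set0) ?set0U ?(mat_A0 M) //.
    by apply/eqP; rewrite setI_eq0 disjoints1.
  - rewrite im setIUl (_ : [set y] :&: B0 = set0) ?set0U ?(mat_B0 M) //.
    by apply/eqP; rewrite setI_eq0 disjoints1.
  - rewrite im setIUl (_ : [set b] :&: Kf = set0) ?set0U ?(mat_Kf M) //.
    by apply/eqP; rewrite setI_eq0 disjoints1.
have -> : freeQ (q |: S) = freeQ S :\ q by apply/setP => z; rewrite !inE negb_or -!andbA.
by rewrite -ltnS (leq_trans _ cS) // [X in _ <= X](cardsD1 q) qf.
Qed.

(** Every exchange spends one unit of j: at most r1 + e of them empty [freeQ] while [freeU] stays at
    most e, and at most e more empty [freeU]. *)
Lemma matches_exists : 0 < e -> exists S u c,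
  [/\ matches (r1 + 2 * e) S u c, Q :\: A0 \subset S & U :\: B0 \subset u @: S].
Proof.
move=> e_gt0; have [S0 [u0 [c0 [M0 fU0 fQ0]]]] := matches_greedy e_gt0.
have mono j j' S u c : j <= j' -> matches j S u c -> matches j' S u c.
  by move=> jj [? ? ? ? h1 h2 h3]; split=> //; apply: leq_trans jj.
have loopQ k j S u c : matches j S u c -> #|freeQ S| <= k -> j + k <= r1 + e -> #|freeU S u| <= e ->
    exists S u c, [/\ matches (r1 + e) S u c, #|freeQ S| = 0 & #|freeU S u| <= e].
  elim: k j S u c => [|k IH] j S u c M fQ jk fU.
    by exists S, u, c; split=> //; [apply: mono M; lia | lia].
  have [f0|fpos] := posnP #|freeQ S|.
    by exists S, u, c; split=> //; apply: mono M; lia.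
  have jlt : j < r1 + 2 * e by lia.
  have [S' [u' [c' [M' fQ' fU']]]] := matches_coverQ M jlt fU fpos.
  by apply: (IH _ _ _ _ M'); lia.
have [S1 [u1 [c1 [M1 fQ1 fU1]]]] := loopQ _ _ _ _ _ M0 fQ0 (leqnn _) fU0.
have loopU k j S u c : matches j S u c -> #|freeU S u| <= k -> j + k <= r1 + 2 * e -> #|freeQ S| = 0 ->
    exists S u c, [/\ matches (r1 + 2 * e) S u c, #|freeQ S| = 0 & #|freeU S u| = 0].
  elim: k j S u c => [|k IH] j S u c M fU jk fQ.
    by exists S, u, c; split=> //; [apply: mono M; lia | lia].
  have [f0|fpos] := posnP #|freeU S u|.
    by exists S, u, c; split=> //; apply: mono M; lia.
  have jlt : j < r1 + 2 * e by lia.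
  have fQ' : #|freeQ S| <= r1 + e by rewrite fQ.
  have [S' [u' [c' [M' fU' fQ'']]]] := matches_coverU M jlt fQ' fpos.
  by apply: (IH _ _ _ _ M'); lia.
have [S2 [u2 [c2 [M2 fQ2 fU2]]]] := loopU _ _ _ _ _ M1 fU1 ltac:(lia) fQ1.
exists S2, u2, c2; split=> //.
  by rewrite -setD_eq0 -cards_eq0 -/(freeQ S2) fQ2.
by rewrite -setD_eq0 -cards_eq0 -/(freeU S2 u2) fU2.
Qed.

End LeafMatching.

(** * Gluing the embedding, the leaf matching and the final matching *)

Section Assembly.
Variables (V X K : finType) (T : sgraph V) (W : {set {set X} * K}).

(** [ch] names every tree edge by its child, which turns colours of non-root vertices into colours
    of edges. *)
Lemma rainbow_copy_from_parents (F : V -> X) (G : V -> K) (par : V -> V) (rt : V) :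
    injective F -> {in [set~ rt] &, injective G} ->
    (forall v, v != rt -> ([set F (par v); F v], G v) \in W) ->
    (forall x y, adj T x y -> (x != rt /\ par x = y) \/ (y != rt /\ par y = x)) ->
  exists2 S : {set {set X} * K}, rainbow_copy_set T S & S \subset W.
Proof.
move=> F_inj G_inj FW adjP.
pose ch (e : {set V}) := odflt rt [pick v | (v != rt) && (e == [set v; par v])].
have chP e : e \in edges T -> ch e != rt /\ e = [set ch e; par (ch e)].
  move=> eT; have : e \in pairs V by apply: (subsetP (edges_pairs T)).
  rewrite inE => /cards2P[x [y [_ eE]]].
  have [v vrt ev] : exists2 v, v != rt & e = [set v; par v].
    have [|[xrt xy]|[yrt yx]] := adjP x y; first by rewrite /adj -eE.
      by exists x; rewrite // eE xy.
    by exists y; rewrite // eE setUC yx.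
  rewrite /ch; case: pickP => [w /andP[wrt /eqP we]|/(_ v)] //=.
  by rewrite vrt -ev eqxx.
exists [set (F @: (e : {set V}), G (ch e)) | e in edges T].
  apply/existsP; exists (finfun F); apply/existsP; exists [ffun e => G (ch e)].
  apply/and3P; split.
  - by apply/injectiveP => x y; rewrite !ffunE; apply: F_inj.
  - apply/dinjectiveP => e1 e2 e1T e2T; rewrite !ffunE => /G_inj.
    have [r1 E1] := chP e1 e1T; have [r2 E2] := chP e2 e2T.
    by rewrite !inE r1 r2 => /(_ isT isT) cc; rewrite E1 E2 cc.
  - apply/eqP/eq_in_imset => e _ /=; rewrite ffunE; congr pair.
    by apply: eq_imset => x; rewrite ffunE.
apply/subsetP => _ /imsetP[e eT ->]; have [r1 E1] := chP e eT.
have -> : F @: e = [set F (par (ch e)); F (ch e)].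
  by rewrite {1}E1 imsetU1 imset_set1 setUC.
exact: FW.
Qed.

End Assembly.

Section Deterministic.
Variables (V X K : finType) (T : sgraph V) (d e r m : nat).
Variables (W0 : {set {set X} * K}) (N : X -> {set X}).
Variables (P0 : {set V}) (lf : V -> V).
Variables (ZQ M A0 B0 Wr D0 : {set X}) (Kf : {set K}).

Definition triple_in (x y : X) (c : K) : bool := ([set x; y], c) \in W0.

Hypotheses (T_tree : is_tree T) (degT : forall v, deg T v <= d) (d_gt0 : 0 < d).
Hypotheses (cardV : #|X| = #|V|) (cardK : #|K| = #|V|.-1).
Hypothesis lfP : forall v, v \in P0 -> [/\ deg T (lf v) = 1, adj T v (lf v) & lf v \notin P0].
Hypotheses (cardP0 : #|P0| = m) (m_gt0 : 0 < m).
Hypothesis dense : spans_triples triple_in e.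
Hypothesis reserveW : reserve_spans triple_in N r Wr Kf.
Hypothesis reserveD : reserve_spans triple_in N r D0 Kf.
Hypotheses (disZM : [disjoint ZQ & M]) (disZW : [disjoint ZQ & Wr]) (disMW : [disjoint M & Wr]).
Hypotheses (disZB : [disjoint ZQ & B0]) (disMB : [disjoint M & B0]) (disWB : [disjoint Wr & B0]).
Hypotheses (A0Z : A0 \subset ZQ) (D0Z : D0 \subset ZQ) (disDA : [disjoint D0 & A0]).
Hypotheses (cardZ : #|ZQ| = m + e) (cardM : #|V| + e <= #|M| + 2 * m).
Hypotheses (cAB : #|A0| = #|B0|) (e_gt0 : 0 < e) (er : 8 * (d * e) <= r).
Hypotheses (Kf_le : #|Kf| + e <= m) (A0big : #|Kf| + r + e <= #|A0|).

(** The parents P0 have a pool ZQ of their own with only e vertices to spare. So their images fill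
    almost all of ZQ, in particular of A0 and D0, although nothing controls where a single parent
    goes. Since only the root has no colour and |K| = |V| - 1, exactly m colours remain for the m
    missing leaves. *)
Lemma deterministic_embedding : exists (A1 B1 : {set X}) (K1 : {set K}),
  [/\ A1 \subset A0, B1 \subset B0, #|A1| = #|B1| /\ #|K1| = #|A1|, #|A0| <= #|A1| + r &
  forall Z : {set {set X} * K}, rainbow_pm A1 B1 K1 Z ->
    exists2 S : {set {set X} * K}, rainbow_copy_set T S & S \subset W0 :|: Z].
Proof.
pose L := lf @: P0.
have [rt rtP] : exists rt, rt \in P0 by apply/card_gt0P; rewrite cardP0.
have leaf_nbr v w : v \in P0 -> adj T w (lf v) -> w = v.
  move=> vP wl; have [/eqP/cards1P[z zE] vl _] := lfP vP.
  have : w \in [set w0 | adj T (lf v) w0] by rewrite inE adj_sym.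
  have : v \in [set w0 | adj T (lf v) w0] by rewrite inE adj_sym.
  by rewrite zE => /set1P -> /set1P ->.
have lf_inj : {in P0 &, injective lf}.
  by move=> v w vP wP vw; apply: leaf_nbr wP _; rewrite -vw; have [] := lfP vP.
have PL v : v \in P0 -> v \notin L.
  by move=> vP; apply/negP => /imsetP[w wP vE]; have [_ _] := lfP wP; rewrite -vE vP.
have cL : #|L| = m by rewrite card_in_imset.
have P0L : P0 \subset ~: L by apply/subsetP => v /PL; rewrite inE.
have cCL : #|~: L| + m = #|V| by rewrite -cL addnC cardsC.
have mV : 2 * m <= #|V| by have := subset_leq_card P0L; rewrite cardP0; move: cCL; clear; lia.
pose ty v := v \in P0; pose Z b := if b then ZQ else M.
have L_leaf l : l \in L -> deg T l = 1 by case/imsetP => v vP ->; have [] := lfP vP.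
have tyc b : #|[set v in ~: L | ty v == b]| + e <= #|Z b|.
  case: b; rewrite /Z.
    have -> : [set v in ~: L | ty v == true] = P0; last by rewrite cardP0 cardZ.
    apply/setP => v; rewrite !inE eqb_id /ty; case: (boolP (v \in P0)); rewrite ?andbF //.
    by move/PL; rewrite andbT.
  have -> : [set v in ~: L | ty v == false] = ~: L :\: P0.
    by apply/setP => v; rewrite !inE eqbF_neg andbC.
  by rewrite cardsD (setIidPr P0L) cardP0; move: cCL cardM mV; clear; lia.
have cK : #|~: L| + e <= #|~: Kf|.+1.
  by have := cardsC Kf; rewrite cardK; move: cCL Kf_le mV m_gt0; clear; lia.
have disZb : [disjoint Z true & Z false] by [].
have disZWb b : [disjoint Z b & Wr] by case: b.
have der : 2 * (d * e) <= r by move: er; clear; lia.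
have [f [g [par E]]] := @embeds_exists V X K T d e r L rt triple_in N Z ty Wr Kf T_tree degT
  L_leaf (PL _ rtP) dense reserveW disZb disZWb tyc cK e_gt0 der.
have fb := card_fallback degT (PL _ rtP) dense disZb disZWb tyc cK e_gt0 der E.
pose Q := f @: P0; pose U := ~: (f @: (~: L)); pose C := ~: (g @: (~: L :\ rt)).
have f_inj := emb_inj E.
have cQ : #|Q| = m.
  by rewrite card_in_imset // => x y xP yP; apply: f_inj; apply: (subsetP P0L).
have cU : #|U| = m.
  by have := cardsC (f @: (~: L)); rewrite card_in_imset // cardV -/U; move: cCL; clear; lia.
have cC : #|C| = m.
  have := cardsC (g @: (~: L :\ rt)); rewrite (card_in_imset (emb_col E)) cardK -/C.
  have := cardsD1 rt (~: L); rewrite inE (PL _ rtP); move: cCL mV m_gt0; clear; lia.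
have disQU : [disjoint Q & U].
  by rewrite disjoints_subset setCK; apply: imsetS.
have fZW v : v \in ~: L -> f v \in ZQ :|: M :|: Wr.
  move=> vL; have [|[_ vW _]] := emb_ty E vL; last by rewrite !inE vW !orbT.
  by rewrite /Z; case: (ty v) => vZ; rewrite !inE vZ ?orbT.
have B0U : B0 \subset U.
  apply/subsetP => b bB; rewrite inE; apply/negP => /imsetP[v vL bE].
  have := fZW v vL; rewrite -bE !inE (disjointFl disZB bB) (disjointFl disMB bB).
  by rewrite (disjointFl disWB bB).
(* The fallback vertices account for 2 * (d * e), the surplus of ZQ over P0 for e. *)
pose r1 := 2 * (d * e) + e.
have cZQ : #|ZQ :\: Q| <= r1.
  have : #|P0 :\: fallback Z ty (~: L) f| <= #|ZQ :&: Q|.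
    have fsub : P0 :\: fallback Z ty (~: L) f \subset ~: L by apply: subset_trans (subsetDl _ _) P0L.
    rewrite -(@card_in_imset _ _ f); last first.
      by move=> x y xP yP; apply: f_inj; apply: (subsetP fsub).
    apply/subset_leq_card/subsetP => _ /imsetP[v /setDP[vP vF] ->].
    rewrite inE imset_f // andbT; move: vF; rewrite inE (subsetP P0L) //= negbK /Z /ty vP.
    by [].
  have : #|P0| <= #|P0 :\: fallback Z ty (~: L) f| + #|fallback Z ty (~: L) f|.
    by rewrite -(cardsID (fallback Z ty (~: L) f) P0) addnC leq_add2l subset_leq_card // subsetIr.
  by have := cardsID Q ZQ; rewrite cardZ cardP0 /r1; move: fb; clear; lia.
have cWU : #|Wr :\: U| <= r1.
  apply: (@leq_trans #|fallback Z ty (~: L) f|); last by rewrite /r1; move: fb; clear; lia.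
  apply: leq_trans (leq_imset_card f _); apply/subset_leq_card/subsetP => w /setDP[wW].
  rewrite inE negbK => /imsetP[v vL wE]; apply/imsetP; exists v => //; rewrite inE vL -wE /=.
  by rewrite (disjointFl (disZWb _) wW).
have cKC : #|Kf :\: C| <= r1.
  apply: (@leq_trans #|fallback Z ty (~: L) f|); last by rewrite /r1; move: fb; clear; lia.
  apply: leq_trans (leq_imset_card g _); apply/subset_leq_card/subsetP => k /setDP[kK].
  rewrite inE negbK => /imsetP[v /setD1P[vrt vL] kE]; apply/imsetP; exists v => //.
  rewrite inE vL; apply: (emb_res E vL vrt); by rewrite -kE.
have t_sym x y c : triple_in x y c = triple_in y x c by rewrite /triple_in setUC.
have de : e <= d * e by rewrite leq_pmull.
have rle : 2 * r1 + 2 * e <= r by rewrite /r1; move: er de; clear; lia.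
have Abig : #|Kf| + 2 * r1 + 3 * e <= #|A0| by move: A0big rle; clear; lia.
have [S [u [c [Mt SA UB]]]] := @matches_exists X K e r r1 m triple_in N Q U A0 B0 Wr D0 C Kf
  t_sym dense reserveW reserveD disQU cQ cU cC B0U disDA disWB
  (leq_trans (subset_leq_card (setSD _ D0Z)) cZQ) cWU cKC
  (leq_trans (subset_leq_card (setSD _ A0Z)) cZQ) cAB rle Abig e_gt0.
pose A1 := Q :\: S; pose B1 := U :\: u @: S; pose K1 := C :\: c @: S.
have uU : u @: S \subset U by apply/subsetP => _ /imsetP[q qS ->]; have [] := mat_edge Mt qS.
have cSC : c @: S \subset C by apply/subsetP => _ /imsetP[q qS ->]; have [] := mat_edge Mt qS.
have cA1 : #|A1| = m - #|S| by rewrite cardsD (setIidPr (mat_sub Mt)) cQ.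
have cB1 : #|B1| = m - #|S| by rewrite cardsD (setIidPr uU) cU (card_in_imset (mat_inj Mt)).
have cK1 : #|K1| = m - #|S| by rewrite cardsD (setIidPr cSC) cC (card_in_imset (mat_col Mt)).
have A1A : A1 \subset A0.
  apply/subsetP => q /setDP[qQ qS]; apply: contraNT qS => qA; apply: (subsetP SA).
  by rewrite inE qQ qA.
have B1B : B1 \subset B0.
  apply/subsetP => q /setDP[qQ qS]; apply: contraNT qS => qA; apply: (subsetP UB).
  by rewrite inE qQ qA.
exists A1, B1, K1; split=> //; first by rewrite cA1 cB1 cK1.
  have sub : A0 \subset A1 :|: ((A0 :\: Q) :|: (S :&: A0)).
    apply/subsetP => a aA; rewrite !inE aA andbT; case: (a \in S); case: (a \in Q) => //.
  have := subset_leq_card sub; have := leq_of_leqif (leq_card_setU A1 ((A0 :\: Q) :|: (S :&: A0))).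
  have := leq_of_leqif (leq_card_setU (A0 :\: Q) (S :&: A0)); have := mat_A0 Mt.
  have := leq_trans (subset_leq_card (setSD Q A0Z)) cZQ; move: rle; clear; lia.
move=> Zs /existsP[h /existsP[k /and3P[/dinjectiveP h_inj /dinjectiveP k_inj /forall_inP hk]]].
pose uu q := if q \in A1 then h q else u q.
pose cc q := if q \in A1 then k q else c q.
have QS q : q \in Q -> q \notin A1 -> q \in S by move=> qQ; rewrite inE qQ andbT negbK.
have uuU q : q \in Q -> [/\ uu q \in U, cc q \in C & ([set q; uu q], cc q) \in W0 :|: Zs].
  move=> qQ; rewrite /uu /cc; case: ifP => [qA|/negbT/(QS q qQ) qS].
    have /and3P[/setDP[hU _] /setDP[kC _] hZ] := hk q qA.
    by split=> //; rewrite inE hZ orbT.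
  by have [? ? t] := mat_edge Mt qS; split=> //; rewrite inE; apply/orP; left.
have uu_inj : {in Q &, injective uu}.
  have nh q q' : q \in A1 -> q' \in S -> h q = u q' -> False.
    move=> qA q'S hq; have /and3P[/setDP[_ /negP hU] _ _] := hk q qA; apply: hU.
    by rewrite hq imset_f.
  move=> q q' qQ q'Q; rewrite /uu; case: ifP => qA; case: ifP => q'A.
  - exact: h_inj.
  - by move=> /(nh _ _ qA (QS _ q'Q (negbT q'A))).
  - by move=> /esym /(nh _ _ q'A (QS _ qQ (negbT qA))).
  - exact: mat_inj Mt _ _ (QS _ qQ (negbT qA)) (QS _ q'Q (negbT q'A)).
have cc_inj : {in Q &, injective cc}.
  have nh q q' : q \in A1 -> q' \in S -> k q = c q' -> False.
    move=> qA q'S hq; have /and3P[_ /setDP[_ /negP hU] _] := hk q qA; apply: hU.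
    by rewrite hq imset_f.
  move=> q q' qQ q'Q; rewrite /cc; case: ifP => qA; case: ifP => q'A.
  - exact: k_inj.
  - by move=> /(nh _ _ qA (QS _ q'Q (negbT q'A))).
  - by move=> /esym /(nh _ _ q'A (QS _ qQ (negbT qA))).
  - exact: mat_col Mt _ _ (QS _ qQ (negbT qA)) (QS _ q'Q (negbT q'A)).
pose pr l := odflt rt [pick v in P0 | lf v == l].
have prK v : v \in P0 -> pr (lf v) = v.
  move=> vP; rewrite /pr; case: pickP => [w /andP[wP /eqP]|/(_ v)]; last by rewrite vP eqxx.
  exact: lf_inj.
have prL l : l \in L -> pr l \in P0 /\ lf (pr l) = l.
  by case/imsetP => v vP ->; rewrite prK.
pose F v := if v \in L then uu (f (pr v)) else f v.
pose G v := if v \in L then cc (f (pr v)) else g v.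
pose par' v := if v \in L then pr v else par v.
have fQ l : l \in L -> f (pr l) \in Q by move=> /prL[pP _]; apply: imset_f.
have pr_inj l l' : l \in L -> l' \in L -> f (pr l) = f (pr l') -> l = l'.
  move=> lL l'L; have [pP pE] := prL l lL; have [pP' pE'] := prL l' l'L.
  by move/(f_inj _ _ (subsetP P0L _ pP) (subsetP P0L _ pP')) => pp; rewrite -pE -pE' pp.
apply: (@rainbow_copy_from_parents V X K T (W0 :|: Zs) F G par' rt).
- have nF v w : v \in L -> w \notin L -> uu (f (pr v)) = f w -> False.
    move=> vL wL e1; have [+ _ _] := uuU _ (fQ v vL); rewrite e1 inE imset_f //.
    by rewrite inE.
  move=> v w; rewrite /F; case: ifP => vL; case: ifP => wL.
  + by move/(uu_inj _ _ (fQ v vL) (fQ w wL)); apply: pr_inj.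
  + by move/(nF _ _ vL (negbT wL)).
  + by move/esym/(nF _ _ wL (negbT vL)).
  + by apply: f_inj; rewrite inE ?vL ?wL.
- have nG v w : v \in L -> w \notin L -> w != rt -> cc (f (pr v)) = g w -> False.
    move=> vL wL wrt e1; have [_ + _] := uuU _ (fQ v vL); rewrite e1 inE imset_f //.
    by rewrite !inE wrt.
  move=> v w; rewrite !inE => vrt wrt; rewrite /G; case: ifP => vL; case: ifP => wL.
  + by move/(cc_inj _ _ (fQ v vL) (fQ w wL)); apply: pr_inj.
  + by move/(nG _ _ vL (negbT wL) wrt).
  + by move/esym/(nG _ _ wL (negbT vL) vrt).
  + by apply: (emb_col E); rewrite !inE ?vrt ?wrt ?vL ?wL.
- move=> v vrt; rewrite /F /G /par'; case: (boolP (v \in L)) => /= vL.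
    have [pP pE] := prL v vL; rewrite (negPf (PL _ pP)).
    by have [] := uuU _ (fQ v vL).
  have [|pL pa pt] := emb_par E _ vrt; first by rewrite inE vL.
  by rewrite inE in pL; rewrite (negPf pL) inE; apply/orP; left.
have adjL x y : x \in L -> adj T x y -> x != rt /\ par' x = y.
  move=> xL xy; have [pP pE] := prL x xL; split; first by apply: contraTneq xL => ->; apply: PL.
  by rewrite /par' xL; apply/esym/leaf_nbr => //; rewrite pE adj_sym.
move=> x y xy; have [xL|xL] := boolP (x \in L); first by left; apply: adjL.
have [yL|yL] := boolP (y \in L); first by right; apply: adjL; rewrite // adj_sym.
by rewrite /par' (negPf xL) (negPf yL); apply: (emb_adj E) => //; rewrite inE.
Qed.

End Deterministic.

(** * Union bounds *)

Section UnionBounds.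
Local Open Scope ring_scope.
Variables (R : realFieldType) (X K : finType) (p : {set X} * K -> R).
Hypothesis p01 : forall x, 0 <= p x <= 1.

Implicit Types (A B : {set X}) (J : {set K}).

Lemma union_bound (O I : finType) (w : O -> R) (D : pred I) (bad : I -> pred O) (E : pred O) :
  (forall o, 0 <= w o) -> (forall o, E o -> exists2 i, D i & bad i o) ->
  \sum_(o | E o) w o <= \sum_(i | D i) \sum_(o | bad i o) w o.
Proof.
move=> w_ge0 cover.
rewrite (exchange_big_dep predT) //= big_mkcond; apply: ler_sum => o _.
case: ifP => [/cover[i Di bi]|_]; last exact: sumr_ge0.
by rewrite (bigD1 i) ?Di //= lerDl; apply: sumr_ge0.
Qed.

Lemma ler_sum_or (O : finType) (w : O -> R) (E E1 E2 : pred O) :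
  (forall o, 0 <= w o) -> (forall o, E o -> E1 o || E2 o) ->
  \sum_(o | E o) w o <= \sum_(o | E1 o) w o + \sum_(o | E2 o) w o.
Proof.
move=> w_ge0 cover; have := @union_bound _ _ w predT (fun b o => if b then E1 o else E2 o) E w_ge0.
rewrite big_bool; apply => o /cover /orP[E1o|E2o]; [by exists true | by exists false].
Qed.

Definition triple_box (A B : {set X}) (J : {set K}) : {set {set X} * K} :=
  [set ([set z.1.1; z.1.2], z.2) | z in setX (setX A B) J].

Lemma card_triple_box A B J : [disjoint A & B] -> #|triple_box A B J| = (#|A| * #|B| * #|J|)%N.
Proof.
move=> disAB; rewrite card_in_imset ?cardsX // => -[[x y] c] [[x' y'] c'].
rewrite !inE /= => /andP[/andP[xA yB] _] /andP[/andP[x'A y'B] _] [e ->].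
by have [-> ->] := set2_disjoint_inj disAB xA x'A yB y'B e.
Qed.

Lemma box_avoid_prob A B J (p1 : R) (k : nat) : [disjoint A & B] -> 0 <= p1 <= 1 ->
    (forall x y c, x \in A -> y \in B -> c \in J -> p1 <= p ([set x; y], c)) ->
    (k <= #|A| * #|B| * #|J|)%N ->
  \sum_(W : {set {set X} * K} | [disjoint triple_box A B J & W]) bern p W <= (1 - p1) ^+ k.
Proof.
move=> disAB /andP[p1_0 p1_1] pge kle; rewrite bern_disjoint.
apply: (@le_trans _ _ (\prod_(x in triple_box A B J) (1 - p1))).
  apply: ler_prod => _ /imsetP[[[x y] c] /setXP[/setXP[xA yB] cJ] ->].
  by have /andP[_ h] := p01 ([set x; y], c); have := pge x y c xA yB cJ; rewrite /=; lra.
rewrite prodr_const card_triple_box //; apply: ler_wiXn2l kle; lra.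
Qed.

Lemma not_triple_box A B J (W : {set {set X} * K}) :
  ~~ [exists x in A, exists y in B, exists c in J, ([set x; y], c) \in W] ->
  [disjoint triple_box A B J & W].
Proof.
move=> nex; rewrite -setI_eq0; apply/set0Pn => -[_ /setIP[/imsetP[[[x y] c] /setXP[/setXP[xA yB] cJ] ->] inW]].
case/negP: nex; apply/exists_inP; exists x => //; apply/exists_inP; exists y => //.
by apply/exists_inP; exists c.
Qed.

Definition dense_triples (e : nat) (W : {set {set X} * K}) : bool :=
  [forall A : {set X}, forall B : {set X}, forall J : {set K},
    [&& [disjoint A & B], e <= #|A|, e <= #|B| & e <= #|J|]%N ==>
    [exists x in A, exists y in B, exists c in J, ([set x; y], c) \in W]].

Lemma dense_prob (e : nat) (p1 : R) : 0 <= p1 <= 1 ->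
    (forall x y c, x != y -> p1 <= p ([set x; y], c)) ->
  \sum_(W | ~~ dense_triples e W) bern p W <=
  2 ^+ (#|X| + #|X| + #|K|) * (1 - p1) ^+ (e * e * e).
Proof.
move=> p1_01 pge.
pose Q (w : {set X} * {set X} * {set K}) :=
  [&& [disjoint w.1.1 & w.1.2], e <= #|w.1.1|, e <= #|w.1.2| & e <= #|w.2|]%N.
have := @union_bound _ _ (bern p) Q (fun w W => [disjoint triple_box w.1.1 w.1.2 w.2 & W])
  (fun W => ~~ dense_triples e W) (fun W => bern_ge0 W p01).
move=> /(_ _)/le_trans; apply.
  move=> W; rewrite negb_forall => /existsP[A]; rewrite negb_forall => /existsP[B].
  rewrite negb_forall => /existsP[J]; rewrite negb_imply => /andP[QABJ /not_triple_box dis].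
  by exists (A, B, J).
apply: (@le_trans _ _ (\sum_(w | Q w) (1 - p1) ^+ (e * e * e))).
  apply: ler_sum => -[[A B] J] /and4P[/= dis eA eB eJ]; apply: box_avoid_prob => //.
    move=> x y c xA yB _; apply: pge; apply: contraTneq xA => ->.
    by rewrite (disjointFl dis yB).
  by rewrite !leq_mul.
rewrite sumr_const -[leLHS]mulr_natl ler_wpM2r ?exprn_ge0 //; first by lra.
rewrite -natrX ler_nat; apply: leq_trans (max_card _) _.
have cs (O : finType) : #|{set O}| = (2 ^ #|O|)%N by rewrite -[LHS]cardsT -powersetT card_powerset cardsT.
by rewrite !card_prod !cs !expnD.
Qed.

Definition reserve_triples (r : nat) (N : X -> {set X}) (Rs : {set X}) (Kf : {set K})
    (W : {set {set X} * K}) : bool :=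
  [forall v, forall Y : {set X}, forall J : {set K},
    (#|(N v :&: Rs) :\: Y| <= r)%N && (#|Kf :\: J| <= r)%N ==>
    [exists y in Y, exists c in J, ([set v; y], c) \in W]].

(** Chernoff's trick: every set Y is weighted by x^|Y|, which is at least x^r for the sets counted,
    and then all Y are summed. *)
Lemma card_small_sets (O : finType) (x : R) (r : nat) : 0 < x <= 1 ->
  #|[set Y : {set O} | (#|Y| <= r)%N]|%:R * x ^+ r <= (1 + x) ^+ #|O|.
Proof.
move=> /andP[x0 x1].
have := sum_subset_expr x [set: O]; rewrite cardsT => <-.
rewrite mulr_natl -sumr_const.
apply: (@le_trans _ _ (\sum_(Y in [set Y : {set O} | (#|Y| <= r)%N]) x ^+ #|Y|)).
  by apply: ler_sum => Y; rewrite inE => Yr; apply: ler_wiXn2l => //; rewrite ?ltW.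
apply: ler_sum_subset => [Y _|Y _]; first by rewrite exprn_ge0 // ltW.
exact: subsetT.
Qed.

(** The union bound runs over the missing parts, which have at most r elements and are therefore
    few, instead of over the sets that remain. *)
Lemma reserve_prob (r a b : nat) (N : X -> {set X}) (Rs : {set X}) (Kf : {set K}) (p2 x : R) :
    0 <= p2 <= 1 -> 0 < x <= 1 -> (forall v, v \notin N v) ->
    (forall v y c, y \in N v -> p2 <= p ([set v; y], c)) ->
    (forall v, a + r <= #|N v :&: Rs|)%N -> (b + r <= #|Kf|)%N ->
  \sum_(W | ~~ reserve_triples r N Rs Kf W) bern p W <=
  #|X|%:R * ((1 + x) ^+ #|X| / x ^+ r * ((1 + x) ^+ #|K| / x ^+ r)) * (1 - p2) ^+ (a * b).
Proof.
move=> p2_01 x01 Nirr pge aN bK.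
have x_gt0 : 0 < x by case/andP: x01.
pose Q (w : X * {set X} * {set K}) := (#|w.1.2| <= r)%N && (#|w.2| <= r)%N.
have := @union_bound _ _ (bern p) Q (fun w W =>
   [disjoint triple_box [set w.1.1] ((N w.1.1 :&: Rs) :\: w.1.2) (Kf :\: w.2) & W])
  (fun W => ~~ reserve_triples r N Rs Kf W) (fun W => bern_ge0 W p01).
move=> /(_ _)/le_trans; apply.
  move=> W; rewrite negb_forall => /existsP[v]; rewrite negb_forall => /existsP[Y].
  rewrite negb_forall => /existsP[J]; rewrite negb_imply => /andP[/andP[cY cJ] nex].
  exists (v, (N v :&: Rs) :\: Y, Kf :\: J); first by rewrite /Q /= cY cJ.
  apply: not_triple_box; apply: contra nex => /exists_inP[v' /set1P -> /exists_inP[y /setDP[yN yY]]].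
  case/exists_inP => c /setDP[cK cJ'] inW /=.
  apply/exists_inP; exists y; first by move: yY; rewrite inE yN andbT negbK.
  by apply/exists_inP; exists c => //; move: cJ'; rewrite inE cK andbT negbK.
apply: (@le_trans _ _ (\sum_(w | Q w) (1 - p2) ^+ (a * b))).
  apply: ler_sum => -[[v Y] J] /andP[/= cY cJ]; apply: box_avoid_prob => //.
  - rewrite disjoints1 !inE negb_and negb_and negbK; apply/orP; right.
    by rewrite Nirr.
  - by move=> z y c /set1P -> /setDP[/setIP[yN _] _] _; apply: pge.
  rewrite cards1 mul1n; apply: leq_mul.
    have := cardsID Y (N v :&: Rs); have := subset_leq_card (subsetIr (N v :&: Rs) Y).
    by move: (aN v) cY; clear; lia.
  have := cardsID J Kf; have := subset_leq_card (subsetIr Kf J).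
  by move: bK cJ; clear; lia.
rewrite sumr_const -[leLHS]mulr_natl ler_wpM2r ?exprn_ge0 //; first by lra.
have -> : #|Q| = (#|X| * #|[set Y : {set X} | (#|Y| <= r)%N]| * #|[set J : {set K} | (#|J| <= r)%N]|)%N.
  have -> : #|X| = #|[set: X]| by rewrite cardsT.
  rewrite -!cardsX; apply: eq_card => -[[v Y] J].
  by rewrite unfold_in /Q !inE.
rewrite !natrM -mulrA ler_wpM2l ?ler0n //; apply: ler_pM => //.
  by rewrite ler_pdivlMr ?exprn_gt0 // card_small_sets.
by rewrite ler_pdivlMr ?exprn_gt0 // card_small_sets.
Qed.

End UnionBounds.

(** * Random choice of the reserve sets *)

Section ReserveSets.
Local Open Scope ring_scope.
Variables (R : realFieldType) (X : finType) (N : X -> {set X}) (Ex : {set X}).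

(** The classes are chosen uniformly at random. The probability that fewer than w of the at least h
    neighbours of v fall into a given class is at most 2^w times the mean of 2^-count, and each
    neighbour contributes a factor 1 - 1/(2L) to this mean. *)
Lemma random_partition (L : nat) (w h : nat) : (0 < L)%N ->
    (forall v, (h <= #|N v :\: Ex|)%N) ->
    #|X|%:R * L%:R * (2 ^+ w * (1 - (2 * L%:R)^-1) ^+ h) < 1 :> R ->
  exists chi : X -> 'I_L, forall v i, (w <= #|[set y in N v :\: Ex | chi y == i]|)%N.
Proof.
move=> L_gt0 hN small.
have LR : 0 < L%:R :> R by rewrite ltr0n.
pose u (x : X) (a : 'I_L) : R := L%:R^-1.
have u1 x : \sum_a u x a = 1 by rewrite /u sumr_const card_ord -(mulr_natl L%:R^-1) divff // gt_eqF.
have u_ge0 x a : 0 <= u x a by rewrite /u invr_ge0 ltW.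
pose cl (chi : {ffun X -> 'I_L}) (z : X * 'I_L) := #|[set y in N z.1 :\: Ex | chi y == z.2]|.
have [/existsP[chi /forallP good]|none] := boolP [exists chi : {ffun X -> 'I_L}, forall z, (w <= cl chi z)%N].
  by exists chi => v i; have := good (v, i).
have := @union_bound R _ _ (prod_mass u) predT (fun z chi => (cl chi z < w)%N) predT
  (fun s => prod_mass_ge0 s u_ge0).
rewrite prod_mass_sum // => /(_ _) le; exfalso.
have {}le : 1 <= \sum_(z : X * 'I_L) \sum_(chi | (cl chi z < w)%N) prod_mass u chi.
  apply: le => chi _; move: none; rewrite negb_exists => /forallP/(_ chi).
  by rewrite negb_forall => /existsP[z]; rewrite -ltnNge => zw; exists z.
suff bd z : \sum_(chi | (cl chi z < w)%N) prod_mass u chi <= 2 ^+ w * (1 - (2 * L%:R)^-1) ^+ h.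
  have := le_trans le (ler_sum _ (fun z _ => bd z)).
  rewrite sumr_const card_prod card_ord -(mulr_natl (_ * _ ^+ h)) natrM.
  by move/(le_lt_trans)/(_ small); rewrite ltxx.
pose v (x : X) (a : 'I_L) : R := u x a * (if (x \in N z.1 :\: Ex) && (a == z.2) then 2^-1 else 1).
apply: (@le_trans _ _ (\sum_(chi : {ffun X -> 'I_L}) 2 ^+ w * prod_mass v chi)).
  have v_ge0 x a : 0 <= v x a by rewrite mulr_ge0 //; case: ifP => // _; rewrite invr_ge0.
  rewrite big_mkcond; apply: ler_sum => chi _; case: ifP => [lt|_]; last first.
    by rewrite mulr_ge0 ?exprn_ge0 // prod_mass_ge0.
  rewrite /prod_mass big_split /= -big_mkcond /= mulrCA ler_peMr ?prod_mass_ge0 //.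
  rewrite prodr_const.
  have -> : #|[pred x | (x \in N z.1 :\: Ex) && (chi x == z.2)]| = cl chi z.
    by rewrite /cl cardsE.
  rewrite exprVn ler_pdivlMr ?exprn_gt0 // mul1r ler_weXn2l //; first by lra.
  exact: ltnW.
rewrite -mulr_sumr ler_wpM2l ?exprn_ge0 // /prod_mass -bigA_distr_bigA /=.
have cf_01 : 0 <= (1 : R) - (2 * L%:R)^-1 <= 1.
  have L1 : 1 <= L%:R :> R by rewrite ler1n.
  have inv_ge0 : 0 <= (2 * L%:R)^-1 :> R by rewrite invr_ge0 mulr_ge0 // ltW.
  have inv_le1 : (2 * L%:R)^-1 <= 1 :> R by rewrite invf_le1 ?mulr_gt0 //; lra.
  by rewrite subr_ge0 inv_le1 lerBlDr lerDl inv_ge0.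
apply: (@le_trans _ _ (\prod_(x in N z.1 :\: Ex) (1 - (2 * L%:R)^-1))); last first.
  by case/andP: cf_01 => c0 c1; rewrite prodr_const; apply: ler_wiXn2l (hN _).
rewrite [leRHS]big_mkcond /=; apply: ler_prod => x _.
have sv_ge0 : 0 <= \sum_a v x a.
  by apply: sumr_ge0 => a _; rewrite mulr_ge0 //; case: ifP => // _; rewrite invr_ge0.
rewrite sv_ge0 /=; case: ifP => xN; last first.
  by rewrite -(u1 x); apply: ler_sum => a _; rewrite /v xN /= mulr1.
rewrite (bigD1 z.2) //= /v xN eqxx /= (eq_bigr (fun a => u x a)); last first.
  by move=> a /negPf az; rewrite az mulr1.
have := u1 x; rewrite (bigD1 z.2) //=; set s := \sum_(i | _) _; rewrite /u => us.
have -> : s = 1 - L%:R^-1 by apply/eqP; rewrite eq_sym subr_eq addrC us.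
by rewrite invfM; lra.
Qed.

(** At most half of the L classes exceed twice the average size, so for L >= 4 two of the others can
    be taken; the reserves must stay a small fraction of m. *)
Lemma reserve_sets (L w h : nat) : (4 <= L)%N -> (0 < #|X|)%N ->
    (forall v, (h <= #|N v :\: Ex|)%N) ->
    #|X|%:R * L%:R * (2 ^+ w * (1 - (2 * L%:R)^-1) ^+ h) < 1 :> R ->
  exists D W : {set X}, [/\ [disjoint D & W], [disjoint D :|: W & Ex],
    (L * #|D| <= 2 * #|X|)%N /\ (L * #|W| <= 2 * #|X|)%N,
    forall v, (w <= #|N v :&: D|)%N & forall v, (w <= #|N v :&: W|)%N].
Proof.
move=> L4 X_gt0 hN small; have L_gt0 : (0 < L)%N by apply: leq_trans L4.
have [chi good] := random_partition L_gt0 hN small.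
pose cl i := [set y | chi y == i].
pose Big := [set i | 2 * #|X| < L * #|cl i|]%N.
have sumcl : (\sum_i #|cl i| = #|X|)%N.
  rewrite -[#|X|]sum1_card (partition_big chi predT) //=; apply: eq_bigr => i _.
  by rewrite -sum1_card; apply: eq_bigl => y; rewrite inE.
have cBig : (2 * #|Big| <= L)%N.
  have : (#|Big| * (2 * #|X|) <= L * #|X|)%N.
    rewrite -sum_nat_const -[X in (_ <= L * X)%N]sumcl big_distrr /= big_mkcond; apply: leq_sum => i _.
    by case: ifP => //; rewrite inE => /ltnW.
  by rewrite mulnCA mulnA leq_pmul2r.
have : (1 < #|~: Big|)%N by have := cardsC Big; rewrite card_ord; move: cBig L4; clear; lia.
case/card_gt1P => i [j [iB jB ij]].
have cle k : k \in ~: Big -> (L * #|cl k :\: Ex| <= 2 * #|X|)%N.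
  rewrite !inE -leqNgt => le; apply: leq_trans le; rewrite leq_mul2l subset_leq_card ?orbT //.
  exact: subsetDl.
have gl v k : (w <= #|N v :&: (cl k :\: Ex)|)%N.
  apply: leq_trans (good v k) _; apply/subset_leq_card/subsetP => y.
  by rewrite !inE => /andP[/andP[-> ->] ->].
exists (cl i :\: Ex), (cl j :\: Ex); split=> //.
- rewrite -setI_eq0; apply/set0Pn => -[y]; rewrite !inE => /andP[/andP[_ /eqP yi] /andP[_ /eqP yj]].
  by case/negP: ij; rewrite -yi -yj.
- by rewrite disjoints_subset subUset !subsetDr.
- by split; apply: cle.
Qed.

End ReserveSets.

(** At most d leaves share a parent, so d * m leaves have at least m parents. A parent is not itself
    a leaf, since two adjacent leaves would be a whole component and there are more than two
    vertices. *)
Lemma leaf_parents (V : finType) (T : sgraph V) (d m : nat) : is_tree T -> 2 < #|V| ->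
    (forall v, deg T v <= d) -> d * m <= #|leaves T| -> 0 < d ->
  exists (P0 : {set V}) (lf : V -> V), #|P0| = m /\
    (forall v, v \in P0 -> [/\ deg T (lf v) = 1, adj T v (lf v) & lf v \notin P0]).
Proof.
move=> [[_ conn] _] V3 degT dm d_gt0.
pose PP := [set v | [exists l in leaves T, adj T v l]].
have leaf_ex l : l \in leaves T -> exists2 v, adj T l v & forall w, adj T l w -> w = v.
  rewrite inE => /cards1P[v vE]; exists v; first by have := set11 v; rewrite -vE inE.
  by move=> w lw; apply/set1P; rewrite -vE inE.
pose pl l := odflt l [pick v | adj T l v].
have plP l : l \in leaves T -> adj T l (pl l).
  by case/leaf_ex => v lv _; rewrite /pl; case: pickP => [//|/(_ v)]; rewrite lv.
have mPP : m <= #|PP|.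
  rewrite -(leq_pmul2l d_gt0); apply: leq_trans dm _; apply: (@card_fiber_le _ _ _ _ pl) => [l lL|v _].
    by rewrite inE; apply/exists_inP; exists l; rewrite // adj_sym plP.
  apply: leq_trans (degT v); apply/subset_leq_card/subsetP => l; rewrite !inE => /andP[l1 /eqP <-].
  by rewrite adj_sym plP // inE.
have PPleaf v : v \in PP -> v \notin leaves T.
  rewrite inE => /exists_inP[l lL vl]; apply/negP => vL.
  have [a _ av] := leaf_ex v vL; have [b _ bl] := leaf_ex l lL.
  have lE := av l vl; have vE := bl v; rewrite adj_sym in vE; have {}vE := vE vl.
  have step x y : adj T x y -> x \in [set v; l] -> y \in [set v; l].
    move=> xy /set2P[xE|xE]; rewrite xE in xy; first by rewrite (av y xy) -lE set22.
    by rewrite (bl y xy) -vE set21.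
  have all x : x \in [set v; l] by apply: connect_closed step (conn v x) (set21 v l).
  have : #|V| <= #|[set v; l]| by rewrite -cardsT subset_leq_card //; apply/subsetP => x _.
  by rewrite cards2; move: V3; clear; case: (_ != _) => /=; lia.
have [P0 P0P P0m] := exists_subset_card mPP.
pose lf v := odflt v [pick l in leaves T | adj T v l].
exists P0, lf; split=> // v vP.
have : v \in PP by apply: (subsetP P0P).
rewrite inE => /exists_inP[l lL vl]; rewrite /lf; case: pickP => [l' /andP[l'L vl']|/(_ l)]; last by rewrite lL vl.
split=> //=; first by move: l'L; rewrite inE => /eqP.
by apply: contraL l'L => /(subsetP P0P)/PPleaf.
Qed.

Lemma prod_error_ge (R : realFieldType) (S F0 F1 : R) : (
  1 - F0 <= S -> S <= 1 -> 0 <= F1 -> 1 - F0 - F1 <= S * (1 - F1))%R.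
Proof. by move=> ? ? ?; nra. Qed.

(** * An explicit bound for fixed n *)

Section FiniteBound.
Local Open Scope ring_scope.
Variables (R : archiRealFieldType) (n : nat) (V : finType) (T : sgraph V) (G0 : sgraph 'I_n).
Variables (p rho s x y : R) (d e r m L w h kf a b c t : nat) (A0 B0 : {set 'I_n}).

Let k : R := n.-1%:R.
Let nbr (v : 'I_n) : {set 'I_n} := [set u | adj G0 v u].

Hypotheses (cardV : #|V| = n) (n_ge3 : (2 < n)%N) (T_tree : is_tree T).
Hypotheses (degT : forall v, (deg T v <= d)%N) (d_gt0 : (0 < d)%N).
Hypotheses (leavesT : (d * m <= #|leaves T|)%N) (m_gt0 : (0 < m)%N).
Hypotheses (p01 : 0 <= p <= 1) (s01 : 0 <= s <= 1) (x01 : 0 < x <= 1) (y_ge1 : 1 <= y).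
Hypotheses (disAB : [disjoint A0 & B0]) (cAB : #|A0| = #|B0|).
Hypothesis regular : forall A1 B1 S Q : {set 'I_n}, A1 \subset A0 -> B1 \subset B0 -> #|A1| = #|B1| ->
  (#|A0| - #|A1|)%:R <= rho * #|A0|%:R -> S \subset A1 -> Q \subset B1 ->
  (#|A1| < #|S| + #|Q|)%N ->
  rho * #|A0|%:R * (minn #|S| #|Q|)%:R <= #|bip_edges (adj G0) S Q|%:R.
Hypotheses (L4 : (4 <= L)%N) (hN : forall v, (h <= #|nbr v :\: (A0 :|: B0)|)%N).
Hypothesis partition_ok : n%:R * L%:R * (2 ^+ w * (1 - (2 * L%:R)^-1) ^+ h) < 1 :> R.
Hypotheses (a0m : (4 * #|A0| <= m)%N) (Lm : (8 * n <= L * m)%N) (em : (8 * e <= m)%N).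
Hypotheses (kfa : (kf + r + e <= #|A0|)%N) (e_gt0 : (0 < e)%N) (er : (8 * (d * e) <= r)%N).
Hypotheses (arw : (a + r <= w)%N) (brk : (b + r <= kf)%N).
Hypotheses (r_rho : r%:R <= rho * #|A0|%:R) (c_rho : c%:R <= rho * #|A0|%:R).
Hypothesis c_a0 : (2 * c + r <= #|A0|)%N.
Hypothesis small : 4 * ((1 + n%:R * (1 - s) ^+ c) ^+ n - 1) <= 1.

Let p0 : R := (3 * k)^-1.

(** The first bracket bounds the failure of the first round: density, then one equal term for each
    of the two reserves. The second bounds the failure of the last two rounds, uniformly over the
    good outcomes of the first. *)
Lemma rainbow_prob_ge :
  1 - (2 ^+ (n + n + n.-1) * (1 - p / (3 * k)) ^+ (e * e * e) +
       2 * (n%:R * ((1 + x) ^+ n / x ^+ r * ((1 + x) ^+ n.-1 / x ^+ r)) * (1 - p0) ^+ (a * b)))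
    - ((1 + y * (s ^+ 2 / p0)) ^+ n / (y ^+ t * 8^-1) + ((1 + s ^+ 2 / p0) ^+ t - 1) / 8^-1 ^+ 2)
  <= prob_rainbow_copy T G0 p.
Proof.
have n1_gt0 : (0 < n.-1)%N by move: n_ge3; clear; lia.
have k_gt0 : 0 < k by rewrite ltr0n.
have k1 : 1 <= k by rewrite ler1n.
have cK : #|'I_n.-1| = n.-1 by rewrite card_ord.
have K_gt0 : (0 < #|'I_n.-1|)%N by rewrite cK.
have cX : #|'I_n| = n by rewrite card_ord.
have n_gt0 : (0 < n)%N by move: n_ge3; clear; lia.
pose q : {set 'I_n} * 'I_n.-1 -> R := fun z => round_prob 'I_n.-1 G0 p z.1.
have q01 z : 0 <= q z <= 1 by apply: round_prob01.
have p0_gt0 : 0 < p0 by rewrite invr_gt0 mulr_gt0.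
have p0_le1 : p0 <= 1 by rewrite invf_le1 ?mulr_gt0 //; apply: (le_trans k1); rewrite ler_peMl ?(ltW k_gt0) // ler1n.
have /andP[p_ge0 p_le1] := p01.
have q_edge v u (col : 'I_n.-1) : adj G0 v u -> p0 <= q ([set v; u], col).
  by move=> vu; rewrite /q /round_prob /= [[set v; u] \in _]vu cK mul1r.
have q_pair u v (col : 'I_n.-1) : u != v -> p / (3 * k) <= q ([set u; v], col).
  move=> uv; rewrite /q /round_prob /= cK -/k ler_wpM2r ?(ltW p0_gt0) //.
  by case: ifP => _ //; rewrite inE cards2 uv.
have nbr_irr v : v \notin nbr v by rewrite inE adj_irrefl.
have [P0 [lf [cP0 lfP]]] := @leaf_parents V T d m T_tree ltac:(by rewrite cardV) degT leavesT d_gt0.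
have [D0 [Wr [disDW disE [cD cW] wD wW]]] := @reserve_sets R 'I_n nbr (A0 :|: B0) L w h L4
  ltac:(by rewrite cX) hN ltac:(by rewrite cX).
rewrite cX in cD cW.
have mn : (2 * m <= n)%N.
  have disPL : [disjoint P0 & lf @: P0].
    rewrite disjoint_sym disjoints_subset; apply/subsetP => _ /imsetP[v vP ->].
    by rewrite inE; have [] := lfP v vP.
  have lf_inj : {in P0 &, injective lf}.
    move=> u v uP vP uv; have [/eqP/cards1P[z zE] ul _] := lfP u uP.
    have [_ vl _] := lfP v vP; rewrite -uv in vl.
    have : u \in [set w0 | adj T (lf u) w0] by rewrite inE adj_sym.
    have : v \in [set w0 | adj T (lf u) w0] by rewrite inE adj_sym.
    by rewrite zE => /set1P -> /set1P ->.
  have := max_card (mem (P0 :|: lf @: P0)); rewrite cardV cardsU (eqP (etrans (setI_eq0 _ _) disPL)).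
  by rewrite cards0 subn0 (card_in_imset lf_inj) cP0 addnn -mul2n.
have D4 : (4 * #|D0| <= m)%N.
  have L0 : (0 < L)%N by apply: leq_trans L4.
  rewrite -(leq_pmul2l L0); apply: leq_trans Lm; rewrite mulnCA; move: cD; clear; lia.
have W4 : (4 * #|Wr| <= m)%N.
  have L0 : (0 < L)%N by apply: leq_trans L4.
  rewrite -(leq_pmul2l L0); apply: leq_trans Lm; rewrite mulnCA; move: cW; clear; lia.
have disEs z : z \in A0 :|: B0 -> z \notin D0 /\ z \notin Wr.
  by move=> zE; have := disjointFl disE zE; rewrite inE => /negbT; rewrite negb_or => /andP.
pose BW := B0 :|: Wr.
have ADs : A0 :|: D0 \subset ~: BW.
  apply/subsetP => z; rewrite !inE => /orP[zA|zD]; rewrite negb_or.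
    by rewrite (disjointFr disAB zA) /=; have [] := disEs z ltac:(by rewrite inE zA).
  rewrite (disjointFr disDW zD) andbT; apply/negP => zB.
  by have [] := disEs z ltac:(by rewrite inE zB orbT); rewrite zD.
have cBW : (#|BW| <= #|A0| + #|Wr|)%N by rewrite cAB; apply: leq_card_setU.
have [ZQ [ADZ ZB cZ]] : exists ZQ : {set 'I_n}, [/\ A0 :|: D0 \subset ZQ, ZQ \subset ~: BW & #|ZQ| = (m + e)%N].
  have cAD : (#|A0 :|: D0| <= #|A0| + #|D0|)%N by apply: leq_card_setU.
  have [|E0 E0s E0c] := @exists_subset_card _ (~: BW :\: (A0 :|: D0)) (m + e - #|A0 :|: D0|).
    rewrite cardsD (setIidPr ADs); apply: leq_sub2r.
    by have := cardsC BW; rewrite cX; move: cBW mn em W4 a0m; clear; lia.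
  exists (A0 :|: D0 :|: E0); split; first exact: subsetUl.
    by rewrite subUset ADs (subset_trans E0s) ?subsetDl.
  rewrite cardsU (_ : (A0 :|: D0) :&: E0 = set0) ?cards0 ?subn0 ?E0c.
    by move: cAD D4 a0m; clear; lia.
  by apply/eqP; rewrite setI_eq0 disjoint_sym (disjointWl E0s) // disjoints_subset subsetDr.
have ZBd z : z \in ZQ -> z \notin B0 /\ z \notin Wr.
  by move/(subsetP ZB); rewrite !inE negb_or => /andP.
pose M := ~: (ZQ :|: BW).
have cM : (#|V| + e <= #|M| + 2 * m)%N.
  have := cardsC (ZQ :|: BW); rewrite cX cardV -/M.
  have : (#|ZQ :|: BW| <= #|ZQ| + #|BW|)%N by apply: leq_card_setU.
  by rewrite cZ; move: cBW a0m W4 em mn; clear; lia.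
have [Kf _ cKf] := @exists_subset_card _ [set: 'I_n.-1] kf
  ltac:(rewrite cardsT cK; move: kfa a0m mn; clear; lia).
have disZM : [disjoint ZQ & M] by rewrite disjoints_subset setCK subsetUl.
have disZW : [disjoint ZQ & Wr] by rewrite disjoints_subset; apply/subsetP => z /ZBd[_ zW]; rewrite inE.
have disZB0 : [disjoint ZQ & B0] by rewrite disjoints_subset; apply/subsetP => z /ZBd[zW _]; rewrite inE.
have disMW : [disjoint M & Wr].
  by rewrite disjoint_sym disjoints_subset setCK; apply: subset_trans (subsetUr _ _); apply: subsetUr.
have disMB : [disjoint M & B0].
  by rewrite disjoint_sym disjoints_subset setCK; apply: subset_trans (subsetUr _ _); apply: subsetUl.
have disWB : [disjoint Wr & B0].
  rewrite disjoints_subset; apply/subsetP => z zW; rewrite inE; apply/negP => zB.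
  by have [] := disEs z ltac:(by rewrite inE zB orbT); rewrite zW.
have disDA : [disjoint D0 & A0].
  rewrite disjoints_subset; apply/subsetP => z zD; rewrite inE; apply/negP => zA.
  by have [] := disEs z ltac:(by rewrite inE zA); rewrite zD.
have A0Z : A0 \subset ZQ by apply: subset_trans ADZ; apply: subsetUl.
have D0Z : D0 \subset ZQ by apply: subset_trans ADZ; apply: subsetUr.
pose good (W : {set {set 'I_n} * 'I_n.-1}) :=
  [&& dense_triples e W, reserve_triples r nbr Wr Kf W & reserve_triples r nbr D0 Kf W].
set E0 := _ + 2 * _; set E1 := _ + _ / 8^-1 ^+ 2.
have p1_01 : 0 <= p / (3 * k) <= 1.
  by rewrite mulr_ge0 ?(ltW p0_gt0) //= mulr_ile1 // ltW.
have p0_01 : 0 <= p0 <= 1 by rewrite ltW.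
have Pgood : 1 - E0 <= \sum_(W | good W) bern q W.
  have := bern_sum q; rewrite (bigID good) /= => tot.
  rewrite lerBlDr -[leLHS]tot lerD2l.
  apply: (@le_trans _ _ (\sum_(W | ~~ dense_triples e W) bern q W +
    (\sum_(W | ~~ reserve_triples r nbr Wr Kf W) bern q W +
     \sum_(W | ~~ reserve_triples r nbr D0 Kf W) bern q W))).
    have b_ge0 W : 0 <= bern q W by apply: bern_ge0.
    apply: le_trans (lerD (lexx _) (@ler_sum_or _ _ (bern q)
      (fun W => ~~ reserve_triples r nbr Wr Kf W || ~~ reserve_triples r nbr D0 Kf W) _ _ b_ge0 _)) => //.
    by apply: ler_sum_or => // W; rewrite /good !negb_and.
  rewrite /E0 [2 * _]mulr_natl mulr2n; apply: lerD; last apply: lerD.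
  - by have := dense_prob q01 e p1_01 q_pair; rewrite cX cK.
  - have := @reserve_prob R _ _ q q01 r a b nbr Wr Kf p0 x p0_01 x01 nbr_irr.
    rewrite cX cK; apply.
    + by move=> v u col; rewrite inE; apply: q_edge.
    + by move=> v; apply: leq_trans (wW v).
    + by rewrite cKf.
  - have := @reserve_prob R _ _ q q01 r a b nbr D0 Kf p0 x p0_01 x01 nbr_irr.
    rewrite cX cK; apply.
    + by move=> v u col; rewrite inE; apply: q_edge.
    + by move=> v; apply: leq_trans (wD v).
    + by rewrite cKf.
have sp0 : 0 <= s ^+ 2 / p0 by rewrite divr_ge0 ?exprn_ge0 ?(ltW p0_gt0) //; case/andP: s01.
have y_gt0 : 0 < y by apply: lt_le_trans y_ge1.
have E1_ge0 : 0 <= E1.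
  apply: addr_ge0; apply: divr_ge0.
  - by apply: exprn_ge0; apply: addr_ge0 => //; apply: mulr_ge0 => //; apply: ltW.
  - by apply: mulr_ge0; [apply: exprn_ge0; apply: ltW | rewrite invr_ge0].
  - by rewrite subr_ge0 exprn_ege1 // lerDl.
  - by apply: exprn_ge0; rewrite invr_ge0.
have inner W0 : good W0 -> 1 - E1 <= \sum_W1 bern q W1 *
   \sum_(W2 : {set {set 'I_n} * 'I_n.-1} | [exists S : {set {set 'I_n} * 'I_n.-1},
      rainbow_copy_set T S && (S \subset W0 :|: W1 :|: W2)]) bern q W2.
  case/and3P => dn rsW rsD.
  have dense' : spans_triples (triple_in W0) e.
    move=> A B J dAB eA eB eJ; have := forallP (forallP (forallP dn A) B) J.
    rewrite dAB eA eB eJ => /exists_inP[z zA /exists_inP[u uB /exists_inP[col cJ inW]]].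
    by exists z, u, col.
  have reserve' Rs : reserve_triples r nbr Rs Kf W0 -> reserve_spans (triple_in W0) nbr r Rs Kf.
    move=> rs v Y J cY cJ; have := forallP (forallP (forallP rs v) Y) J.
    by rewrite cY cJ => /exists_inP[u uY /exists_inP[col colJ inW]]; exists u, col.
  have Kf_le : (#|Kf| + e <= m)%N by rewrite cKf; move: kfa a0m; clear; lia.
  have A0big : (#|Kf| + r + e <= #|A0|)%N by rewrite cKf.
  have cVX : #|'I_n| = #|V| by rewrite cX cardV.
  have cVK : #|'I_n.-1| = #|V|.-1 by rewrite cK cardV.
  have [A1 [B1 [K1 [A1A B1B [cA1 cK1] A1r emb]]]] := @deterministic_embedding V 'I_n 'I_n.-1 T d e r m W0 nbr
    P0 lf ZQ M A0 B0 Wr D0 Kf T_tree degT d_gt0 cVX cVK lfP cP0 m_gt0 dense' (reserve' _ rsW) (reserve' _ rsD)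
    disZM disZW disMW disZB0 disMB disWB A0Z D0Z disDA cZ cM cAB e_gt0 er Kf_le A0big.
  have A1le := subset_leq_card A1A.
  have a1n : (#|A1| <= n)%N by have := max_card (mem A1); rewrite cX.
  have SR (S Q : {set 'I_n}) : S \subset A1 -> Q \subset B1 -> (#|A1| < #|S| + #|Q|)%N ->
      (c * minn #|S| #|Q| <= #|bip_edges (adj G0) S Q|)%N.
    move=> SA QB SQ; rewrite -(ler_nat R) natrM.
    apply: le_trans (regular A1A B1B cA1 _ SA QB SQ); first by rewrite ler_wpM2r.
    by apply: le_trans r_rho; rewrite ler_nat; move: A1r; clear; lia.
  have c_le : (2 * c <= #|A1|.+1)%N by move: c_a0 A1r; clear; lia.
  have x0 : 'I_n by exists 0%N.
  have kk0 : 'I_n.-1 by exists 0%N; move: n_ge3; clear; lia.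
  have z_ge0 : 0 <= (1 - s) ^+ c by rewrite exprn_ge0 // subr_ge0; case/andP: s01.
  have small' : 4 * ((1 + #|A1|%:R * (1 - s) ^+ c) ^+ #|A1| - 1) <= 1.
    apply: le_trans small; rewrite ler_wpM2l // lerB //.
    apply: (@le_trans _ _ ((1 + n%:R * (1 - s) ^+ c) ^+ #|A1|)).
      rewrite lerXn2r ?nnegrE ?addr_ge0 ?mulr_ge0 //.
      by rewrite lerD2l ler_wpM2r // ler_nat.
    by rewrite ler_weXn2l // lerDl mulr_ge0.
  have dis1 : [disjoint A1 & B1] by apply: disjointWl A1A (disjointWr B1B disAB).
  have q_AB (z u : 'I_n) (col : 'I_n.-1) : z \in A1 -> u \in B1 -> adj G0 z u -> col \in K1 -> p0 <= q ([set z; u], col).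
    by move=> _ _ zu _; apply: q_edge.
  have := @rainbow_pm_rounds R _ _ (adj G0) A1 B1 K1 #|A1| c x0 kk0 erefl (esym cA1) cK1 dis1 SR c_le
    q p0 s y t q01 p0_gt0 s01 y_ge1 q_AB small'.
  (* A1 depends on W0, so its size is replaced by n in the error term. *)
  move=> bound; apply: (@le_trans _ _ _ _ _ _ (le_trans bound _)).
    rewrite /E1 opprD addrA lerB // lerB // ler_wpM2r ?invr_ge0 ?mulr_ge0 ?exprn_ge0 ?invr_ge0 ?(ltW y_gt0) //.
    by rewrite ler_weXn2l // lerDl mulr_ge0 // ltW.
  apply: ler_sum => W1 _; rewrite ler_wpM2l ?bern_ge0 //.
  apply: ler_sum_subset => [W2 _|W2 /emb[S SC SW]]; first exact: bern_ge0.
  by apply/existsP; exists S; rewrite SC -setUA.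
apply: le_trans (perturbed_three_rounds T G0 K_gt0 p01).
apply: (@le_trans _ _ (\sum_(W0 | good W0) bern q W0 * (1 - E1))).
  rewrite -mulr_suml.
  have sle1 : \sum_(W0 | good W0) bern q W0 <= 1.
    by rewrite -(bern_sum q); apply: ler_sum_subset => // W _; apply: bern_ge0.
  exact: prod_error_ge.
apply: (@le_trans _ _ (\sum_(W0 | good W0) bern q W0 * \sum_W1 bern q W1 *
   \sum_(W2 : {set {set 'I_n} * 'I_n.-1} | [exists S : {set {set 'I_n} * 'I_n.-1},
      rainbow_copy_set T S && (S \subset W0 :|: W1 :|: W2)]) bern q W2)).
  by apply: ler_sum => W0 gW; rewrite ler_wpM2l ?bern_ge0 // inner.
apply: ler_sum_subset => // W0 _; rewrite mulr_ge0 ?bern_ge0 //; apply: sumr_ge0 => W1 _.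
by rewrite mulr_ge0 ?bern_ge0 //; apply: sumr_ge0 => W2 _; apply: bern_ge0.
Qed.

End FiniteBound.

(** * Asymptotics *)

From mathcomp Require Import all_classical all_reals all_analysis.
Import numFieldNormedType.Exports.

Section ExpEstimates.
Local Open Scope ring_scope.
Variable R : realType.
Implicit Types (z u theta : R) (n k t : nat).

Lemma expr1B_le z k : 0 <= z <= 1 -> (1 - z) ^+ k <= expR (- (k%:R * z)).
Proof.
move=> /andP[z0 z1]; rewrite -mulrN expRM_natl lerXn2r ?nnegrE ?expR_ge0 ?subr_ge0 //.
exact: expR_ge1Dx.
Qed.

Lemma expr1D_le z k : 0 <= z -> (1 + z) ^+ k <= expR (k%:R * z).
Proof.
move=> z0; rewrite expRM_natl lerXn2r ?nnegrE ?expR_ge0 ?addr_ge0 //.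
exact: expR_ge1Dx.
Qed.

Lemma expR_le_lin z : 0 <= z <= 1 / 2 -> expR z <= 1 + 2 * z.
Proof.
move=> /andP[z0 z1]; have e0 : 0 < expR z by apply: expR_gt0.
have : 1 - z <= (expR z)^-1 by rewrite -expRN; apply: expR_ge1Dx.
rewrite -(ler_pM2l e0) divff ?gt_eqF // => h; nra.
Qed.

(** The Taylor term of order k + 1 of the exponential already beats z^k. *)
Lemma poly_exp_decay (k : nat) theta (ep : R) : 0 < theta -> 0 < ep ->
  exists2 B, 0 < B & forall z, B <= z -> z ^+ k * expR (- (theta * z)) <= ep.
Proof.
move=> th0 ep0; pose c : R := k.+1`!%:R; have c0 : 0 < c by rewrite ltr0n fact_gt0.
exists (c / (theta ^+ k.+1 * ep)); first by rewrite divr_gt0 // mulr_gt0 // exprn_gt0.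
move=> z Bz; have z0 : 0 < z by apply: lt_le_trans Bz; rewrite divr_gt0 // mulr_gt0 // exprn_gt0.
have tz : 0 <= theta * z by rewrite mulr_ge0 // ltW.
have := expR_ge1Dxn k tz => h.
have h2 : (theta * z) ^+ k.+1 / c <= expR (theta * z) by apply: le_trans h; rewrite lerDr.
rewrite expRN ler_pdivrMr ?expR_gt0 //; apply: le_trans (ler_wpM2l (ltW ep0) h2).
rewrite exprMn exprSr [z ^+ k.+1]exprSr.
have -> : ep * (theta ^+ k * theta * (z ^+ k * z) / c) = z ^+ k * (z / (c / (theta ^+ k.+1 * ep))).
  by rewrite exprSr; field; rewrite !gt_eqF // exprn_gt0.
rewrite ler_peMr ?exprn_ge0 ?(ltW z0) // ler_pdivlMr ?mul1r //.
by rewrite divr_gt0 // mulr_gt0 // exprn_gt0.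
Qed.

Lemma dense_error (n e : nat) (P : R) : 0 <= P <= 1 -> 4 * n%:R <= P * (e * e * e)%:R ->
  2 ^+ (n + n + n.-1) * (1 - P) ^+ (e * e * e) <= expR (- n%:R).
Proof.
move=> P01 big.
have two : 2 <= expR 1 :> R by have := @expR_ge1Dx R 1; lra.
apply: (@le_trans _ _ (expR (3 * n%:R) * expR (- ((e * e * e)%:R * P)))).
  apply: ler_pM; rewrite ?exprn_ge0 ?subr_ge0 ?expr1B_le //; first by case/andP: P01.
  apply: (@le_trans _ _ (expR 1 ^+ (n + n + n.-1))); first by rewrite lerXn2r ?nnegrE ?expR_ge0.
  rewrite -expRM_natl mulr1 ler_expR -natrM ler_nat; lia.
by rewrite -expRD ler_expR; lra.
Qed.

(** With x = theta / 8, either count of small sets is at most exp(theta n / 4): one half of the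
    exponent comes from (1 + x)^n, the other from x^-r <= exp(r / x). Avoidance has probability at
    most exp(-theta n), which leaves exp(-theta n / 2). *)
Lemma reserve_error (n r a b : nat) (theta : R) : (1 < n)%N -> 0 < theta <= 1 ->
    r%:R <= theta ^+ 2 / 64 * n%:R -> theta * n%:R * (3 * n%:R) <= (a * b)%:R ->
  n%:R * ((1 + theta / 8) ^+ n / (theta / 8) ^+ r * ((1 + theta / 8) ^+ n.-1 / (theta / 8) ^+ r)) *
    (1 - (3 * n.-1%:R)^-1) ^+ (a * b) <= n%:R * expR (- (theta / 2 * n%:R)).
Proof.
move=> n1 /andP[th0 th1] rle ab; set x := theta / 8.
have x0 : 0 < x by rewrite divr_gt0.
have N0 : 0 < n%:R :> R by rewrite ltr0n; lia.
have k1 : 1 <= n.-1%:R :> R by rewrite ler1n; lia.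
have kn : n.-1%:R <= n%:R :> R by rewrite ler_nat leq_pred.
have powx m : (m <= n)%N -> (1 + x) ^+ m / x ^+ r <= expR (x * n%:R + r%:R / x).
  move=> mn; rewrite expRD; apply: ler_pM; rewrite ?invr_ge0 ?exprn_ge0 ?addr_ge0 ?(ltW x0) //.
    apply: (le_trans (expr1D_le m (ltW x0))); rewrite ler_expR mulrC ler_wpM2l ?(ltW x0) //.
    by rewrite ler_nat.
  rewrite -exprVn expRM_natl lerXn2r ?nnegrE ?expR_ge0 ?invr_ge0 ?(ltW x0) //.
  by apply: le_trans (expR_ge1Dx _); rewrite lerDr.
have rx : r%:R / x <= theta / 8 * n%:R.
  rewrite ler_pdivrMr // /x; apply: (le_trans rle).
  by rewrite le_eqVlt; apply/orP; left; apply/eqP; field.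
have p_0 : 0 < (3 * n.-1%:R)^-1 :> R by rewrite invr_gt0; lra.
have p_1 : (3 * n.-1%:R)^-1 <= 1 :> R by rewrite invf_le1; lra.
have pab : theta * n%:R <= (a * b)%:R * (3 * n.-1%:R)^-1.
  rewrite ler_pdivlMr; last by lra.
  apply: le_trans ab; rewrite ler_wpM2l ?mulr_ge0 ?(ltW N0) ?(ltW th0) //; lra.
rewrite -mulrA ler_wpM2l ?(ltW N0) //.
apply: (@le_trans _ _ (expR (x * n%:R + r%:R / x) * expR (x * n%:R + r%:R / x) * expR (- ((a * b)%:R * (3 * n.-1%:R)^-1)))).
  have pge m : 0 <= (1 + x) ^+ m / x ^+ r.
    by rewrite divr_ge0 // exprn_ge0 // ?addr_ge0 // ltW.
  apply: ler_pM; [exact: mulr_ge0 | by rewrite exprn_ge0 ?subr_ge0 | |].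
    by apply: ler_pM; rewrite ?pge ?powx // leq_pred.
  by rewrite expr1B_le // (ltW p_0).
rewrite -!expRD ler_expR /x; move: rx pab; rewrite /x; lra.
Qed.

(** This is the ratio q / p0 of the two-round argument, with q = s^2 and s = u / n. *)
Lemma density_ratio n u : (1 < n)%N -> 0 < u ->
  0 <= (u / n%:R) ^+ 2 / (3 * n.-1%:R)^-1 /\
  (u / n%:R) ^+ 2 / (3 * n.-1%:R)^-1 <= 3 * u ^+ 2 / n%:R.
Proof.
move=> n1 u0; have N0 : 0 < n%:R :> R by rewrite ltr0n; lia.
have kn : n.-1%:R <= n%:R :> R by rewrite ler_nat leq_pred.
have k0 : 0 <= n.-1%:R :> R by apply: ler0n.
split.
  by rewrite invrK mulr_ge0 ?exprn_ge0 ?mulr_ge0 ?invr_ge0 // ltW.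
rewrite invrK; have -> : 3 * u ^+ 2 / n%:R = (u / n%:R) ^+ 2 * (3 * n%:R) by field; rewrite gt_eqF.
by rewrite ler_wpM2l ?exprn_ge0 ?mulr_ge0 ?invr_ge0 ?(ltW u0) ?(ltW N0) //; lra.
Qed.

(** Here y is Euler's number e: the numerator is at most exp(3 e u^2), and t >= (3 e + 1) u^2 leaves
    exp(-u^2). *)
Lemma matching_error1 (n t : nat) u : (1 < n)%N -> 0 < u ->
    (3 * expR 1 + 1) * u ^+ 2 <= t%:R ->
  (1 + expR 1 * ((u / n%:R) ^+ 2 / (3 * n.-1%:R)^-1)) ^+ n / (expR 1 ^+ t * 8^-1) <=
  8 * expR (- u ^+ 2).
Proof.
move=> n1 u0 tu; have N0 : 0 < n%:R :> R by rewrite ltr0n; lia.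
have e0 := @expR_gt0 R 1; have [q0 qle] := density_ratio n1 u0.
rewrite ler_pdivrMr; last by rewrite mulr_gt0 ?exprn_gt0 // invr_gt0.
apply: (le_trans (expr1D_le n (mulr_ge0 (ltW e0) q0))).
have -> : 8 * expR (- u ^+ 2) * (expR 1 ^+ t * 8^-1) = expR (t%:R - u ^+ 2).
  by rewrite -expRM_natl mulr1 expRD; field.
rewrite ler_expR.
apply: (@le_trans _ _ (n%:R * (expR 1 * (3 * u ^+ 2 / n%:R)))).
  by rewrite ler_wpM2l ?(ltW N0) // ler_wpM2l ?(ltW e0).
have -> : n%:R * (expR 1 * (3 * u ^+ 2 / n%:R)) = 3 * expR 1 * u ^+ 2 by field; rewrite gt_eqF.
lra.
Qed.

(** With n = u^8, the product of t and q / p0 is of order u^2 * u^2 / u^8 = u^-4. The constant 384 =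
    64 * 2 * 3 comes from M0 = 1/8, from exp z <= 1 + 2 z and from the 3 in p0. *)
Lemma matching_error2 (n t : nat) u (c : R) : (1 < n)%N -> 0 < u -> u ^+ 8 = n%:R ->
    t%:R <= c * u ^+ 2 -> 0 <= c -> 6 * c <= u ^+ 4 ->
  ((1 + (u / n%:R) ^+ 2 / (3 * n.-1%:R)^-1) ^+ t - 1) / 8^-1 ^+ 2 <= 384 * c / u ^+ 4.
Proof.
move=> n1 u0 un tc c0 cu; have N0 : 0 < n%:R :> R by rewrite ltr0n; lia.
have [q0 qle] := density_ratio n1 u0.
have u4 : 0 < u ^+ 4 by rewrite exprn_gt0.
have tq : t%:R * ((u / n%:R) ^+ 2 / (3 * n.-1%:R)^-1) <= 3 * c / u ^+ 4.
  apply: (@le_trans _ _ (c * u ^+ 2 * (3 * u ^+ 2 / n%:R))).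
    by apply: ler_pM.
  rewrite -un; have -> : c * u ^+ 2 * (3 * u ^+ 2 / u ^+ 8) = 3 * c / u ^+ 4; last by [].
  by field; rewrite gt_eqF.
have c4 : 0 <= 3 * c / u ^+ 4 <= 1 / 2.
  apply/andP; split; first by apply: divr_ge0; [apply: mulr_ge0 | apply: ltW].
  by rewrite ler_pdivrMr //; lra.
have := le_trans (expr1D_le t q0) (_ : _ <= expR (3 * c / u ^+ 4)); rewrite ler_expR => /(_ tq) h.
have h2 := le_trans h (expR_le_lin c4).
have -> : 8^-1 ^+ 2 = 64^-1 :> R by field.
rewrite [64^-1^-1]invrK -ler_pdivlMr //.
apply: (@le_trans _ _ (2 * (3 * c / u ^+ 4))); first by rewrite lerBlDl.
by rewrite le_eqVlt; apply/orP; left; apply/eqP; field; rewrite gt_eqF.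
Qed.

Lemma hall_error (n c : nat) (s z : R) : 0 <= s <= 1 -> z <= c%:R * s ->
  n%:R ^+ 2 * expR (- z) <= 8^-1 ->
  4 * ((1 + n%:R * (1 - s) ^+ c) ^+ n - 1) <= 1.
Proof.
move=> s01 zc sm; have N0 : 0 <= n%:R :> R by apply: ler0n.
have pw : (1 - s) ^+ c <= expR (- z).
  by apply: (le_trans (expr1B_le c s01)); rewrite ler_expR lerN2.
have pw0 : 0 <= (1 - s) ^+ c by rewrite exprn_ge0 // subr_ge0; case/andP: s01.
have := expr1D_le n (mulr_ge0 N0 pw0).
have le8 : n%:R * (n%:R * (1 - s) ^+ c) <= 8^-1.
  by apply: le_trans sm; rewrite mulrA -expr2 ler_wpM2l ?exprn_ge0.
have ge0 : 0 <= n%:R * (n%:R * (1 - s) ^+ c) by rewrite !mulr_ge0.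
have := @expR_le_lin (n%:R * (n%:R * (1 - s) ^+ c)); rewrite ge0 /=.
have -> : n%:R * (n%:R * (1 - s) ^+ c) <= 1 / 2 by lra.
move=> /(_ isT); lra.
Qed.

Lemma partition_error (n L w h : nat) (om : R) : (0 < L)%N -> w%:R <= om * n%:R ->
    2 * om * n%:R <= h%:R / (2 * L%:R) ->
  2 ^+ w * (1 - (2 * L%:R)^-1) ^+ h <= expR (- (om * n%:R)).
Proof.
move=> L0 wo ho; have LR : 1 <= L%:R :> R by rewrite ler1n.
have two : 2 <= expR 1 :> R by have := @expR_ge1Dx R 1; lra.
have i0 : 0 <= (2 * L%:R)^-1 :> R by rewrite invr_ge0; lra.
have i1 : (2 * L%:R)^-1 <= 1 :> R by rewrite invf_le1; lra.
apply: (@le_trans _ _ (expR w%:R * expR (- (h%:R * (2 * L%:R)^-1)))).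
  apply: ler_pM; rewrite ?exprn_ge0 ?subr_ge0 // ?expr1B_le ?i0 //.
  by rewrite -[w%:R]mulr1 expRM_natl lerXn2r ?nnegrE ?expR_ge0.
by rewrite -expRD ler_expR; move: ho; set v := h%:R * _; lra.
Qed.

End ExpEstimates.

(** * Choice of the constants and passage to the limit *)

Local Open Scope ring_scope.

Lemma truncn_half (R : realType) (z : R) : 2 <= z -> (Num.truncn z)%:R <= z /\ z / 2 <= (Num.truncn z)%:R.
Proof.
move=> z2; have z0 : 0 <= z by lra.
have /andP[lo hi] := truncn_itv z0; split=> //.
by move: hi; rewrite -natr1; lra.
Qed.

(** The scale u = s * n must exceed log n for Hall's condition and stay below n^(1/4) for the second
    moment; n^(1/8) lies between the two and is three nested square roots. *)
Lemma eighth_root (R : realType) (z B : R) : 0 <= z -> 0 <= B -> B ^+ 8 <= z ->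
  exists u : R, [/\ 0 <= u, u ^+ 8 = z & B <= u].
Proof.
move=> z0 B0 Bz; pose u := Num.sqrt (Num.sqrt (Num.sqrt z)).
have u8 : u ^+ 8 = z.
  by rewrite (exprM _ 2 4) sqr_sqrtr ?sqrtr_ge0 // (exprM _ 2 2) sqr_sqrtr ?sqrtr_ge0 // sqr_sqrtr.
exists u; split=> //; first exact: sqrtr_ge0.
by rewrite -(@ler_pXn2r _ 8) ?nnegrE ?sqrtr_ge0 // u8.
Qed.

(** All sizes are fractions of n: [mu] for m, [al] for the starting pair, [a1] for |A0| from below,
    [om] for w, [cc] for r and [sg] for e, while [th] measures a * b against 3 n^2. The equations
    serve to cancel d and L exactly. *)
Lemma density_constants (R : realType) (zeta delta be rho : R) (d : nat) :
    0 < zeta < 1 -> 0 < delta < 1 -> (2 <= d)%N -> 0 < be -> 0 < rho <= 1 ->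
  exists (mu al a1 rh om th cc sg : R) (L : nat),
  [/\ [/\ 0 < mu, mu * d%:R = zeta & mu <= 1],
      [/\ 0 < al, al <= delta / 32 & al <= mu / 16],
      [/\ 0 < a1, 2 * a1 <= be * al & a1 <= al / 2],
      [/\ 0 < rh, rh <= 1 / 4 & rh <= rho] &
   [/\ [/\ (4 <= L)%N, 64 <= L%:R * mu, 0 < om & 16 * (om * L%:R) = delta],
       [/\ 0 < th <= 1, th * 768 = om * a1 & om <= delta],
       [/\ 0 < cc, cc <= th ^+ 2 / 64, cc <= rh * a1 & cc <= om / 4],
       cc <= a1 / 16 &
       [/\ 0 < sg, 16 * (d%:R * sg) = cc & sg <= cc / 32]]].
Proof.
move=> /andP[ze0 ze1] /andP[de0 de1] d2 be0 /andP[rho0 rho1].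
have dR : 2 <= d%:R :> R by rewrite ler_nat.
have d0 : 0 < d%:R :> R by move: dR; clear; lra.
have [mu muE] : exists mu : R, mu = zeta / d%:R by eexists.
have mu0 : 0 < mu by rewrite muE divr_gt0.
have mu1 : mu <= 1 by rewrite muE ler_pdivrMr //; move: ze1 dR; clear; lra.
have mud : mu * d%:R = zeta by rewrite muE divfK // gt_eqF.
have [al alE] : exists al : R, al = delta * mu / 32 by eexists.
have al0 : 0 < al by rewrite alE; apply: divr_gt0; rewrite ?mulr_gt0 ?ltr0n.
have al_de : al <= delta / 32 by rewrite alE ler_wpM2r ?invr_ge0 ?ler0n // ler_piMr // ltW.
have al_mu : al <= mu / 16.
  apply: (@le_trans _ _ (mu / 32)); last by move: mu0; clear; lra.
  by rewrite alE ler_wpM2r ?invr_ge0 ?ler0n // ler_piMl // ltW.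
(* A positive number below both [be] and 1. *)
have [be1 be1E] : exists be1 : R, be1 = be / (1 + be) by eexists.
have b1 : 0 < 1 + be by move: be0; clear; lra.
have be10 : 0 < be1 by rewrite be1E divr_gt0.
have be11 : be1 <= 1 by rewrite be1E ler_pdivrMr //; move: be0; clear; lra.
have be1b : be1 <= be by rewrite be1E ler_pdivrMr // ler_peMr ?(ltW be0) //; move: be0; clear; lra.
have [a1 a1E] : exists a1 : R, a1 = be1 * al / 2 by eexists.
have a10 : 0 < a1 by rewrite a1E divr_gt0 // mulr_gt0.
have a1be : 2 * a1 <= be * al.
  have -> : 2 * a1 = be1 * al by rewrite a1E; field.
  by rewrite ler_wpM2r // ltW.
have a1al : a1 <= al / 2 by rewrite a1E ler_wpM2r ?invr_ge0 // ler_piMl // ltW.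
have [L [L4 Lmu]] : exists L : nat, (4 <= L)%N /\ 64 <= L%:R * mu.
  exists ((Num.truncn (64 / mu)).+1 + 4)%N; split; first by rewrite leq_addl.
  have z0 : 0 <= 64 / mu by apply: divr_ge0; rewrite ?ler0n ?(ltW mu0).
  have /andP[_ hi] := truncn_itv z0.
  by rewrite -ler_pdivrMr //; apply: (le_trans (ltW hi)); rewrite ler_nat leq_addr.
have LR : 4 <= L%:R :> R by rewrite ler_nat.
have L16 : 0 < 16 * L%:R :> R by move: LR; clear; lra.
have [om omE] : exists om : R, om = delta / (16 * L%:R) by eexists.
have om0 : 0 < om by rewrite omE divr_gt0.
have omL : 16 * (om * L%:R) = delta.
  by rewrite mulrCA -[om]/(om) omE divfK // gt_eqF.
have om_de : om <= delta.
  by rewrite omE ler_pdivrMr // ler_peMr ?(ltW de0) //; move: LR; clear; lra.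
have om1 : om <= 1 by move: om_de de1; clear; lra.
have a11 : a1 <= 1 by move: a1al al_mu mu1; clear; lra.
(* 768 = 3 * 8 * 32, because a >= om n / 8 and b >= a1 n / 32 and their product has to reach 3 th
   n^2. *)
have [th thE] : exists th : R, th = om * a1 / 768 by eexists.
have th0 : 0 < th by rewrite thE; apply: divr_gt0; rewrite ?mulr_gt0 ?ltr0n.
have th768 : th * 768 = om * a1 by rewrite thE; apply: divfK; rewrite pnatr_eq0.
have oma_om : om * a1 <= om by rewrite ler_piMr // ltW.
have oma_a1 : om * a1 <= a1 by rewrite ler_piMl // ltW.
have th1 : th <= 1 by move: th768 oma_om om1 th0; clear; lra.
have [cc ccE] : exists cc : R, cc = rho / 4 * th ^+ 2 / 64 by eexists.
have rh0 : 0 < rho / 4 by move: rho0; clear; lra.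
have th20 : 0 < th ^+ 2 by rewrite exprn_gt0.
have th2 : th ^+ 2 <= th by rewrite expr2 ler_piMr ?(ltW th0).
have cc0 : 0 < cc by rewrite ccE; apply: divr_gt0; rewrite ?mulr_gt0 ?ltr0n.
have rt : rho / 4 * th ^+ 2 <= th ^+ 2.
  by rewrite ler_piMl ?(ltW th20) //; move: rho1; clear; lra.
have cc_th2 : cc <= th ^+ 2 / 64 by rewrite ccE; move: rt; clear; lra.
have rt2 : rho / 4 * th ^+ 2 <= rho / 4 * a1.
  rewrite ler_wpM2l ?(ltW rh0) //; move: th2 th768 oma_a1 th0; clear; lra.
have rt0 : 0 < rho / 4 * a1 by rewrite mulr_gt0.
have cc_rha : cc <= rho / 4 * a1 by rewrite ccE; move: rt2 rt0; clear; lra.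
have [sg sgE] : exists sg : R, sg = cc / (16 * d%:R) by eexists.
have d16 : 0 < 16 * d%:R :> R by move: dR; clear; lra.
have sg0 : 0 < sg by rewrite sgE divr_gt0.
have sgd : 16 * (d%:R * sg) = cc by rewrite mulrA mulrC sgE divfK // gt_eqF.
have sgcc : sg <= cc / 32.
  have : 2 * sg <= d%:R * sg by rewrite ler_wpM2r // ltW.
  by move: sgd; clear; lra.
exists mu, al, a1, (rho / 4), om, th, cc, sg, L; split; first by split.
- by split.
- by split.
- by split=> //; move: rho0 rho1; clear; lra.
split; first by split.
- by rewrite th0.
- by split=> //; move: cc_th2 th2 th768 oma_om th0; clear; lra.
- by move: cc_th2 th2 th768 oma_a1 th0; clear; lra.
- by split.
Qed.

(** The threshold B is chosen before V, T and G0: a single sequence of lower bounds, valid for all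
    trees and all G0, requires this uniformity. *)
Lemma rainbow_eventually (R : realType) (zeta delta : R) (d : nat) :
    0 < zeta < 1 -> 0 < delta < 1 -> (2 <= d)%N ->
  exists2 C0 : R, 0 < C0 & forall C : R, C0 <= C -> forall ep : R, 0 < ep ->
  exists B : R, forall (n : nat) (V : finType) (T : sgraph V) (G0 : sgraph 'I_n),
    B <= n%:R -> #|V| = n -> is_tree T -> (forall v : V, (deg T v <= d)%N) ->
    zeta * n%:R <= #|leaves T|%:R ->
    (forall v : 'I_n, delta * n%:R <= (deg G0 v)%:R) ->
    1 - ep <= prob_rainbow_copy T G0 (Num.min 1 (C / n%:R)).
Proof.
move=> ze01 de01 d2; have /andP[de0 de1] := de01.
have d_gt0 : (0 < d)%N by apply: leq_trans d2.
have [be [rho [be0 rho0 rho1 regp]]] := @regular_pair R delta ltac:(by rewrite de0 ltW).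
have rho01 : 0 < rho <= 1 by rewrite rho0.
have [mu [al [a1 [rh [om [th [cc [sg [L [[mu0 mud mu1] [al0 al_de al_mu] [a10 a1be a1al] [rh0 rh1 rh_rho]
  [[L4 Lmu om0 omL] [th01 th768 om_de] [cc0 cc_th2 cc_rha cc_om] cc_a1 [sg0 sgd sgcc]]]]]]]]]]]] :=
  density_constants ze01 de01 d2 be0 rho01.
have /andP[th0 th1] := th01.
have [ga gaE] : exists ga : R, ga = rh * a1 / 2 by eexists.
have ga0 : 0 < ga by rewrite gaE divr_gt0 // mulr_gt0.
have e1_0 := @expR_gt0 R 1.
(* One more than the 3 e + 1 of [matching_error1], as rounding up to the integer t costs at most 1
   <= u^2. *)
have [k2 k2E] : exists k2 : R, k2 = 3 * expR 1 + 2 by eexists.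
have k20 : 0 < k2 by move: k2E e1_0; clear; lra.
have sg3 : 0 < sg ^+ 3 by rewrite exprn_gt0.
have C0_gt0 : 0 < 96 / sg ^+ 3 by apply: divr_gt0; rewrite ?ltr0n.
(* [dense_error] asks for C / (3 n^2) * (sg n / 2)^3 >= 4 n, that is C * sg^3 >= 96. *)
exists (96 / sg ^+ 3) => // C CC0 ep ep0.
have LR : 4 <= L%:R :> R by rewrite ler_nat.
have L0 : 0 < (2 * L%:R)^-1 :> R by rewrite invr_gt0; move: LR; clear; lra.
have th2_0 : 0 < th / 2 by move: th0; clear; lra.
have ep16 : 0 < ep / 16 by move: ep0; clear; lra.
have ep64 : 0 < ep / 64 by move: ep0; clear; lra.
have i8 : 0 < 8^-1 :> R by rewrite invr_gt0 ltr0n.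
have [B1 B10 dec1] := poly_exp_decay 1 om0 L0.
have [B2 B20 dec2] := poly_exp_decay 1 th2_0 ep16.
have [B3 B30 dec3] := poly_exp_decay 0 (ltr01 : 0 < (1 : R)) ep64.
(* The exponent 16 stems from n^2 = u^16 in [hall_error]. *)
have [B5 B50 dec5] := poly_exp_decay 16 ga0 i8.
have [kq kqE] : exists kq : R, kq = 384 * k2 / (ep / 8) by eexists.
have kq0 : 0 < kq by rewrite kqE; apply: divr_gt0; [rewrite mulr_gt0 ?ltr0n | move: ep0; clear; lra].
have [B6 B6E] : exists B6 : R, B6 = 1 + B3 + B5 + kq + 6 * k2 by eexists.
have B60 : 0 <= B6 by move: B6E B30 B50 kq0 k20; clear; lra.
have C0' : 0 < C by apply: lt_le_trans CC0.
exists (3 + C + 2 / sg + B1 + B2 + B3 + B6 ^+ 8).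
move=> n V T G0 Bn cV T_tree degT leavesT degG.
have sg2 : 0 < 2 / sg by rewrite divr_gt0.
have B68 : 0 <= B6 ^+ 8 by rewrite exprn_ge0.
set N : R := n%:R in Bn leavesT degG *.
have N3 : 3 <= N by move: Bn C0' sg2 B10 B20 B30 B68; clear; lra.
have NC : C <= N by move: Bn C0' sg2 B10 B20 B30 B68; clear; lra.
have N0 : 0 < N by move: N3; clear; lra.
have Nsg : 2 <= sg * N by rewrite mulrC -ler_pdivrMr //; move: Bn C0' sg2 B10 B20 B30 B68; clear; lra.
have NB1 : B1 <= N by move: Bn C0' sg2 B10 B20 B30 B68; clear; lra.
have NB2 : B2 <= N by move: Bn C0' sg2 B10 B20 B30 B68; clear; lra.
have NB3 : B3 <= N by move: Bn C0' sg2 B10 B20 B30 B68; clear; lra.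
have NB6 : B6 ^+ 8 <= N by move: Bn C0' sg2 B10 B20 B30 B68; clear; lra.
have scale (x y : R) : x <= y -> x * N <= y * N by move=> h; rewrite ler_wpM2r // ltW.
(* Sizes are truncated multiples of n; if the multiple is at least 2, truncation loses at most half
   of it. *)
have big (ka : R) : sg <= ka -> 2 <= ka * N by move=> h; apply: le_trans Nsg (scale _ _ h).
have n3 : (2 < n)%N by rewrite -(ltr_nat R) -/N; move: N3; clear; lra.
have n1 : (1 < n)%N by apply: ltnW.
have [u [u_ge0 u8 uB6]] := eighth_root (ltW N0) B60 NB6.
have u1 : 1 <= u by move: uB6 B6E B30 B50 kq0 k20; clear; lra.
have u0 : 0 < u by move: u1; clear; lra.
have sg_cc : sg <= cc by move: sgcc cc0; clear; lra.
have [m_hi m_lo] := truncn_half (big mu ltac:(move: sgcc cc_a1 a1al al_mu mu0 al0 cc0; clear; lra)).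
set m := Num.truncn (mu * N) in m_hi m_lo.
have [k0_hi k0_lo] := truncn_half (big al ltac:(move: sgcc cc_a1 a1al al0 cc0; clear; lra)).
set k0 := Num.truncn (al * N) in k0_hi k0_lo.
have [h_hi h_lo] := truncn_half (big (delta / 2) ltac:(move: sgcc cc_om om_de cc0 de0; clear; lra)).
set h := Num.truncn (delta / 2 * N) in h_hi h_lo.
have [w_hi w_lo] := truncn_half (big om ltac:(move: sgcc cc_om cc0 om0; clear; lra)).
set w := Num.truncn (om * N) in w_hi w_lo.
have [kf_hi kf_lo] := truncn_half (big (a1 / 4) ltac:(move: sgcc cc_a1 cc0 a10; clear; lra)).
set kf := Num.truncn (a1 / 4 * N) in kf_hi kf_lo.
have [r_hi r_lo] := truncn_half (big cc sg_cc).
set r := Num.truncn (cc * N) in r_hi r_lo.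
have [a_hi a_lo] := truncn_half (big (om / 4) ltac:(move: sgcc cc_om cc0; clear; lra)).
set a := Num.truncn (om / 4 * N) in a_hi a_lo.
have [b_hi b_lo] := truncn_half (big (a1 / 16) ltac:(move: sgcc cc_a1 cc0; clear; lra)).
set b := Num.truncn (a1 / 16 * N) in b_hi b_lo.
have [e_hi e_lo] := truncn_half Nsg.
set e := Num.truncn (sg * N) in e_hi e_lo.
have cX : #|'I_n| = n by rewrite card_ord.
have alN0 : 0 < al * N by rewrite mulr_gt0.
have k0_gt0 : (0 < k0)%N by rewrite -(ltr0n R); move: k0_lo alN0; clear; lra.
have sc1 := scale _ _ al_de; have sc2 := scale _ _ al_mu; have sc3 := scale _ _ a1al.
have sc4 := scale _ _ cc_om; have sc5 := scale _ _ cc_a1; have sc6 := scale _ _ sgcc.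
have sc7 := scale _ _ cc_rha; have sc8 := scale _ _ a1be; have sc9 := scale _ _ Lmu.
have a1N0 : 0 < a1 * N by rewrite mulr_gt0.
have muN0 : 0 < mu * N by rewrite mulr_gt0.
have deN0 : 0 < delta * N by rewrite mulr_gt0.
have ccN0 : 0 < cc * N by rewrite mulr_gt0.
have k0de : 2 * k0%:R <= delta * #|'I_n|%:R.
  by rewrite cX -/N; move: k0_hi sc1 deN0; clear; lra.
have degG' v : delta * #|'I_n|%:R <= #|[set y | adj G0 v y]|%:R by rewrite cX; apply: degG.
have [A0 [B0 [disAB cAB A0k0 A0be reg]]] := regp 'I_n (adj G0) k0 (adj_sym G0) k0_gt0 k0de degG'.
have [q0 q0E] : exists q0 : R, q0 = #|A0|%:R by eexists.
have q0_hi : q0 <= al * N.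
  by apply: le_trans k0_hi; rewrite q0E ler_nat.
have q0_lo : a1 * N <= q0.
  have h1 : be * (al * N / 2) <= be * k0%:R by rewrite ler_wpM2l // ltW.
  by move: h1 A0be sc8; rewrite -q0E; clear; lra.
have q00 : 0 < q0 by move: q0_lo a1N0; clear; lra.
have leaves' : (d * m <= #|leaves T|)%N.
  rewrite -(ler_nat R) natrM; apply: le_trans leavesT; rewrite -mud.
  have : d%:R * m%:R <= d%:R * (mu * N) by rewrite ler_wpM2l.
  by clear; lra.
have m_gt0 : (0 < m)%N by rewrite -(ltr0n R); move: m_lo muN0; clear; lra.
have pE : Num.min 1 (C / N) = C / N by rewrite min_r // ler_pdivrMr // mul1r.
have p_ge0 : 0 <= C / N by rewrite divr_ge0 // ltW.
have p_le1 : C / N <= 1 by rewrite ler_pdivrMr // mul1r.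
have uN : u <= N by rewrite -u8 exprS ler_peMr // exprn_ege1.
have s01 : 0 <= u / N <= 1 by rewrite divr_ge0 ?(ltW N0) //= ler_pdivrMr // mul1r.
have x01 : 0 < th / 8 <= 1 by move: th0 th1; clear; lra.
have y1 : 1 <= expR 1 :> R by have := @expR_ge1Dx R 1; clear; lra.
have reg' (Aa Bb S Q : {set 'I_n}) : Aa \subset A0 -> Bb \subset B0 -> #|Aa| = #|Bb| ->
    (#|A0| - #|Aa|)%:R <= rh * #|A0|%:R -> S \subset Aa -> Q \subset Bb ->
    (#|Aa| < #|S| + #|Q|)%N ->
    rh * #|A0|%:R * (minn #|S| #|Q|)%:R <= #|bip_edges (adj G0) S Q|%:R.
  have le : rh * #|A0|%:R <= rho * #|A0|%:R by rewrite ler_wpM2r.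
  move=> AaA BbB cc1 Aar SA QB SQ.
  apply: le_trans (reg _ _ _ _ AaA BbB cc1 (le_trans Aar le) SA QB SQ).
  by rewrite ler_wpM2r.
have hN v : (h <= #|[set z | adj G0 v z] :\: (A0 :|: B0)|)%N.
  set nb := [set z | adj G0 v z].
  have cI : (#|nb :&: (A0 :|: B0)| <= 2 * #|A0|)%N.
    apply: leq_trans (subset_leq_card (subsetIr _ _)) _; apply: leq_trans (leq_card_setU _ _) _.
    by rewrite -cAB mul2n addnn.
  have cS : #|nb|%:R = #|nb :&: (A0 :|: B0)|%:R + #|nb :\: (A0 :|: B0)|%:R :> R.
    by rewrite -natrD cardsID.
  have cI' : #|nb :&: (A0 :|: B0)|%:R <= 2 * q0 by rewrite q0E -natrM ler_nat.
  rewrite -(ler_nat R); have := degG v; rewrite -[deg G0 v]/#|nb| cS.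
  by move: cI' h_hi q0_hi sc1 deN0; clear; lra.
have part_ok : N * L%:R * (2 ^+ w * (1 - (2 * L%:R)^-1) ^+ h) < 1.
  have Lpos : (0 < L)%N by apply: leq_trans L4.
  have ho : 2 * om * N <= h%:R / (2 * L%:R).
    rewrite ler_pdivlMr; last by move: LR; clear; lra.
    have -> : 2 * om * N * (2 * L%:R) = 16 * (om * L%:R) * N / 4 by field.
    by rewrite omL; move: h_lo; clear; lra.
  have pe := partition_error Lpos w_hi ho.
  have := dec1 N NB1; rewrite expr1 => d1.
  apply: (@le_lt_trans _ _ (L%:R * (N * expR (- (om * N))))).
    rewrite [N * L%:R]mulrC -mulrA ler_wpM2l ?ler0n // ler_wpM2l ?(ltW N0) //.
  apply: (@le_lt_trans _ _ (L%:R * (2 * L%:R)^-1)); first by rewrite ler_wpM2l ?ler0n.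
  have -> : L%:R * (2 * L%:R)^-1 = 2^-1 :> R by field; rewrite gt_eqF //; move: LR; clear; lra.
  by clear; lra.
have a0m : (4 * #|A0| <= m)%N.
  by rewrite -(ler_nat R) natrM -q0E; move: q0_hi sc2 m_lo muN0; clear; lra.
have Lm : (8 * n <= L * m)%N.
  rewrite -(ler_nat R) !natrM -/N.
  have : L%:R * (mu * N / 2) <= L%:R * m%:R by rewrite ler_wpM2l.
  by move: sc9 N0; clear; lra.
have em : (8 * e <= m)%N.
  by rewrite -(ler_nat R) natrM; move: e_hi sc6 sc5 sc3 sc2 m_lo muN0 a1N0 alN0 ccN0; clear; lra.
have kfa : (kf + r + e <= #|A0|)%N.
  rewrite -(ler_nat R) !natrD -q0E; move: kf_hi r_hi e_hi q0_lo sc5 sc6 a1N0 ccN0; clear; lra.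
have e_gt0 : (0 < e)%N by rewrite -(ltr0n R); move: e_lo Nsg; clear; lra.
have er : (8 * (d * e) <= r)%N.
  rewrite -(ler_nat R) !natrM.
  have h1 : d%:R * e%:R <= d%:R * (sg * N) by rewrite ler_wpM2l.
  have h2 : 16 * (d%:R * (sg * N)) = cc * N by rewrite -sgd; ring.
  by move: h1 h2 r_lo; clear; lra.
have arw : (a + r <= w)%N.
  by rewrite -(ler_nat R) natrD; move: a_hi r_hi w_lo sc4; clear; lra.
have brk : (b + r <= kf)%N.
  by rewrite -(ler_nat R) natrD; move: b_hi r_hi kf_lo sc5; clear; lra.
have rq : rh * (a1 * N) <= rh * q0 by rewrite ler_wpM2l // ltW.
have r_rho : r%:R <= rh * #|A0|%:R.
  by rewrite -q0E; move: r_hi sc7 rq; clear; lra.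
have rq2 : 2 <= rh * q0.
  by have := big cc sg_cc; move: sc7 rq; clear; lra.
have [c_hi c_lo] := truncn_half rq2.
set c := Num.truncn (rh * q0) in c_hi c_lo.
have c_rho : c%:R <= rh * #|A0|%:R by rewrite -q0E.
have rq4 : rh * q0 <= q0 / 4.
  have : rh * q0 <= 1 / 4 * q0 by rewrite ler_wpM2r // ltW.
  by clear; lra.
have c_a0 : (2 * c + r <= #|A0|)%N.
  by rewrite -(ler_nat R) natrD natrM -q0E; move: c_hi rq4 r_hi sc5 q0_lo q00 a1N0; clear; lra.
have gs : ga * u <= c%:R * (u / N).
  have h1 : ga * N <= c%:R by rewrite gaE; move: c_lo rq; clear; lra.
  have -> : ga * u = ga * N * (u / N) by field; rewrite gt_eqF.
  by rewrite ler_wpM2r //; case/andP: s01.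
have small : 4 * ((1 + N * (1 - u / N) ^+ c) ^+ n - 1) <= 1.
  apply: (hall_error s01 gs); rewrite -/N -u8 -exprM.
  by apply: dec5; move: uB6 B6E B30 B50 kq0 k20; clear; lra.
have u2 : 1 <= u ^+ 2 by rewrite exprn_ege1.
have tz : 0 <= (3 * expR 1 + 1) * u ^+ 2.
  by rewrite mulr_ge0 ?exprn_ge0 //; move: e1_0; clear; lra.
have /andP[t_lo t_hi] := truncn_itv tz.
set t := (Num.truncn ((3 * expR 1 + 1) * u ^+ 2)).+1 in t_hi.
have t_hi2 : t%:R <= k2 * u ^+ 2.
  by rewrite /t -natr1 k2E; move: t_lo u2; clear; lra.
have key := @rainbow_prob_ge R n V T G0 (C / N) rh (u / N) (th / 8) (expR 1) d e r m L w h kf a b c t A0 B0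
  cV n3 T_tree degT d_gt0 leaves' m_gt0 ltac:(by rewrite p_ge0) s01 x01 y1 disAB cAB reg' L4 hN part_ok
  a0m Lm em kfa e_gt0 er arw brk r_rho c_rho c_a0 small.
rewrite pE; apply: le_trans key.
have k1 : 1 <= n.-1%:R :> R by rewrite ler1n; move: n1; clear; lia.
have kN : n.-1%:R <= N by rewrite ler_nat leq_pred.
have k3 : 0 < 3 * n.-1%:R :> R by move: k1; clear; lra.
have P01 : 0 <= C / N / (3 * n.-1%:R) <= 1.
  rewrite divr_ge0 ?(ltW k3) //= ler_pdivrMr // mul1r; move: k1 p_le1; clear; lra.
have Pbig : 4 * n%:R <= C / N / (3 * n.-1%:R) * (e * e * e)%:R.
  have C96 : 96 <= C * sg ^+ 3 by rewrite -ler_pdivrMr.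
  have e3 : (sg * N / 2) ^+ 3 <= (e * e * e)%:R.
    rewrite !natrM -!expr2 -exprSr lerXn2r ?nnegrE //; move: Nsg; clear; lra.
  have e3_0 : 0 <= (sg * N / 2) ^+ 3 by rewrite exprn_ge0 //; move: Nsg; clear; lra.
  apply: (@le_trans _ _ (C / N / (3 * N) * (sg * N / 2) ^+ 3)).
    have -> : C / N / (3 * N) * (sg * N / 2) ^+ 3 = C * sg ^+ 3 * N / 24 by field; rewrite gt_eqF.
    have : 96 * N <= C * sg ^+ 3 * N by rewrite ler_wpM2r // ltW.
    by rewrite -/N; clear; lra.
  apply: ler_pM => //; first by rewrite divr_ge0 // mulr_ge0 // ltW.
  rewrite ler_wpM2l // lef_pV2 ?posrE ?k3 ?mulr_gt0 //; move: kN; clear; lra.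
have E1 := dense_error P01 Pbig.
have thab : th * n%:R * (3 * n%:R) <= (a * b)%:R.
  rewrite natrM -/N; apply: (@le_trans _ _ ((om / 4 * N / 2) * (a1 / 16 * N / 2))).
    have -> : om / 4 * N / 2 * (a1 / 16 * N / 2) = om * a1 * (N * N) / 256 by field.
    by rewrite -th768; clear; lra.
  apply: ler_pM => //.
    by rewrite mulr_ge0 // mulr_ge0 ?(ltW N0) // mulr_ge0 ?(ltW om0) // invr_ge0.
  by rewrite mulr_ge0 // mulr_ge0 ?(ltW N0) // mulr_ge0 ?(ltW a10) // invr_ge0.
have rth : r%:R <= th ^+ 2 / 64 * n%:R by apply: (le_trans r_hi); apply: scale.
have E2 := reserve_error n1 th01 rth thab.
have E3 := matching_error1 n1 u0 (ltW t_hi).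
have u4_u : u <= u ^+ 4 by rewrite exprS ler_peMr // exprn_ege1.
have k2u : 6 * k2 <= u ^+ 4 by move: u4_u uB6 B6E B30 B50 kq0 k20; clear; lra.
have E4 := matching_error2 n1 u0 u8 t_hi2 (ltW k20) k2u.
have D1 : expR (- n%:R) <= ep / 64 by have := dec3 N NB3; rewrite expr0 !mul1r.
have D2 : n%:R * expR (- (th / 2 * n%:R)) <= ep / 16 by have := dec2 N NB2; rewrite expr1.
have D3 : expR (- u ^+ 2) <= ep / 64.
  have u2B : B3 <= u ^+ 2.
    have : u <= u ^+ 2 by rewrite expr2 ler_peMr.
    by move: uB6 B6E B30 B50 kq0 k20; clear; lra.
  by have := dec3 _ u2B; rewrite expr0 !mul1r.
have D4 : 384 * k2 / u ^+ 4 <= ep / 8.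
  have u4 : 0 < u ^+ 4 by rewrite exprn_gt0.
  have ep8 : 0 < ep / 8 by move: ep0; clear; lra.
  rewrite ler_pdivrMr // [ep / 8 * _]mulrC -ler_pdivrMr // -kqE.
  by move: u4_u uB6 B6E B30 B50 kq0 k20; clear; lra.
have F2 := le_trans E2 D2; have F4 := le_trans E4 D4; have F1 := le_trans E1 D1.
have total (x1 x2 x3 x4 x5 : R) : x1 <= ep / 64 -> x2 <= ep / 16 -> x4 <= ep / 8 ->
    x3 <= 8 * x5 -> x5 <= ep / 64 -> 1 - ep <= 1 - (x1 + 2 * x2) - (x3 + x4).
  by move: ep0; clear; lra.
exact: total F1 F2 F4 E3 D3.
Qed.

Lemma prob_rainbow_copy_ge0 (R : realType) (V : finType) (n : nat) (T : sgraph V)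
    (G0 : sgraph 'I_n) (p : R) :
  (0 <= p <= 1)%R -> (0 <= prob_rainbow_copy T G0 p)%R.
Proof.
move=> /andP[p0 p1]; apply: sumr_ge0 => H _; apply: mulr_ge0.
  by apply: prodr_ge0 => e _; case: ifP => _ //; rewrite subr_ge0.
by apply: sumr_ge0 => c _; apply: prodr_ge0 => e _; rewrite invr_ge0.
Qed.

Local Open Scope classical_set_scope.
Local Open Scope ring_scope.

Theorem theorem4p2 (R : realType) (zeta delta : R) (d : nat)
    (zeta01 : 0 < zeta < 1) (delta01 : 0 < delta < 1) (d_ge2 : (2 <= d)%N) :
  exists2 C0 : R, 0 < C0 &
  forall C : R, C0 <= C ->
  exists2 q : nat -> R, q n @[n --> \oo] --> (1 : R) &
  forall (n : nat) (V : finType) (T : sgraph V) (G0 : sgraph 'I_n),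
    #|V| = n ->
    is_tree T ->
    (forall v : V, (deg T v <= d)%N) ->
    zeta * n%:R <= #|leaves T|%:R ->
    (forall v : 'I_n, delta * n%:R <= (deg G0 v)%:R) ->
    q n <= prob_rainbow_copy T G0 (Num.min 1 (C / n%:R)).
Proof.
have [C0 C0_gt0 ev] := rainbow_eventually zeta01 delta01 d_ge2.
exists C0 => // C CC0; have C_gt0 : 0 < C by apply: lt_le_trans CC0.
(* The infimum over all admissible trees and graphs gives one sequence q; adjoining 1 keeps the set
   nonempty for those n that admit none. *)
pose probs (n : nat) : set R := [set x | x = 1 \/ exists (V : finType) (T : sgraph V) (G0 : sgraph 'I_n),
  [/\ #|V| = n, is_tree T, forall v : V, (deg T v <= d)%N, zeta * n%:R <= #|leaves T|%:R &
      (forall v : 'I_n, delta * n%:R <= (deg G0 v)%:R)] /\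
  x = prob_rainbow_copy T G0 (Num.min 1 (C / n%:R))].
have probs1 n : probs n 1 by left.
have probs_lb n : lbound (probs n) 0.
  move=> x [->//|[V [T [G0 [_ ->]]]]]; apply: prob_rainbow_copy_ge0.
  by rewrite le_min ge_min lexx ler01 divr_ge0 // ltW.
have probs_inf n : has_inf (probs n) by split; [exists 1 | exists 0].
exists (fun n => inf (probs n)); last first.
  move=> n V T G0 cV T_tree degT leavesT degG; apply: ge_inf; first by exists 0.
  by right; exists V, T, G0.
apply/cvgrPdist_le => ep ep0; have [B evB] := ev C CC0 ep ep0.
near=> n; have nB : B <= n%:R by near: n; exact: nbhs_infty_ger.
have le1 : inf (probs n) <= 1 by apply: ge_inf => //; exists 0.
have ge1 : 1 - ep <= inf (probs n).
  apply: lb_le_inf; first by exists 1.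
  move=> x [->|[V [T [G0 [[cV T_tree degT leavesT degG] ->]]]]]; first by rewrite gerBl ltW.
  exact: evB.
by rewrite ger0_norm ?subr_ge0 // lerBlDr addrC -lerBlDr.
Unshelve. all: by end_near.
Qed.
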